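(* Let $k$ be an odd positive integer, let $n=2k+1$, and let $M^n=\mathbb{R}^n/\Gamma\in\mathcal{F}_{CHD}$ be an $n$-dimensional flat manifold of the family described in the context, with its two spin structures $\alpha_+$ and $\alpha_-$. Let $c(k)=0$ if $\frac{k(k+1)}{2}$ is even and $c(k)=\frac12$ if $\frac{k(k+1)}{2}$ is odd. For $\epsilon=(\epsilon_1,\dots,\epsilon_k)\in\{-1,1\}^k$ put $\mu_\epsilon=\sum_{j=1}^k\epsilon_j j$ and $\nu(\epsilon)=\epsilon_1\cdots\epsilon_k$, and let $\mathcal{D}_+=\{\epsilon\in\{-1,1\}^k:\nu(\epsilon)=1\}$. The number $\frac{\mu_\epsilon}{2}+c(k)n$ is always an integer; for $r\in\{0,\dots,n-1\}$ let $$A_r^+=2\,\#\{\epsilon\in\mathcal{D}_+:\tfrac{\mu_\epsilon}{2}+c(k)n\equiv r \pmod n\},$$ $$A_r^-=2\,\#\{\epsilon\in\mathcal{D}_+:\tfrac{\mu_\epsilon}{2}+c(k)n+k\equiv r \pmod n\}.$$ Then the eta invariants of the Dirac operator of $M^n$ for the spin structures $\alpha_+$ and $\alpha_-$ are $$\eta_{M^n,\alpha_+}(0)=\sum_{r=1}^{n-1}A_r^+\left(1-\frac{2r}{n}\right),\qquad \eta_{M^n,\alpha_-}(0)=\sum_{r=0}^{n-1}A_r^-\left(1-\frac{2r+1}{n}\right).$$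
   Context: The family $\mathcal{F}_{CHD}$. Let $k\ge 0$ be an integer and $n=2k+1$. Let $a_1,\dots,a_n$ be a basis of $\mathbb{R}^n$ and let $A:\mathbb{R}^n\to\mathbb{R}^n$ be the linear map with $A(a_j)=a_{j+1}$ for $j<n-1$, $A(a_{n-1})=-a_1-\dots-a_{n-1}$, $A(a_n)=a_n$. Let $g(x)=A(x)+\frac1n a_n$ and let $\Gamma=\langle a_1,\dots,a_{n-1},g\rangle$ (the $a_j$ acting as translations). Equip $\mathbb{R}^n$ with an $A$-invariant scalar product for which there is an orthonormal basis $e_1,\dots,e_n$ with $e_1,\dots,e_{n-1}\in\mathrm{Span}[a_1,\dots,a_{n-1}]$, $e_n=a_n$ (in particular $a_n$ has norm 1), and, for $1\le j\le k$, $A(e_{2j-1})=\cos(2\pi j/n)e_{2j-1}+\sin(2\pi j/n)e_{2j}$ and $A(e_{2j})=-\sin(2\pi j/n)e_{2j-1}+\cos(2\pi j/n)e_{2j}$. An $n$-dimensional manifold $M\in\mathcal{F}_{CHD}$ is the closed flat manifold $M=\mathbb{R}^n/\Gamma$ with the induced metric. Spin structures. The Clifford algebra has $e_i^2=-1$ and $e_ie_j=-e_je_i$ for $i\ne j$; $\lambda:Spin(n)\to SO(n)$ is $\lambda(y)(x)=yxy^*$, where $(e_{j_1}\cdots e_{j_s})^*=e_{j_s}\cdots e_{j_1}$. Let $\beta=\pi/n$, $r_j=\cos(j\beta)+e_{2j-1}e_{2j}\sin(j\beta)$, $\alpha=r_1\cdots r_k$. Then $\lambda(\alpha)=A$. Put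 $\alpha_+=(-1)^{k(k+1)/2}\alpha$ and $\alpha_-=-\alpha_+$; these satisfy $\alpha_+^n=1$, $\alpha_-^n=-1$. The spin structure denoted $\alpha_\pm$ is given by the homomorphism $\widehat h:\Gamma\to Spin(n)$ with $\widehat h(a_j)=1$ for $j\le n-1$ and $\widehat h(g)=\alpha_\pm$, which lifts the holonomy homomorphism (linear part). Spinors. Let $g_1=\begin{pmatrix} i&0\\0&-i\end{pmatrix}$, $g_2=\begin{pmatrix}0&i\\ i&0\end{pmatrix}$, $T=\begin{pmatrix}0&-i\\ i&0\end{pmatrix}$, and let $\Sigma_{2k}=(\mathbb{C}^2)^{\otimes k}$. The Clifford action on $\Sigma_{2k}$ is: for $j\le n-1$, $e_j$ acts as $I\otimes\cdots\otimes I\otimes g_{\alpha(j)}\otimes T\otimes\cdots\otimes T$ with $[\frac{j-1}{2}]$ factors $T$, where $\alpha(j)=1$ for $j$ odd and $\alpha(j)=2$ for $j$ even; $e_n$ acts as $i\,T\otimes\cdots\otimes T$. Spinors on $M$ are the smooth maps $\phi:\mathbb{R}^n\to\Sigma_{2k}$ invariant under the $\Gamma$-action $(\gamma\phi)(x)=\widehat h(\gamma)\phi(\gamma^{-1}x)$, and the Dirac operator is $D\phi=\sum_{j=1}^n e_j\frac{\partial\phi}{\partial x_j}$, with $x_1,\dots,x_n$ the coordinates determined by $e_1,\dots,e_n$. Eta invariant. $\eta_M(z)$ is the meromorphic extension to $\mathbb{C}$ of $\sum_{\lambda\ne0}\mathrm{sgn}(\lambda)|\lambda|^{-z}$ ($\mathrm{Re}\,z$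 large), the sum being over nonzero eigenvalues of $D$ counted with multiplicity; it is regular at $0$, and the eta invariant is $\eta_M(0)$. The subscript $\alpha_\pm$ indicates the spin structure. *)

(* Defs.v *)
From HB Require Import structures.
From mathcomp Require Import all_boot all_order all_algebra.

Set Implicit Arguments.
Unset Strict Implicit.
Unset Printing Implicit Defensive.

Import Order.TTheory GRing.Theory Num.Theory.
Local Open Scope ring_scope.

(* The Clifford algebra of R^n with e_i^2 = -1.  An element is the family of its coordinates on the basis
   [e_S = e_(j1) * ... * e_(js)], S = {j1 < ... < js}.  One has
   [e_S * e_T = (-1)^q e_(S + T)], where S + T is the symmetric difference and q
   is the number of pairs (s, t) in S x T with t <= s: a transposition of
   distinct generators if t < s, a factor [e_s^2 = -1] if t = s. *)
Section Clifford.
Variables (R : comNzRingType) (n : nat).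
Implicit Types S T U : {set 'I_n}.

Definition symdiff S T : {set 'I_n} := (S :\: T) :|: (T :\: S).

Lemma in_symdiff S T i : (i \in symdiff S T) = (i \in S) (+) (i \in T).
Proof. by rewrite !inE; case: (i \in S); case: (i \in T). Qed.

Lemma symdiffA S T U : symdiff S (symdiff T U) = symdiff (symdiff S T) U.
Proof. by apply/setP => i; rewrite !in_symdiff addbA. Qed.

Lemma symdiffC S T : symdiff S T = symdiff T S.
Proof. by apply/setP => i; rewrite !in_symdiff addbC. Qed.

Lemma symdiffK S : cancel (symdiff S) (symdiff S).
Proof. by move=> T; apply/setP => i; rewrite !in_symdiff addKb. Qed.

Lemma symdiff0 S : symdiff S set0 = S.
Proof. by apply/setP => i; rewrite in_symdiff inE addbF. Qed.

Lemma symdiff_eq0 S T : (symdiff S T == set0) = (S == T).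
Proof.
apply/eqP/eqP => [/setP ST0|->]; apply/setP => i.
  by have := ST0 i; rewrite in_symdiff inE; do 2 case: (i \in _).
by rewrite in_symdiff inE addbb.
Qed.

Definition blade_sign S T : R :=
  \prod_(s : 'I_n) \prod_(t : 'I_n) (-1) ^+ [&& s \in S, t \in T & (t <= s)%N].

Lemma blade_signDl S T U :
  blade_sign (symdiff S T) U = blade_sign S U * blade_sign T U.
Proof.
rewrite -big_split; apply: eq_bigr => s _; rewrite -big_split.
apply: eq_bigr => t _ /=; rewrite -signr_addb in_symdiff.
by do 3 case: (_ \in _); case: (_ <= _)%N.
Qed.

Lemma blade_signDr S T U :
  blade_sign S (symdiff T U) = blade_sign S T * blade_sign S U.
Proof.
rewrite -big_split; apply: eq_bigr => s _; rewrite -big_split.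
apply: eq_bigr => t _ /=; rewrite -signr_addb in_symdiff.
by do 3 case: (_ \in _); case: (_ <= _)%N.
Qed.

Lemma blade_sign0l S : blade_sign set0 S = 1.
Proof.
by rewrite /blade_sign big1 // => s _; rewrite big1 // => t _; rewrite inE.
Qed.

Lemma blade_sign0r S : blade_sign S set0 = 1.
Proof.
by rewrite /blade_sign big1 // => s _; rewrite big1 // => t _; rewrite inE /= andbF.
Qed.

Lemma blade_sign1 (i j : 'I_n) :
  blade_sign [set i] [set j] = (-1) ^+ (j <= i)%N.
Proof.
rewrite /blade_sign (bigD1 i) //= (bigD1 j) //= !inE !eqxx /=.
rewrite !big1 ?mulr1 // => [s /negPf si|t /negPf tj].
  by rewrite big1 // => t _; rewrite !inE si.
by rewrite !inE tj.
Qed.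

Definition clifford : Type := {ffun {set 'I_n} -> R}.

Definition cl_fun (x : clifford) : {ffun {set 'I_n} -> R} := x.
Coercion cl_fun : clifford >-> finfun_of.

HB.instance Definition _ := GRing.Lmodule.copy clifford {ffun {set 'I_n} -> R^o}.

Implicit Types x y z : clifford.

Lemma cliffordP x y : (forall U, x U = y U) -> x = y.
Proof. by move=> xy; apply/ffunP. Qed.

Definition blade S : clifford := [ffun U => (U == S)%:R].

Definition cl_mul x y : clifford :=
  [ffun U => \sum_S blade_sign S (symdiff S U) * x S * y (symdiff S U)].

Lemma cl_mulE x y U :
  cl_mul x y U = \sum_S blade_sign S (symdiff S U) * x S * y (symdiff S U).
Proof. by rewrite /cl_fun ffunE. Qed.

Lemma bladeE S U : blade S U = (U == S)%:R.
Proof. by rewrite /cl_fun ffunE. Qed.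

Lemma cl_addE x y U : (x + y) U = x U + y U.
Proof. by rewrite /cl_fun ffunE. Qed.

Lemma cl_scaleE (c : R) x U : (c *: x) U = c * x U.
Proof. by rewrite /cl_fun ffunE. Qed.

Lemma cl_mulA : associative cl_mul.
Proof.
move=> x y z; apply: cliffordP => U; rewrite !cl_mulE.
under eq_bigr => S _ do rewrite cl_mulE mulr_sumr.
under [RHS]eq_bigr => V _ do rewrite cl_mulE mulr_sumr mulr_suml.
rewrite [RHS]exchange_big /=; apply: eq_bigr => S _.
rewrite [RHS](reindex_inj (can_inj (symdiffK S))) /=.
apply: eq_bigr => T _; rewrite symdiffK !symdiffA (symdiffC T S).
set W := symdiff (symdiff S T) U.
have -> : symdiff S U = symdiff T W.
  by apply/setP => i; rewrite !in_symdiff; do 3 case: (i \in _).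
rewrite blade_signDl blade_signDr.
set a := blade_sign S T; set b := blade_sign S W; set c := blade_sign T W.
by rewrite !mulrA (mulrAC _ (x S)) [b * c * a]mulrC !mulrA.
Qed.

Lemma cl_mul1l : left_id (blade set0) cl_mul.
Proof.
move=> x; apply: cliffordP => U; rewrite cl_mulE (bigD1 set0) //= big1 => [|S S0].
  by rewrite bladeE eqxx blade_sign0l symdiffC symdiff0 !mul1r addr0.
by rewrite bladeE (negPf S0) mulr0 mul0r.
Qed.

Lemma cl_mul1r : right_id (blade set0) cl_mul.
Proof.
move=> x; apply: cliffordP => U; rewrite cl_mulE (bigD1 U) //= big1 => [|S SU].
  have /eqP -> : symdiff U U == set0 by rewrite symdiff_eq0.
  by rewrite bladeE eqxx blade_sign0r mul1r mulr1 addr0.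
by rewrite bladeE symdiff_eq0 (negPf SU) mulr0.
Qed.

Lemma cl_mulDl : left_distributive cl_mul +%R.
Proof.
move=> x y z; apply: cliffordP => U; rewrite cl_addE !cl_mulE -big_split.
by apply: eq_bigr => S _; rewrite cl_addE mulrDr mulrDl.
Qed.

Lemma cl_mulDr : right_distributive cl_mul +%R.
Proof.
move=> x y z; apply: cliffordP => U; rewrite cl_addE !cl_mulE -big_split.
by apply: eq_bigr => S _; rewrite cl_addE mulrDr.
Qed.

Lemma cl_one_neq0 : blade set0 != 0.
Proof.
apply/eqP => /(congr1 (fun x : clifford => x set0)).
by rewrite bladeE eqxx /cl_fun ffunE => /eqP; rewrite oner_eq0.
Qed.

HB.instance Definition _ := GRing.Zmodule_isNzRing.Build clifford
  cl_mulA cl_mul1l cl_mul1r cl_mulDl cl_mulDr cl_one_neq0.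

Lemma cl_scaleAl (c : R) x y : c *: (x * y) = (c *: x) * y.
Proof.
apply: cliffordP => U; rewrite cl_scaleE !cl_mulE mulr_sumr.
by apply: eq_bigr => S _; rewrite cl_scaleE (mulrCA _ c) !mulrA.
Qed.

Lemma cl_scaleAr (c : R) x y : c *: (x * y) = x * (c *: y).
Proof.
apply: cliffordP => U; rewrite cl_scaleE !cl_mulE mulr_sumr.
by apply: eq_bigr => S _; rewrite cl_scaleE mulrCA.
Qed.

HB.instance Definition _ :=
  GRing.Lmodule_isLalgebra.Build R clifford cl_scaleAl.
HB.instance Definition _ :=
  GRing.Lalgebra_isAlgebra.Build R clifford cl_scaleAr.

Definition cl_gen (i : 'I_n) : clifford := blade [set i].

Lemma blade_mul S T : blade S * blade T = blade_sign S T *: blade (symdiff S T).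
Proof.
apply: cliffordP => U; rewrite cl_scaleE cl_mulE bladeE.
rewrite (bigD1 S) //= big1 => [|V VS]; last by rewrite bladeE (negPf VS) mulr0 mul0r.
rewrite !bladeE eqxx mulr1 addr0 -(can_eq (symdiffK S)) symdiffK.
case: eqP => [->|]; last by rewrite !mulr0.
by rewrite symdiffK.
Qed.

Lemma cl_gen_sq i : cl_gen i * cl_gen i = - 1.
Proof.
rewrite /cl_gen blade_mul blade_sign1 leqnn scaleN1r.
by have /eqP -> : symdiff [set i] [set i] == set0 by rewrite symdiff_eq0.
Qed.

Lemma cl_gen_anti i j : i != j -> cl_gen i * cl_gen j = - (cl_gen j * cl_gen i).
Proof.
move=> ij; rewrite /cl_gen !blade_mul !blade_sign1 -scaleNr symdiffC.
congr (_ *: _); have : (i : nat) != j by [].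
by rewrite neq_ltn; case: ltngtP => // _ _; rewrite ?expr1 ?expr0 ?opprK.
Qed.

(* [(e_(j1) * ... * e_(js))^* = e_(js) * ... * e_(j1)]; the reordering of the s
   generators takes s(s-1)/2 transpositions. *)
Definition cl_rev x : clifford := [ffun S : {set 'I_n} => (-1) ^+ 'C(#|S|, 2) * x S].

End Clifford.

From mathcomp Require Import finmap sesquilinear complex.
From mathcomp Require Import all_classical all_reals all_analysis.
From mathcomp Require summability.
Import numFieldNormedType.Exports.
Local Open Scope complex_scope.
Local Open Scope classical_set_scope.

(* [R[i]] packed as a [numFieldType], so that it inherits the norm, topology and
   normed module structure over itself; for [f : CC R -> CC R],
   [derivable f z 1] is then complex differentiability at z. *)
Definition CC (R : realType) : numFieldType := R[i].

Section ComplexFunctions.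
Variable R : realType.
Implicit Types (f : CC R -> CC R) (p z : CC R).

(* x^z = exp (z ln x), for x > 0 *)
Definition cpowR (x : R) z : CC R :=
  (expR (complex.Re z * ln x))%:C *
  (cos (complex.Im z * ln x) +i* sin (complex.Im z * ln x)).

Definition holomorphic_at f p := \forall z \near p, derivable f z 1.

Definition meromorphic f := forall p, exists (m : nat) (g : CC R -> CC R),
  holomorphic_at g p /\ \forall z \near p^', f z = g z / (z - p) ^+ m.

End ComplexFunctions.

Section Flat.
Variables (R : realType) (k : nat).

Local Notation n := k.*2.+1.
Local Notation V := 'cV[R]_n.
Local Notation Cl := (clifford R n).

(* the j-th element of 'I_n, counted from 1 *)
Definition ix (j : nat) : 'I_n := inord j.-1.

(* [chd_A_wrap] needs a guard: for k = 0 there is no a_(n-1). *)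
Record CHD := {
  chd_a : 'I_n -> V;
  chd_basis : basis_of fullv [seq chd_a i | i <- enum 'I_n];
  chd_A : 'M[R]_n;
  chd_A_shift : forall j, (1 <= j < n.-1)%N ->
    chd_A *m chd_a (ix j) = chd_a (ix j.+1);
  chd_A_wrap : (0 < k)%N ->
    chd_A *m chd_a (ix n.-1) = - \sum_(1 <= j < n) chd_a (ix j);
  chd_A_last : chd_A *m chd_a (ix n) = chd_a (ix n);
  chd_dot : {dot V for idfun};
  chd_dot_A : forall u v, chd_dot (chd_A *m u) (chd_A *m v) = chd_dot u v;
  chd_e : 'I_n -> V;
  chd_e_orthonormal : forall i j, chd_dot (chd_e i) (chd_e j) = (i == j)%:R;
  chd_e_span : forall j, (1 <= j < n)%N ->
    chd_e (ix j) \in <<[seq chd_a (ix i) | i <- iota 1 n.-1]>>%VS;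
  chd_e_last : chd_e (ix n) = chd_a (ix n);
  chd_A_odd : forall j, (1 <= j <= k)%N ->
    chd_A *m chd_e (ix j.*2.-1) =
      cos (2 * pi * j%:R / n%:R) *: chd_e (ix j.*2.-1)
      + sin (2 * pi * j%:R / n%:R) *: chd_e (ix j.*2);
  chd_A_even : forall j, (1 <= j <= k)%N ->
    chd_A *m chd_e (ix j.*2) =
      - sin (2 * pi * j%:R / n%:R) *: chd_e (ix j.*2.-1)
      + cos (2 * pi * j%:R / n%:R) *: chd_e (ix j.*2)
}.

(* The pair (L, t) stands for the affine map x |-> L x + t. *)
Definition affine := ('M[R]_n * V)%type.
Definition aff_app (g : affine) (x : V) : V := g.1 *m x + g.2.
Definition aff_id : affine := (1%:M, 0).
Definition aff_comp (g h : affine) : affine := (g.1 *m h.1, g.1 *m h.2 + g.2).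
Definition aff_inv (g : affine) : affine :=
  (invmx g.1, - (invmx g.1 *m g.2)).
Definition translation (v : V) : affine := (1%:M, v).

Definition chd_g (M : CHD) : affine := (chd_A M, n%:R^-1 *: chd_a M (ix n)).

Inductive Gamma (M : CHD) : affine -> Prop :=
| Gamma_id : Gamma M aff_id
| Gamma_a j : (1 <= j < n)%N -> Gamma M (translation (chd_a M (ix j)))
| Gamma_g : Gamma M (chd_g M)
| Gamma_comp g h : Gamma M g -> Gamma M h -> Gamma M (aff_comp g h)
| Gamma_inv g : Gamma M g -> Gamma M (aff_inv g).

Definition spin_group (y : Cl) : Prop := exists s : seq V,
  [/\ ~~ odd (size s),
      forall v, v \in s -> \sum_i v i 0 ^+ 2 = 1 &
      y = \prod_(v <- s) \sum_i v i 0 *: cl_gen R i].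

(* R^n -> Cl(n), identifying the frame [chd_e] with the generators *)
Definition cl_vec (M : CHD) (x : V) : Cl :=
  \sum_i chd_dot M x (chd_e M i) *: cl_gen R i.

Definition rotor (j : nat) : Cl :=
  cos (j%:R * (pi / n%:R)) *: 1
  + sin (j%:R * (pi / n%:R)) *: (cl_gen R (ix j.*2.-1) * cl_gen R (ix j.*2)).

Definition alpha : Cl := \prod_(1 <= j < k.+1) rotor j.
Definition alpha_plus : Cl := (-1) ^+ (k * k.+1)./2 * alpha.
Definition alpha_minus : Cl := - alpha_plus.

(* [h] is a homomorphism Gamma -> Spin(n) trivial on the translations
   a_1, ..., a_(n-1), mapping g to [y], and lifting the linear part through
   [lambda (y) x = y x y^*]; its values outside Gamma are irrelevant. *)
Definition spin_structure (M : CHD) (y : Cl) (h : affine -> Cl) : Prop :=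
  [/\ forall g, Gamma M g -> spin_group (h g),
      forall g g', Gamma M g -> Gamma M g' -> h (aff_comp g g') = h g * h g',
      forall j, (1 <= j < n)%N -> h (translation (chd_a M (ix j))) = 1,
      h (chd_g M) = y &
      forall g x, Gamma M g ->
        h g * cl_vec M x * cl_rev (h g) = cl_vec M (g.1 *m x)].

(* The spinor space, k-th tensor power of C^2: coordinates are indexed by
   multi-indices in {0,1}^k. *)
Definition spinor := {ffun {ffun 'I_k -> 'I_2} -> CC R}.

(* the operator [m 0 (x) ... (x) m (k-1)] *)
Definition tensor_op (m : 'I_k -> 'M[CC R]_2) (w : spinor) : spinor :=
  [ffun I : {ffun 'I_k -> 'I_2} =>
    \sum_(J : {ffun 'I_k -> 'I_2}) (\prod_s m s (I s) (J s)) * w J].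

Definition mx22 (a b c d : CC R) : 'M[CC R]_2 :=
  \matrix_(i, j) (if i == 0 then if j == 0 then a else b
                  else if j == 0 then c else d).
Definition mx_g1 := mx22 'i 0 0 (- 'i).
Definition mx_g2 := mx22 0 'i 'i 0.
Definition mx_T := mx22 0 (- 'i) 'i 0.

(* Clifford action of the i-th basis vector (i from 0, so that e_j is i = j-1 and
   [[(j-1)/2] = i./2]).  For i < n-1 the i./2 last tensor factors are T. *)
Definition gamma (i : 'I_n) (w : spinor) : spinor :=
  if i == ord_max then ('i : CC R) *: tensor_op (fun=> mx_T) w
  else tensor_op (fun s : 'I_k =>
         if (s + i./2 < k.-1)%N then 1%:M
         else if (s + i./2 == k.-1)%N then (if odd i then mx_g2 else mx_g1)
         else mx_T) w.

(* [enum S] is increasing: e_S acts as gamma_(j1) o ... o gamma_(js). *)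
Definition cl_act (y : Cl) (w : spinor) : spinor :=
  \sum_(S : {set 'I_n}) ((y S)%:C : CC R) *: foldr gamma w (enum S).

Fixpoint Cm (m : nat) (f : V -> R) : Prop :=
  if m is m'.+1 then
    (forall v x, derivable f x v) /\ (forall v, Cm m' (fun x => 'D_v f x))
  else continuous f.

Definition smooth (phi : V -> spinor) : Prop := forall m I,
  Cm m (fun x => complex.Re (phi x I)) /\ Cm m (fun x => complex.Im (phi x I)).

Definition spinor_derive (v : V) (phi : V -> spinor) (x : V) : spinor :=
  [ffun I => ('D_v (fun y => complex.Re (phi y I)) x)
             +i* ('D_v (fun y => complex.Im (phi y I)) x)].

(* spinor fields on the quotient of R^n by Gamma *)
Definition spinor_field (M : CHD) (h : affine -> Cl) (phi : V -> spinor) :=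
  smooth phi /\
  forall g, Gamma M g ->
    forall x, cl_act (h g) (phi (aff_app (aff_inv g) x)) = phi x.

Definition dirac_op (M : CHD) (phi : V -> spinor) (x : V) : spinor :=
  \sum_i gamma i (spinor_derive (chd_e M i) phi x).

(* The Dirac operator is symmetric, so its eigenvalues are real. *)
Definition eigenspinors (M : CHD) (h : affine -> Cl) (l : R) : set (V -> spinor) :=
  [set phi | spinor_field M h phi /\
             forall x, dirac_op M phi x = (l%:C : CC R) *: phi x].

Definition has_dim (E : set (V -> spinor)) (d : nat) : Prop :=
  exists b : 'I_d -> V -> spinor, (forall i, E (b i)) /\
    forall phi, E phi ->
      exists! c : 'rV[CC R]_d, forall x, phi x = \sum_i c 0 i *: b i x.

Definition eta_term (m : nat) (l : R) (z : CC R) : CC R :=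
  (m%:R : CC R) * ((Num.sg l)%:C : CC R) * cpowR `|l| (- z).

(* [v] is the value at 0 of the meromorphic extension [eta] of the eta series;
   [mult l] is the multiplicity of the eigenvalue l (it is 0 when l is not an
   eigenvalue).  The series is the unconditional sum, i.e. the limit along the
   directed set of finite sets of reals.  By the identity theorem there is at
   most one such [v]. *)
Definition eta_invariant (M : CHD) (h : affine -> Cl) (v : CC R) : Prop :=
  exists (mult : R -> nat) (eta : CC R -> CC R),
  [/\ forall l, l != 0 -> has_dim (eigenspinors M h l) (mult l),
      exists sigma : R, forall z : CC R, sigma < complex.Re z ->
        (fun L : {fset R} => \sum_(l <- L | l != 0) eta_term (mult l) l z)
        @ summability.totally --> eta z,
      meromorphic eta,
      holomorphic_at eta 0 &
      eta 0 = v].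

End Flat.

Section Counting.
Variable k : nat.

(* [eps : {ffun 'I_k -> bool}] encodes the sign vector (epsilon_1, ..., epsilon_k)
   with [epsilon_(i+1) = (-1) ^+ eps i]. *)
Implicit Type eps : {ffun 'I_k -> bool}.

Definition mu eps : int := \sum_(i < k) (-1) ^+ eps i * (i.+1)%:Z.
Definition nu eps : int := \prod_(i < k) (-1) ^+ eps i.
Definition D_plus := [set eps : {ffun 'I_k -> bool} | nu eps == 1]%SET.

Definition c_k : rat := if odd ((k * k.+1)./2) then 1 / 2 else 0.

Definition half_mu eps : rat := (mu eps)%:~R / 2 + c_k * (k.*2.+1)%:R.

Definition rat_congr (m : nat) (x y : rat) : bool :=
  (x - y) / m%:R \is a Num.int.

Definition A_plus (r : nat) : nat :=
  (2 * #|[set eps in D_plus | rat_congr k.*2.+1 (half_mu eps) r%:R]%SET|)%N.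
Definition A_minus (r : nat) : nat :=
  (2 * #|[set eps in D_plus | rat_congr k.*2.+1 (half_mu eps + k%:R) r%:R]%SET|)%N.

End Counting.

(* Main.v *)
(* Let delta = 0 for alpha_+ and 1/2 for alpha_-. By Fourier analysis an eigenspinor for the
   eigenvalue l is a finite sum of e^(2 pi i th(x)) c_th, where th is a linear form with
   th(a_j) in Z for j < n, th(a_n) in Z + delta and 2 pi |th| = |l|; the eigenvalue equation
   becomes 2 pi i u c_th = l c_th, u being the vector dual to th, and invariance under g
   relates c_(th A) to c_th through alpha. Clifford multiplication by the vector
   w = |th|^2 e_n - th(e_n) u, which is orthogonal to u, anticommutes with u and is compatible
   with A, so that the forms th which are not multiples of <e_n, .> contribute equally to the
   multiplicities of l and -l. On this axis alpha and e_n are simultaneously diagonal, the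
   eigenvalues of alpha being e^(- i pi mu_eps / n), and the contribution to the multiplicity
   of 2 pi (r + delta) is A_r. The eta series is therefore sum_m chi(m) (c (1 + d m))^(-z)
   with chi of period n and zero sum over a period; summation by parts extends it to an entire
   function whose value at 0 is the mean of the partial sums of chi over a period. *)

From HB Require Import structures.
Require Import Defs.
From mathcomp Require Import all_boot all_order all_algebra.
From mathcomp Require Import finmap complex ring lra zify.
From mathcomp Require Import all_classical all_reals all_analysis.
From mathcomp Require Import sesquilinear.
From mathcomp Require summability.

Set Implicit Arguments.
Unset Strict Implicit.
Unset Printing Implicit Defensive.

Import Order.TTheory GRing.Theory Num.Theory.
Import numFieldNormedType.Exports.
Local Open Scope ring_scope.
Local Open Scope complex_scope.
Local Open Scope classical_set_scope.
Local Notation Re := complex.Re.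
Local Notation Im := complex.Im.

(** * Complex-valued functions of a real parameter *)

Section ComplexModulus.
Variable R : realType.
Local Notation C := (CC R).
Implicit Types (z w : C) (x y : R).

(** Spinor fields are only known to be smooth and quasi-periodic. Fourier coefficients are therefore
    taken with a mean defined on every bounded function, and smoothness enters through a single
    second order Taylor bound, uniform on R^n because the derivatives of a quasi-periodic function
    are bounded by compactness. Squaring the eigenvalue equation confines an eigenspinor to finitely
    many characters, so eigenspaces become spaces of finite families of coefficients; off the axis
    their dimensions are compared, not computed. The factor 2 and the condition nu = 1 in A_r
    reflect that k is odd: changing all signs of eps reverses both nu and mu, which identifies the
    contributions of th and - th. The constant c(k) writes the sign (-1)^(k(k+1)/2) as e^(-2 pi i
    c(k)). Modulo n, negation turns one family of eigenvalues into the other, so that chi(m) is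
    A_(m+1) - A_(n-1-m) for alpha_+ and A_m - A_(n-1-m) for alpha_-; hence its zero sum over a
    period. Unconditional convergence is asked for in some half-plane only, so a crude count of
    characters, with exponent 2n, is enough. *)

Definition cabs z : R := Normc.normc z.

(** The norm of [CC R] has its values in [CC R] itself; estimates are made with the real-valued
    [cabs], and this identity transfers them. *)
Lemma normCC z : `|z| = (cabs z)%:C. Proof. by []. Qed.

Lemma cabs_ge0 z : 0 <= cabs z.
Proof. by case: z => a b; exact: sqrtr_ge0. Qed.

Lemma cabsM z w : cabs (z * w) = cabs z * cabs w.
Proof. exact: Normc.normcM. Qed.

Lemma cabsD z w : cabs (z + w) <= cabs z + cabs w.
Proof. exact: (@le_normcD _ z w). Qed.

Lemma cabsN z : cabs (- z) = cabs z.
Proof. exact: (@normcN _ z). Qed.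

Lemma cabsB z w : cabs (z - w) <= cabs z + cabs w.
Proof. by rewrite -(cabsN w) cabsD. Qed.

Lemma cabs_distC z w : cabs (z - w) = cabs (w - z).
Proof. by rewrite -cabsN opprB. Qed.

Lemma cabs0 : cabs 0 = 0. Proof. exact: Normc.normc0. Qed.

Lemma cabs1 : cabs 1 = 1. Proof. exact: Normc.normc1. Qed.

Lemma cabs0_eq0 z : cabs z = 0 -> z = 0.
Proof. exact: Normc.eq0_normc. Qed.

Lemma cabsE z : cabs z = Num.sqrt (Re z ^+ 2 + Im z ^+ 2).
Proof. by case: z. Qed.

Lemma cabsX z n : cabs (z ^+ n) = cabs z ^+ n.
Proof. by elim: n => [|n IH]; rewrite ?expr0 ?cabs1 // !exprS cabsM IH. Qed.

Lemma cabsR x : cabs x%:C = `|x|.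
Proof. by rewrite cabsE /= expr0n /= addr0 sqrtr_sqr. Qed.

Lemma cabs_nat n : cabs (n%:R) = n%:R.
Proof.
have -> : (n%:R : C) = (n%:R : R)%:C by rewrite (rmorph_nat (real_complex R)).
by rewrite cabsR ger0_norm.
Qed.

Lemma cabsi : cabs 'i = 1.
Proof. by rewrite cabsE /= expr0n /= add0r expr1n sqrtr1. Qed.

Lemma cabs_sum (I : Type) (r : seq I) (P : pred I) (F : I -> C) :
  cabs (\sum_(i <- r | P i) F i) <= \sum_(i <- r | P i) cabs (F i).
Proof.
elim/big_rec2: _ => [|i y z _ H]; first by rewrite cabs0.
by apply: (le_trans (cabsD _ _)); rewrite lerD2l.
Qed.

Lemma cabs_geRe z : `|Re z| <= cabs z.
Proof. by have := normc_ge_Re z; rewrite normCC lecR. Qed.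

Lemma cabs_geIm z : `|Im z| <= cabs z.
Proof.
have -> : Im z = - Re (z * 'i) by rewrite ReiNIm opprK.
by rewrite normrN (le_trans (cabs_geRe _)) // cabsM cabsi mulr1.
Qed.

Lemma cabs_leReIm z : cabs z <= `|Re z| + `|Im z|.
Proof.
rewrite {1}(complexE z); apply: le_trans (cabsD _ _) _.
by rewrite cabsM cabsi mul1r !cabsR.
Qed.

Lemma ReD z w : Re (z + w) = Re z + Re w. Proof. by case: z; case: w. Qed.
Lemma ImD z w : Im (z + w) = Im z + Im w. Proof. by case: z; case: w. Qed.
Lemma ReN z : Re (- z) = - Re z. Proof. by case: z. Qed.
Lemma ImN z : Im (- z) = - Im z. Proof. by case: z. Qed.
Lemma ReB z w : Re (z - w) = Re z - Re w. Proof. by rewrite ReD ReN. Qed.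
Lemma ImB z w : Im (z - w) = Im z - Im w. Proof. by rewrite ImD ImN. Qed.
Lemma RecM z w : Re (z * w) = Re z * Re w - Im z * Im w.
Proof. by case: z; case: w. Qed.
Lemma ImcM z w : Im (z * w) = Re z * Im w + Im z * Re w.
Proof. by case: z; case: w. Qed.
Lemma ReIm_eq z w : Re z = Re w -> Im z = Im w -> z = w.
Proof. by case: z; case: w => /= a b c d -> ->. Qed.
Lemma Re_sum (I : Type) (r : seq I) (P : pred I) (F : I -> C) :
  Re (\sum_(i <- r | P i) F i) = \sum_(i <- r | P i) Re (F i).
Proof. by elim/big_rec2: _ => [|i y z _ <-] //; rewrite ReD. Qed.
Lemma Im_sum (I : Type) (r : seq I) (P : pred I) (F : I -> C) :
  Im (\sum_(i <- r | P i) F i) = \sum_(i <- r | P i) Im (F i).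
Proof. by elim/big_rec2: _ => [|i y z _ <-] //; rewrite ImD. Qed.

Definition cexp z : C := (expR (Re z))%:C * (cos (Im z) +i* sin (Im z)).

Lemma Re_cexp z : Re (cexp z) = expR (Re z) * cos (Im z).
Proof. by rewrite RecM /= mul0r subr0. Qed.

Lemma Im_cexp z : Im (cexp z) = expR (Re z) * sin (Im z).
Proof. by rewrite ImcM /= mul0r addr0. Qed.

Lemma cexpD z w : cexp (z + w) = cexp z * cexp w.
Proof.
apply: ReIm_eq; rewrite [in LHS](Re_cexp, Im_cexp) ReD ImD expRD (cosD, sinD).
  by rewrite [RHS]RecM !Re_cexp !Im_cexp; ring.
by rewrite [RHS]ImcM !Re_cexp !Im_cexp; ring.
Qed.

Lemma cexp0 : cexp 0 = 1.
Proof.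
by apply: ReIm_eq; rewrite ?Re_cexp ?Im_cexp /= expR0 ?cos0 ?sin0 mul1r.
Qed.

Lemma cabs_cexp z : cabs (cexp z) = expR (Re z).
Proof.
rewrite cabsM cabsR ger0_norm ?expR_ge0 // cabsE /= cos2Dsin2 sqrtr1.
by rewrite mulr1.
Qed.

Lemma cexpN z : cexp (- z) = (cexp z)^-1.
Proof.
have h : cexp z * cexp (- z) = 1 by rewrite -cexpD subrr cexp0.
have nz : cexp z != 0 by apply/eqP => z0; move: h; rewrite z0 mul0r => /eqP; rewrite eq_sym oner_eq0.
by apply: (mulfI nz); rewrite h divff.
Qed.

Lemma cexp_neq0 z : cexp z != 0.
Proof.
apply/eqP => z0; have := cabs_cexp z; rewrite z0 cabs0 => /eqP.
by rewrite eq_sym expR_eq0.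
Qed.

Lemma cpowRE (x : R) z : cpowR x z = cexp (z * (ln x)%:C).
Proof.
by rewrite /cpowR /cexp RecM ImcM /= !mulr0 subr0 add0r.
Qed.

Lemma Re_mulR z (x : R) : Re (z * x%:C) = Re z * x.
Proof. by rewrite RecM /= mulr0 subr0. Qed.

Lemma Im_mulR z (x : R) : Im (z * x%:C) = Im z * x.
Proof. by rewrite ImcM /= mulr0 add0r. Qed.

Lemma cabs_cpowR (x : R) z : cabs (cpowR x z) = expR (Re z * ln x).
Proof. by rewrite cpowRE cabs_cexp Re_mulR. Qed.

Lemma cpowRM (x y : R) z : 0 < x -> 0 < y -> cpowR (x * y) z = cpowR x z * cpowR y z.
Proof. by move=> x0 y0; rewrite !cpowRE lnM ?posrE// rmorphD mulrDr cexpD. Qed.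

Lemma cpowR0 (x : R) : cpowR x 0 = 1.
Proof. by rewrite cpowRE mul0r cexp0. Qed.

End ComplexModulus.

Section RealParameter.
Variable R : realType.
Local Notation C := (CC R).
Implicit Types (F G : R -> C) (x : R) (d e : C).

(** Componentwise, so that the real calculus of [is_derive] applies. *)
Definition cder (F : R -> C) (x : R) (d : C) :=
  is_derive x 1 (fun y => Re (F y)) (Re d) /\ is_derive x 1 (fun y => Im (F y)) (Im d).

Lemma is_derive_continuous (f : R -> R) (x d : R) : is_derive x 1 f d -> {for x, continuous f}.
Proof. by case=> h _; apply/differentiable_continuous/derivable1_diffP. Qed.

Lemma MVT_abs (f f' : R -> R) (a b B : R) : a <= b ->
  (forall x, a <= x <= b -> is_derive x 1 f (f' x)) ->
  (forall x, a <= x <= b -> `|f' x| <= B) -> `|f b - f a| <= B * (b - a).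
Proof.
move=> ab df bf.
have [x||c cab ->] := @MVT_segment R f f' a b ab.
- by rewrite in_itv /= => /andP[ax xb]; apply: df; rewrite !ltW.
- apply: continuous_in_subspaceT => x; rewrite inE /= in_itv /= => xab.
  exact: is_derive_continuous (df _ xab).
- have {}cab : a <= c <= b by move: cab; rewrite in_itv.
  by rewrite normrM (ger0_norm (_ : 0 <= b - a)) ?subr_ge0 // ler_wpM2r ?subr_ge0 // bf.
Qed.

(** The mean value theorem is applied to the real and imaginary parts separately, at different
    intermediate points; this costs the factor 2. *)
Lemma cMVT (F F' : R -> C) (a b B : R) : a <= b ->
  (forall x, a <= x <= b -> cder F x (F' x)) ->
  (forall x, a <= x <= b -> cabs (F' x) <= B) -> cabs (F b - F a) <= 2 * B * (b - a).
Proof.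
move=> ab dF bF; apply: le_trans (cabs_leReIm _) _; rewrite ReB ImB -mulrA mulr_natl mulr2n.
apply: lerD.
  apply: (@MVT_abs (fun x => Re (F x)) (fun x => Re (F' x))) => // x xab.
    by have [] := dF _ xab.
  exact: le_trans (cabs_geRe _) (bF _ xab).
apply: (@MVT_abs (fun x => Im (F x)) (fun x => Im (F' x))) => // x xab.
  by have [] := dF _ xab.
exact: le_trans (cabs_geIm _) (bF _ xab).
Qed.

Lemma cderD F G x d e : cder F x d -> cder G x e -> cder (fun y => F y + G y) x (d + e).
Proof.
move=> [F1 F2] [G1 G2]; rewrite /cder ReD ImD; split.
  rewrite [X in is_derive _ _ X _](_ : _ = (fun y => Re (F y)) + (fun y => Re (G y))).
    exact: is_deriveD.
  by apply/funext => y; rewrite ReD.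
rewrite [X in is_derive _ _ X _](_ : _ = (fun y => Im (F y)) + (fun y => Im (G y))).
  exact: is_deriveD.
by apply/funext => y; rewrite ImD.
Qed.

Lemma cderM F G x d e : cder F x d -> cder G x e ->
  cder (fun y => F y * G y) x (d * G x + F x * e).
Proof.
move=> [F1 F2] [G1 G2]; rewrite /cder; split.
  rewrite [X in is_derive _ _ X _](_ : _ =
    (fun y => Re (F y)) * (fun y => Re (G y)) - (fun y => Im (F y)) * (fun y => Im (G y))).
    apply: is_derive_eq (is_deriveB (is_deriveM F1 G1) (is_deriveM F2 G2)) _.
    by rewrite ReD !RecM /GRing.scale /=; ring.
  by apply/funext => y; rewrite RecM.
rewrite [X in is_derive _ _ X _](_ : _ =
    (fun y => Re (F y)) * (fun y => Im (G y)) + (fun y => Im (F y)) * (fun y => Re (G y))).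
  apply: is_derive_eq (is_deriveD (is_deriveM F1 G2) (is_deriveM F2 G1)) _.
  by rewrite ImD !ImcM /GRing.scale /=; ring.
by apply/funext => y; rewrite ImcM.
Qed.

Lemma cder_cst (c : C) x : cder (fun=> c) x 0.
Proof. by split => /=; [exact: (is_derive_cst (Re c))|exact: (is_derive_cst (Im c))]. Qed.

Lemma cderZ c F x d : cder F x d -> cder (fun y => c * F y) x (c * d).
Proof.
by move=> dF; have := cderM (cder_cst c x) dF; rewrite mul0r add0r.
Qed.

Lemma cderN F x d : cder F x d -> cder (fun y => - F y) x (- d).
Proof.
move=> dF; rewrite -mulN1r (_ : (fun y => - F y) = (fun y => -1 * F y)); first exact: cderZ.
by apply/funext => y; rewrite mulN1r.
Qed.

Lemma cderB F G x d e : cder F x d -> cder G x e -> cder (fun y => F y - G y) x (d - e).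
Proof. by move=> dF dG; exact: cderD dF (cderN dG). Qed.

Lemma cderR (f : R -> R) (x d : R) : is_derive x 1 f d -> cder (fun y => (f y)%:C) x d%:C.
Proof. by move=> df; split => //=; exact: is_derive_cst. Qed.

Lemma cder_id x : cder (fun y => y%:C) x 1.
Proof. exact: (@cderR id). Qed.

Lemma cder_cexp F x d : cder F x d -> cder (fun y => cexp (F y)) x (d * cexp (F x)).
Proof.
move=> [F1 F2]; rewrite /cder; split.
  rewrite [X in is_derive _ _ X _](_ : _ =
    (expR \o (fun y => Re (F y))) * (cos \o (fun y => Im (F y)))).
    have h1 := is_derive1_comp (is_derive_expR (Re (F x))) F1.
    have h2 := is_derive1_comp (is_derive_cos (Im (F x))) F2.
    apply: is_derive_eq (is_deriveM h1 h2) _.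
    by rewrite RecM Re_cexp Im_cexp /GRing.scale /=; ring.
  by apply/funext => y; rewrite Re_cexp.
rewrite [X in is_derive _ _ X _](_ : _ =
    (expR \o (fun y => Re (F y))) * (sin \o (fun y => Im (F y)))).
  have h1 := is_derive1_comp (is_derive_expR (Re (F x))) F1.
  have h2 := is_derive1_comp (is_derive_sin (Im (F x))) F2.
  apply: is_derive_eq (is_deriveM h1 h2) _.
  by rewrite ImcM Re_cexp Im_cexp /GRing.scale /=; ring.
by apply/funext => y; rewrite Im_cexp.
Qed.

Lemma cder_shift F x (h : R) d : cder F (x + h) d -> cder (fun y => F (y + h)) x d.
Proof.
move=> [F1 F2]; split.
  have h1 : is_derive x 1 (shift h : R -> R) 1 by exact: is_derive_shift.
  by have := @is_derive1_comp _ _ (shift h) _ _ _ F1 h1; rewrite mulr1.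
have h1 : is_derive x 1 (shift h : R -> R) 1 by exact: is_derive_shift.
by have := @is_derive1_comp _ _ (shift h) _ _ _ F2 h1; rewrite mulr1.
Qed.

Lemma cder_comp_affine F x (a b : R) d :
  cder F (a * x + b) d -> cder (fun y => F (a * y + b)) x (a%:C * d).
Proof.
have h1 : is_derive x 1 (fun y : R => a * y + b) a.
  apply: (@is_derive_eq _ _ _ (a \*: id + cst b : R -> R) _ _ _ _ _ (_ : a *: 1 + 0 = _)).
  by rewrite addr0 /GRing.scale /= mulr1.
move=> [F1 F2]; split.
  by have := @is_derive1_comp _ _ (fun y : R => a * y + b) _ _ _ F1 h1; rewrite mulrC RecM /= mul0r subr0.
by have := @is_derive1_comp _ _ (fun y : R => a * y + b) _ _ _ F2 h1; rewrite mulrC ImcM /= mul0r addr0.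
Qed.

(* The bound is needed between [x] and [x + h] only. *)
Lemma cTaylor2 (F F1 F2 : R -> C) (x h B : R) : 0 <= h ->
  (forall y, x <= y <= x + h -> cder F y (F1 y)) ->
  (forall y, x <= y <= x + h -> cder F1 y (F2 y)) ->
  (forall y, x <= y <= x + h -> cabs (F2 y) <= B) ->
  cabs (F (x + h) - F x - h%:C * F1 x) <= 4 * B * h ^+ 2.
Proof.
move=> h0 d1 d2 bB.
(* The derivative F1 y - F1 x of G is itself estimated by [cMVT]; the two uses give the factor 4. *)
pose G y := F y - (y - x)%:C * F1 x.
have dG y : x <= y <= x + h -> cder G y (F1 y - F1 x).
  move=> yx; apply: cderB; first exact: d1.
  rewrite -[X in cder _ _ X]mul1r; have h1 : is_derive y 1 (fun t : R => t - x) 1.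
    exact: is_derive_shift.
  have := cderM (cderR h1) (cder_cst (F1 x) y).
  by rewrite mulr0 addr0.
have bG y : x <= y <= x + h -> cabs (F1 y - F1 x) <= 2 * B * h.
  move=> /andP[xy yx].
  have B0 : 0 <= B by apply: le_trans (cabs_ge0 _) (bB x _); rewrite lexx lerDl.
  apply: (@le_trans _ _ (2 * B * (y - x))).
    apply: cMVT => // z /andP[xz zy]; [apply: d2|apply: bB]; rewrite xz /=;
      exact: le_trans zy yx.
  by rewrite ler_wpM2l ?mulr_ge0 // lerBlDl.
have := cMVT _ dG bG; rewrite lerDl => /(_ h0).
rewrite /G subrr !(addrC x) addrK mul0r subr0.
rewrite -addrA -opprD (addrC (_ * _)) opprD addrA => H; apply: le_trans H _.
by rewrite le_eqVlt; apply/orP; left; apply/eqP; ring.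
Qed.

Lemma cTaylor2T (F F1 F2 : R -> C) (B : R) :
  (forall y, cder F y (F1 y)) -> (forall y, cder F1 y (F2 y)) ->
  (forall y, cabs (F2 y) <= B) ->
  forall x h, cabs (F (x + h) - F x - h%:C * F1 x) <= 4 * B * h ^+ 2.
Proof.
move=> d1 d2 bB x h; have [h0|h0] := leP 0 h; first exact: (@cTaylor2 F F1 F2).
(* Negative h is reduced to positive h by the reflection y |-> 2x - y. *)
pose refl (H : R -> C) y := H (-1 * y + (x + x)).
have dr H H1 : (forall y, cder H y (H1 y)) -> forall y, cder (refl H) y (- refl H1 y).
  move=> dH y; have := @cder_comp_affine H y (-1) (x + x) _ (dH _).
  by rewrite rmorphN1 mulN1r.
have := @cTaylor2 (refl F) (fun y => - refl F1 y) (refl F2) x (- h) B.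
rewrite oppr_ge0 ltW // => /(_ isT).
have -> : refl F (x - h) = F (x + h) by congr F; ring.
have -> : refl F x = F x by congr F; ring.
have -> : refl F1 x = F1 x by congr F1; ring.
rewrite rmorphN mulrNN sqrrN; apply => y _; [exact: dr| |exact: bB].
rewrite -[X in cder _ _ X]opprK; apply: cderN; exact: dr.
Qed.

End RealParameter.

(** * Analytic continuation of periodic Dirichlet series *)

Section FiniteDifferences.
Variable R : realType.
Local Notation C := (CC R).
Variable d : R.
Hypothesis d_gt0 : 0 < d.
Implicit Types (F G : R -> C) (x : R) (z w : C) (N i : nat).

(** Minus the forward difference: the sign with which summation by parts produces it in
    [abel_sum]. *)
Definition nabla F x : C := F x - F (x + d).
Definition nab N F := iter N nabla F.

Lemma nabS N F x : nab N.+1 F x = nab N F x - nab N F (x + d).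
Proof. by []. Qed.

Lemma nabZ N c F x : nab N (fun y => c * F y) x = c * nab N F x.
Proof. by elim: N x => // N IH x; rewrite !nabS !IH mulrBr. Qed.

Lemma nabB N F G x : nab N (fun y => F y - G y) x = nab N F x - nab N G x.
Proof. by elim: N x => // N IH x; rewrite !nabS !IH; ring. Qed.

Lemma cder_nab N F G x : (forall y, x <= y -> cder F y (G y)) -> cder (nab N F) x (nab N G x).
Proof.
elim: N x => [|N IH] x dF; first exact: dF.
apply: cderB; first exact: IH.
by apply: cder_shift; apply: IH => y xy; apply: dF; rewrite (le_trans _ xy) // lerDl ltW.
Qed.

(* (ln x)^i x^(-z): up to sign, the i-th derivative of x^(-z) in z *)
Definition logpow i z x : C := ((ln x) ^+ i)%:C * cexp (- z * (ln x)%:C).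

Lemma logpow0 z x : logpow 0 z x = cpowR x (- z).
Proof. by rewrite /logpow expr0 mul1r cpowRE. Qed.

Lemma logpow00 x : logpow 0 0 x = 1.
Proof. by rewrite logpow0 oppr0 cpowR0. Qed.

(** The derivative in x stays in the family with z replaced by z + 1, which is a gain of one power
    of x. *)
Lemma cder_logpow i z x : 0 < x ->
  cder (logpow i z) x (i%:R * logpow i.-1 (z + 1) x - z * logpow i (z + 1) x).
Proof.
move=> x0; have dl := is_derive1_ln x0.
have h1 := cderR (is_deriveX i dl).
have h2 := cder_cexp (cderZ (- z) (cderR dl)).
have := cderM h1 h2; congr cder; first by apply/funext => y; rewrite exprfctE.
rewrite exprfctE /logpow.
have e1 : cexp (- (z + 1) * (ln x)%:C) = (x^-1)%:C * cexp (- z * (ln x)%:C).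
  rewrite opprD mulrDl addrC cexpD; congr (_ * _).
  rewrite mulN1r -rmorphN; apply: ReIm_eq; rewrite ?Re_cexp ?Im_cexp /= ?cos0 ?sin0 ?mulr1 ?mulr0 //.
  by rewrite expRN lnK.
have e2 : (i%:R : C) = (i%:R : R)%:C by rewrite (rmorph_nat (real_complex R)).
by rewrite e1 e2 /GRing.scale /= !rmorphM; ring.
Qed.

(** Powers are comparable over one step: for 1 <= x <= y <= x + d the ratio y / x lies between 1 and
    1 + d. *)
Lemma le_expR_ln (a b A x y : R) : 1 <= x -> x <= y <= x + d -> `|a| <= A ->
  expR (a * ln y) <= expR (A * ln (1 + d)) * expR (a * ln x).
Proof.
move=> x1 /andP[xy yx] aA; have x0 : 0 < x by apply: lt_le_trans x1.
have y0 : 0 < y by apply: lt_le_trans xy.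
have d1 : 0 < 1 + d by rewrite addr_gt0.
have l1 : ln x <= ln y by rewrite ler_ln ?posrE.
have l2 : ln y <= ln x + ln (1 + d).
  rewrite -lnM ?posrE // ler_ln ?posrE ?mulr_gt0 //.
  by apply: le_trans yx _; rewrite mulrDr mulr1 lerD2l ler_peMl // ltW.
rewrite -expRD ler_expR -lerBlDr -mulrBr.
have h : 0 <= ln y - ln x <= ln (1 + d) by rewrite subr_ge0 l1 lerBlDl.
case/andP: h => h1 h2; apply: le_trans (ler_norm _) _.
by rewrite normrM (ger0_norm h1) ler_pM.
Qed.

(** (ln x)^i <= (2 i)^i x^(1/2), from 1 + t <= e^t at t = ln x / (2 i). The exponent 1/2 absorbs all
    logarithms. *)
Lemma logpow_bound i (r : R) : exists2 K, 0 <= K & forall z, cabs z <= r -> forall x, 1 <= x ->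
  cabs (logpow i z x) <= K * expR ((1 / 2 - Re z) * ln x).
Proof.
exists ((2 * i%:R) ^+ i); first by rewrite exprn_ge0 // mulr_ge0.
move=> z _ x x1; have L0 : 0 <= ln x by rewrite ln_ge0.
rewrite /logpow cabsM cabsR cabs_cexp Re_mulR ReN mulrBl expRD mulrA mulNr.
rewrite ler_wpM2r ?expR_ge0 // ger0_norm ?exprn_ge0 //.
case: i => [|i]; first by rewrite !expr0 mul1r -[leLHS]expR0 ler_expR mulr_ge0 // divr_ge0.
have -> : expR (1 / 2 * ln x) = expR (ln x / (2 * i.+1%:R)) ^+ i.+1.
  rewrite -expRM_natl; congr expR; field.
  by rewrite nat1r pnatr_eq0.
rewrite -exprMn ler_pXn2r ?nnegrE // ?mulr_ge0 ?expR_ge0 //.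
have p : 0 < 2 * i.+1%:R :> R by rewrite mulr_gt0.
rewrite mulrC -ler_pdivrMr //; apply: le_trans (expR_ge1Dx _).
by rewrite lerDr.
Qed.

(** By the mean value theorem each difference gains a factor 1 / x. The derivative involves z + 1,
    so the induction hypothesis is taken on the disc of radius r + 1. *)
Lemma nab_logpow_bound N i (r : R) : exists2 K, 0 <= K & forall z, cabs z <= r -> forall x, 1 <= x ->
  cabs (nab N (logpow i z) x) <= K * expR ((1 / 2 - Re z - N%:R) * ln x).
Proof.
elim: N i r => [|N IH] i r.
  have [K K0 H] := logpow_bound i r; exists K => // z zr x x1.
  by rewrite subr0; exact: H.
have [K1 K10 H1] := IH i.-1 (r + 1); have [K2 K20 H2] := IH i (r + 1).
have [r0|r0] := ltP r 0.
  by exists 0 => // z zr; have := le_lt_trans (le_trans (cabs_ge0 z) zr) r0; rewrite ltxx.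
(* A dominates the absolute value of the exponent 1/2 - Re z - (N + 1), as [le_expR_ln] requires. *)
pose A := r + N.+2%:R; pose K := (i%:R * K1 + r * K2) * expR (A * ln (1 + d)).
have K0 : 0 <= K by rewrite mulr_ge0 ?expR_ge0 // addr_ge0 // mulr_ge0.
exists (2 * K * d) => [|z zr x x1]; first by apply: mulr_ge0 (ltW d_gt0); exact: mulr_ge0.
rewrite nabS cabs_distC.
pose F' y : C := i%:R * nab N (logpow i.-1 (z + 1)) y - z * nab N (logpow i (z + 1)) y.
have zr1 : cabs (z + 1) <= r + 1 by rewrite (le_trans (cabsD _ _)) // cabs1 lerD2r.
have Rez : `|Re z| <= r by apply: le_trans (cabs_geRe _) zr.
set E := expR _.
have := @cMVT R (nab N (logpow i z)) F' x (x + d) (K * E).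
rewrite lerDl ltW // => /(_ isT) H.
have -> : 2 * K * d * E = 2 * (K * E) * (x + d - x) by rewrite addrAC subrr add0r; ring.
apply: H => y xy; have x1y : 1 <= y by case/andP: xy => xy _; apply: le_trans xy.
  rewrite /F' -!nabZ -nabB; apply: cder_nab => t yt; apply: cder_logpow.
  by apply: lt_le_trans yt; apply: lt_le_trans x1y.
apply: le_trans (cabsB _ _) _; rewrite !cabsM cabs_nat.
have h1 := H1 _ zr1 _ x1y; have h2 := H2 _ zr1 _ x1y.
have e : expR ((1 / 2 - Re (z + 1) - N%:R) * ln y) <= expR (A * ln (1 + d)) * E.
  rewrite ReD /=; have -> : 1 / 2 - (Re z + 1) - N%:R = 1 / 2 - Re z - N.+1%:R :> R.
    by rewrite -natr1; ring.
  apply: le_expR_ln => //.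
  have N0 : 0 <= N%:R :> R by [].
  have -> : A = r + N%:R + 2 by rewrite /A -addn2 natrD addrA.
  rewrite ler_norml -(natr1 N); move: Rez; rewrite ler_norml => /andP[a b].
  by apply/andP; split; lra.
rewrite /K -mulrA mulrDl; apply: lerD.
  rewrite -mulrA ler_wpM2l //; apply: le_trans h1 _; exact: ler_wpM2l.
rewrite -mulrA; apply: ler_pM => //; try exact: cabs_ge0.
apply: le_trans h2 _; exact: ler_wpM2l.
Qed.

(** The dependence on z is studied along the segment from w to z, with a real parameter; each
    derivative brings down - (z - w) ln x. *)
Lemma cder_path i (z w : C) x (t : R) :
  cder (fun s : R => logpow i (w + s%:C * (z - w)) x) t
       (- (z - w) * logpow i.+1 (w + t%:C * (z - w)) x).
Proof.
have h : cder (fun s : R => - (w + s%:C * (z - w)) * (ln x)%:C) t (- (z - w) * (ln x)%:C).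
  have h1 := cderD (cder_cst w t) (cderM (cder_id t) (cder_cst (z - w) t)).
  have := cderM (cderN h1) (cder_cst (ln x)%:C t); congr cder; ring.
have := cderZ ((ln x) ^+ i)%:C (cder_cexp h); congr cder.
by rewrite /logpow exprS rmorphM; ring.
Qed.

Lemma cder_nab_path N i (z w : C) x (t : R) :
  cder (fun s : R => nab N (logpow i (w + s%:C * (z - w))) x) t
       (- (z - w) * nab N (logpow i.+1 (w + t%:C * (z - w))) x).
Proof.
elim: N x => [|N IH] x; first exact: cder_path.
rewrite nabS mulrBr; exact: cderB (IH x) (IH (x + d)).
Qed.

Lemma cabs_segment (z w : C) (r t : R) : 0 <= t <= 1 -> cabs z <= r -> cabs w <= r ->
  cabs (w + t%:C * (z - w)) <= r.
Proof.
move=> /andP[t0 t1] zr wr.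
have -> : w + t%:C * (z - w) = (1 - t)%:C * w + t%:C * z by rewrite rmorphB; ring.
apply: le_trans (cabsD _ _) _; rewrite !cabsM !cabsR !ger0_norm ?subr_ge0 //.
have -> : r = (1 - t) * r + t * r by ring.
by apply: lerD; rewrite ler_wpM2l // subr_ge0.
Qed.

(** Derivatives in z cost only powers of ln x, so the second order remainder in z keeps the decay in
    x gained by the differences. This is what allows termwise differentiation of the series. *)
Lemma nab_logpow_taylor N (r : R) : exists2 K, 0 <= K & forall z w, cabs z <= r -> cabs w <= r ->
  forall x, 1 <= x ->
  cabs (nab N (logpow 0 z) x - nab N (logpow 0 w) x + (z - w) * nab N (logpow 1 w) x)
   <= K * expR ((1 / 2 + r - N%:R) * ln x) * cabs (z - w) ^+ 2.
Proof.
have [K K0 H] := nab_logpow_bound N 2 r; exists (4 * K) => [|z w zr wr x x1].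
  by rewrite mulr_ge0.
pose psi i (s : R) := nab N (logpow i (w + s%:C * (z - w))) x.
set E := expR _.
have := @cTaylor2 R (psi 0%N) (fun s => - (z - w) * psi 1%N s)
  (fun s => (z - w) ^+ 2 * psi 2%N s) 0 1 (cabs (z - w) ^+ 2 * (K * E)).
have p0 i : psi i 0 = nab N (logpow i w) x by rewrite /psi mul0r addr0.
have p1 : psi 0%N 1 = nab N (logpow 0 z) x by rewrite /psi mul1r addrC subrK.
rewrite add0r !p0 p1 expr1n mulr1 rmorph1 mul1r mulNr opprK => T.
have -> : 4 * K * E * cabs (z - w) ^+ 2 = 4 * (cabs (z - w) ^+ 2 * (K * E)) by ring.
apply: T => // y y01; first exact: cder_nab_path.
  have := cderZ (- (z - w)) (cder_nab_path N 1 z w x y); congr cder.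
  by rewrite /psi; ring.
rewrite cabsM cabsX ler_wpM2l ?exprn_ge0 ?cabs_ge0 //.
have seg := cabs_segment y01 zr wr; apply: le_trans (H _ seg _ x1) _.
rewrite ler_wpM2l // ler_expR ler_wpM2r ?ln_ge0 // lerD2r lerD2l.
by have := le_trans (cabs_geRe _) seg; rewrite ler_norml => /andP[a _]; rewrite lerNl.
Qed.

End FiniteDifferences.

(** * Convergence of complex series and complex differentiability *)

Section SeriesBySums.
Variable R : realType.
Local Notation C := (CC R).
Implicit Types (u v : nat -> C) (s t c : C).

Definition csums u s := forall e : R, 0 < e ->
  exists M0, forall M, (M0 <= M)%N -> cabs (\sum_(m < M) u m - s) <= e.

Lemma csums_unique u s t : csums u s -> csums u t -> s = t.
Proof.
move=> us ut; apply/eqP; rewrite -subr_eq0; apply/eqP/cabs0_eq0/eqP.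
rewrite eq_le cabs_ge0 andbT; apply/ler_addgt0Pr => e e0; rewrite add0r.
have e2 : 0 < e / 2 by rewrite divr_gt0.
have [M1 H1] := us _ e2; have [M2 H2] := ut _ e2.
pose M := maxn M1 M2; have := H1 M (leq_maxl _ _); have := H2 M (leq_maxr _ _).
set S := \sum_(_ < _) _ => h2 h1.
have -> : s - t = (S - t) - (S - s) by ring.
by apply: le_trans (cabsB _ _) _; rewrite [e]splitr lerD.
Qed.

Lemma csumsD u v s t : csums u s -> csums v t -> csums (fun m => u m + v m) (s + t).
Proof.
move=> us vt e e0; have e2 : 0 < e / 2 by rewrite divr_gt0.
have [M1 H1] := us _ e2; have [M2 H2] := vt _ e2.
exists (maxn M1 M2) => M; rewrite geq_max => /andP[/H1 h1 /H2 h2].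
rewrite big_split /= opprD addrACA.
by apply: le_trans (cabsD _ _) _; rewrite [e]splitr lerD.
Qed.

Lemma csumsZ c u s : csums u s -> csums (fun m => c * u m) (c * s).
Proof.
move=> us e e0; have c1 : 0 < cabs c + 1 by rewrite ltr_wpDl ?cabs_ge0.
have [M0 H] := us (e / (cabs c + 1)) (divr_gt0 e0 c1).
exists M0 => M /H h; rewrite -mulr_sumr -mulrBr cabsM.
apply: (@le_trans _ _ ((cabs c + 1) * (e / (cabs c + 1)))).
  by apply: ler_pM => //; rewrite ?cabs_ge0 ?lerDl.
by rewrite mulrC divfK // gt_eqF.
Qed.

Lemma csumsN u s : csums u s -> csums (fun m => - u m) (- s).
Proof.
move=> us; rewrite -mulN1r (_ : (fun m => - u m) = fun m => -1 * u m); first exact: csumsZ.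
by apply/funext => m; rewrite mulN1r.
Qed.

Lemma csums_le u s (B : R) : (forall M, cabs (\sum_(m < M) u m) <= B) -> csums u s -> cabs s <= B.
Proof.
move=> bB us; apply/ler_addgt0Pr => e e0; have [M0 H] := us _ e0.
have := H M0 (leqnn _); set S := \sum_(_ < _) _ => h.
have -> : s = S - (S - s) by ring.
by apply: le_trans (cabsB _ _) _; rewrite lerD // bB.
Qed.

Lemma csums_eventually u v s : (forall e : R, 0 < e -> exists M0, forall M, (M0 <= M)%N ->
    cabs (\sum_(m < M) u m - \sum_(m < M) v m) <= e) -> csums u s -> csums v s.
Proof.
move=> uv us e e0; have e2 : 0 < e / 2 by rewrite divr_gt0.
have [M1 H1] := uv _ e2; have [M2 H2] := us _ e2.
exists (maxn M1 M2) => M; rewrite geq_max => /andP[/H1 h1 /H2 h2].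
set S := \sum_(m < M) u m in h1 h2 *; set T := \sum_(m < M) v m in h1 *.
have -> : T - s = (S - s) - (S - T) by ring.
by apply: le_trans (cabsB _ _) _; rewrite [e]splitr lerD.
Qed.

Lemma real_series_cvg (f : nat -> R) (b : nat -> R) (B : R) :
  (forall m, `|f m| <= b m) -> (forall M, \sum_(m < M) b m <= B) ->
  exists s : R, forall e : R, 0 < e -> exists M0, forall M, (M0 <= M)%N -> `|\sum_(m < M) f m - s| <= e.
Proof.
move=> fb bB.
have cb : cvgn (series b).
  apply: nondecreasing_is_cvgn.
    by apply: nondecreasing_series => m _ _; apply: le_trans (fb m).
  by exists B => _ [M _ <-]; rewrite /series /= big_mkord.
have cf : cvgn (series f).
  apply: normed_cvg; apply: (series_le_cvg _ _ _ cb) => m //=.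
  by apply: le_trans (fb m).
exists (limn (series f)) => e e0.
have /cvgrPdist_le /(_ e e0) [M0 _ H] := cf.
exists M0 => M MM; have := H M MM; rewrite /= distrC /series /=.
by rewrite big_mkord.
Qed.

Lemma csums_exists u (b : nat -> R) (B : R) :
  (forall m, cabs (u m) <= b m) -> (forall M, \sum_(m < M) b m <= B) -> exists s, csums u s.
Proof.
move=> ub bB.
have [a Ha] := @real_series_cvg (fun m => Re (u m)) b B
  (fun m => le_trans (cabs_geRe _) (ub m)) bB.
have [c Hc] := @real_series_cvg (fun m => Im (u m)) b B
  (fun m => le_trans (cabs_geIm _) (ub m)) bB.
exists (a +i* c) => e e0; have e2 : 0 < e / 2 by rewrite divr_gt0.
have [M1 H1] := Ha _ e2; have [M2 H2] := Hc _ e2.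
exists (maxn M1 M2) => M; rewrite geq_max => /andP[/H1 h1 /H2 h2].
apply: le_trans (cabs_leReIm _) _; rewrite ReB ImB Re_sum Im_sum [e]splitr.
exact: lerD.
Qed.

(** Reduces complex differentiability to a quadratic remainder bound, which survives termwise
    summation. *)
Lemma derivable_quadratic (f : C -> C) (w D : C) (r K : R) : 0 < r -> 0 <= K ->
  (forall h : C, cabs h < r -> cabs (f (w + h) - f w - h * D) <= K * cabs h ^+ 2) ->
  derivable f w 1.
Proof.
move=> r0 K0 H; apply/cvg_ex; exists D; apply/cvgrPdist_le => e e0.
have [er [eE ep]] : exists er : R, e = er%:C /\ 0 < er.
  case: e e0 => a b; rewrite ltcE /= => /andP[/eqP -> a0]; by exists a.
have K1 : 0 < K + 1 by rewrite ltr_wpDl.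
pose q := Num.min r (er / (K + 1)); have q0 : 0 < q by rewrite lt_min r0 divr_gt0.
have q0c : 0 < q%:C :> C by rewrite ltcR.
near=> h; have hn0 : h != 0 by near: h; exact: nbhs_dnbhs_neq.
have hq : `|h| < q%:C.
  near: h; apply: (@dnbhs0_lt _ C); exact: q0c.
rewrite eE normCC lecR.
have {}hq : cabs h < q by move: hq; rewrite normCC ltcR.
move: hq; rewrite lt_min => /andP[hr hK].
have -> : D - h^-1 *: ((f \o shift w) (h *: 1) - f w) = - h^-1 * (f (w + h) - f w - h * D).
  rewrite /= (_ : h%:A = h); last by rewrite /GRing.scale /= mulr1.
  by rewrite /GRing.scale /= (addrC h); field.
rewrite cabsM cabsN; apply: le_trans (ler_wpM2l (cabs_ge0 _) (H _ hr)) _.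
have hi : cabs h^-1 * cabs h = 1 by rewrite -cabsM mulVf // cabs1.
have -> : cabs h^-1 * (K * cabs h ^+ 2) = (cabs h^-1 * cabs h) * (K * cabs h) by ring.
rewrite hi mul1r; move: hK; rewrite ltr_pdivlMr // => hK; apply: le_trans (ltW hK).
by rewrite mulrC ler_wpM2l ?cabs_ge0 // lerDl.
Unshelve. all: by end_near. Qed.

End SeriesBySums.

(** * Continuation by iterated summation by parts *)

Section DirichletContinuation.
Variables (R : realType) (n : nat) (d : R).
Hypotheses (n_gt0 : (0 < n)%N) (d_gt0 : 0 < d).
Local Notation C := (CC R).
Implicit Types (f : nat -> R) (z w : C) (N m M : nat).

Definition balanced f := (forall m, f (m + n)%N = f m) /\ \sum_(m < n) f m = 0.

Definition psum f m : R := \sum_(i < m) f i.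
Definition avg f : R := (\sum_(m < n) psum f m.+1) / n%:R.
(* The constant is chosen so that an n-periodic f with zero sum over a period has an
   antidifference of the same kind: summation by parts can be iterated. *)
Definition antidiff f m : R := psum f m.+1 - avg f.

Lemma psumS f m : psum f m.+1 = psum f m + f m.
Proof. by rewrite /psum big_ord_recr. Qed.

Lemma psum_periodic f : balanced f -> forall m, psum f (m + n) = psum f m.
Proof.
move=> [per f0]; elim=> [|m IH]; first by rewrite add0n /psum f0 big_ord0.
by rewrite addSn !psumS IH per.
Qed.

Lemma antidiff_balanced f : balanced f -> balanced (antidiff f).
Proof.
move=> bf; split=> [m|]; first by rewrite /antidiff -addSn psum_periodic.
rewrite /antidiff sumrB sumr_const card_ord -[avg f *+ n]mulr_natr /avg divfK ?subrr //.
by rewrite pnatr_eq0 -lt0n.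
Qed.

Lemma periodic_bounded f : (forall m, f (m + n)%N = f m) -> exists2 B, 0 <= B & forall m, `|f m| <= B.
Proof.
move=> per; exists (\sum_(i < n) `|f i|) => [|m]; first exact: sumr_ge0.
have perk q r : f (q * n + r)%N = f r.
  by elim: q => [|q IH]; rewrite ?add0n // mulSn -addnA addnC per.
rewrite (divn_eq m n) perk (bigD1 (Ordinal (ltn_pmod m n_gt0))) //= lerDl.
exact: sumr_ge0.
Qed.

(** Abel summation with partial sums centred at their mean; the centring leaves the boundary term
    [avg f] times g 0, the source of the value at 0. *)
Lemma abel_sum f (g : nat -> C) M : \sum_(m < M) (f m)%:C * g m =
  (psum f M - avg f)%:C * g M + (avg f)%:C * g 0%N
  + \sum_(m < M) (antidiff f m)%:C * (g m - g m.+1).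
Proof.
elim: M => [|M IH].
  by rewrite !big_ord0 /psum big_ord0 sub0r rmorphN mulNr addr0 addNr.
rewrite !big_ord_recr /= IH /antidiff psumS !(rmorphB, rmorphD); ring.
Qed.

(** Normalized to start at 1, so that the logarithms are nonnegative; the actual eigenvalues are a
    constant multiple. *)
Definition node m : R := 1 + d * m%:R.

Lemma node_ge1 m : 1 <= node m.
Proof. by rewrite lerDl mulr_ge0 // ltW. Qed.

Lemma node_gt0 m : 0 < node m.
Proof. exact: lt_le_trans (node_ge1 m). Qed.

Lemma nodeS m : node m.+1 = node m + d.
Proof. by rewrite /node -natr1; ring. Qed.

Lemma node0 : node 0 = 1. Proof. by rewrite /node mulr0 addr0. Qed.

Lemma expR_node m : expR (-2 * ln (node m)) = (node m) ^- 2.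
Proof.
rewrite mulNr expRN; congr _^-1.
by rewrite -[2]/(2%:R) expRM_natl lnK ?posrE ?node_gt0.
Qed.

(** Telescoping: d / node(m+1)^2 is at most 1 / node m - 1 / node(m+1). *)
Lemma sum_node M : \sum_(m < M) (node m) ^- 2 <= 1 + d^-1.
Proof.
case: M => [|M]; first by rewrite big_ord0 addr_ge0 // invr_ge0 ltW.
suff : \sum_(m < M.+1) node m ^- 2 <= 1 + d^-1 * (1 - (node M)^-1).
  move/le_trans; apply; rewrite lerD2l ler_piMr ?invr_ge0 ?(ltW d_gt0) //.
  by rewrite gerBl invr_ge0 ltW ?node_gt0.
elim: M => [|M IH].
  by rewrite big_ord_recr big_ord0 /= node0 expr1n !invr1 subrr mulr0 addr0 add0r.
rewrite big_ord_recr /=; apply: le_trans (lerD IH (lexx _)) _.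
have p := node_gt0 M; have p1 := node_gt0 M.+1.
rewrite -addrA lerD2l -lerBrDl -mulrBr.
have -> : 1 - (node M.+1)^-1 - (1 - (node M)^-1) = d / (node M * node M.+1).
  rewrite nodeS in p1 *; field; rewrite ?gt_eqF //.
rewrite mulrA mulVf ?gt_eqF // mul1r lef_pV2 ?posrE ?mulr_gt0 ?exprn_gt0 //.
by rewrite expr2 ler_wpM2r ?(ltW p1) // nodeS lerDl ltW.
Qed.

Variable chi : nat -> R.
Hypothesis chi_bal : balanced chi.

Definition coef N := iter N antidiff chi.

Lemma coef_bal N : balanced (coef N).
Proof. by elim: N => //= N; exact: antidiff_balanced. Qed.

Definition term N z m : C := (coef N m)%:C * nab d N (logpow 0 z) (node m).

Lemma small_node z N (K r : R) (G : R -> C) : 0 <= K -> r <= -2 ->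
  (forall x, 1 <= x -> cabs (G x) <= K * expR (r * ln x)) ->
  forall m, cabs (G (node m)) <= K * node m ^- 2.
Proof.
move=> K0 hr H m; apply: le_trans (H _ (node_ge1 m)) _.
rewrite ler_wpM2l // -expR_node ler_expR; apply: ler_wpM2r => //.
by rewrite ln_ge0 // node_ge1.
Qed.

(** For Re z + N >= 3 the exponent 1/2 - Re z - N is below -2, and [sum_node] gives absolute
    convergence. *)
Lemma nab_node_small z N : 3 <= Re z + N%:R -> exists2 K, 0 <= K &
  forall m, cabs (nab d N (logpow 0 z) (node m)) <= K * node m ^- 2.
Proof.
move=> zN; have [K K0 H] := nab_logpow_bound d_gt0 N 0 (cabs z); exists K => //.
apply: (small_node z N K0 _ (H z (lexx _))); lra.
Qed.

Lemma sum_bound (G : nat -> C) (f : nat -> R) (B K : R) : 0 <= B ->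
  (forall m, `|f m| <= B) -> (forall m, cabs (G m) <= K * node m ^- 2) ->
  forall m, cabs ((f m)%:C * G m) <= B * K * node m ^- 2.
Proof.
by move=> B0 fB GK m; rewrite cabsM cabsR -mulrA; apply: ler_pM; rewrite ?cabs_ge0.
Qed.

Lemma sum_node_le (c : R) M : 0 <= c -> \sum_(m < M) c * node m ^- 2 <= c * (1 + d^-1).
Proof. by move=> c0; rewrite -mulr_sumr ler_wpM2l // sum_node. Qed.

Lemma csums_term z N : 3 <= Re z + N%:R -> exists s, csums (term N z) s.
Proof.
move=> zN; have [K K0 H] := nab_node_small zN.
have [B B0 HB] := periodic_bounded (coef_bal N).1.
apply: csums_exists (sum_bound B0 HB H) (fun M => sum_node_le M (mulr_ge0 B0 K0)).
Qed.

Definition tailsum N z : C := xget 0 [set s | csums (term N z) s].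

Lemma tailsumP z N : 3 <= Re z + N%:R -> csums (term N z) (tailsum N z).
Proof. by move=> /csums_term [s Hs]; rewrite /tailsum; apply: xgetPex; exists s. Qed.

Definition partialF N z : C :=
  \sum_(j < N) (avg (coef j))%:C * nab d j (logpow 0 z) 1.

(* The series after N summations by parts: it converges absolutely as soon as Re z + N >= 3. *)
Definition contF N z : C := partialF N z + tailsum N z.

Lemma node_large (e : R) : 0 < e -> exists M0, forall M, (M0 <= M)%N -> node M ^- 2 <= e.
Proof.
move=> e0; have [M0 HM] : exists M0 : nat, e^-1 <= node M0.
  exists (Num.truncn (e^-1 / d)).+1; rewrite /node.
  have : e^-1 / d < (Num.truncn (e^-1 / d)).+1%:R by rewrite truncnS_gt.
  by rewrite ltr_pdivrMr // mulrC => h; rewrite (le_trans (ltW h)) // lerDr.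
exists M0 => M MM; have h : node M0 <= node M.
  by rewrite lerD2l ler_wpM2l ?(ltW d_gt0) // ler_nat.
have n0 := node_gt0 M; rewrite -[e]invrK lef_pV2 ?posrE ?invr_gt0 ?exprn_gt0 //.
apply: le_trans HM _; apply: le_trans h _.
by rewrite expr2 ler_peMl ?node_ge1 // ltW.
Qed.

(** One more summation by parts: the boundary term at M tends to 0, since the centred partial sums
    are bounded and the N-th differences decay, and the one at 0 is the new term of [partialF]. *)
Lemma contF_next z N : 3 <= Re z + N%:R -> contF N z = contF N.+1 z.
Proof.
move=> zN; have zN1 : 3 <= Re z + N.+1%:R by rewrite (le_trans zN) // lerD2l ler_nat.
have [K K0 H] := nab_node_small zN.
have bal := coef_bal N.
rewrite /contF /partialF big_ord_recr /= -addrA; congr (_ + _).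
set c := _%:C * _.
apply: (csums_unique (tailsumP zN)).
have H1 : csums (fun m => if m == 0%N then c else 0) c.
  move=> e e0; exists 1%N => -[//|M] _; rewrite big_ord_recl /= big1 // addr0 subrr cabs0.
  exact: ltW.
apply: csums_eventually (csumsD H1 (tailsumP zN1)) => e e0.
have [B B0 HB] : exists2 B, 0 <= B & forall M, `|psum (coef N) M - avg (coef N)| <= B.
  have [B B0 HB] := periodic_bounded (f := psum (coef N)) (psum_periodic bal).
  exists (B + `|avg (coef N)|) => [|M]; first by rewrite addr_ge0.
  by apply: le_trans (ler_normB _ _) _; rewrite lerD2r.
have BK : 0 < B * K + 1 by rewrite ltr_wpDl // mulr_ge0.
have [M0 HM0] := node_large (divr_gt0 e0 BK).
exists (maxn 1 M0) => M; rewrite geq_max => /andP[M1 MM].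
rewrite big_split /=.
have -> : \sum_(i < M) (if i == 0%N :> nat then c else 0) = c.
  by case: M M1 {MM} => // M _; rewrite big_ord_recl /= big1 // addr0.
rewrite (abel_sum (coef N) (fun m => nab d N (logpow 0 z) (node m))).
have -> : \sum_(m < M) (antidiff (coef N) m)%:C *
   (nab d N (logpow 0 z) (node m) - nab d N (logpow 0 z) (node m.+1)) =
   \sum_(m < M) term N.+1 z m.
  by apply: eq_bigr => m _; rewrite /term nodeS.
rewrite node0 -/c opprD addrACA -!addrA subrr addr0 opprD (addrCA c) subrr addr0 cabsN.
apply: le_trans (sum_bound B0 HB H M) _.
apply: le_trans (ler_wpM2l (mulr_ge0 B0 K0) (HM0 _ MM)) _.
by rewrite mulrCA ger_pMr // ler_pdivrMr // mul1r lerDl.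
Qed.

Lemma contF_add z N j : 3 <= Re z + N%:R -> contF N z = contF (N + j) z.
Proof.
move=> zN; elim: j => [|j ->]; first by rewrite addn0.
by rewrite addnS; apply: contF_next; rewrite (le_trans zN) // lerD2l ler_nat leq_addr.
Qed.

(** The number of summations is chosen from |z| so that Re z + N >= 3; by [contF_next] any larger
    number gives the same value. *)
Definition contE z : C := contF (Num.truncn (cabs z)).+4 z.

Lemma contE_eq z N : 3 <= Re z + N%:R -> contE z = contF N z.
Proof.
move=> zN; rewrite /contE; set N1 := _.+4.
have zN1 : 3 <= Re z + N1%:R.
  have : cabs z < (Num.truncn (cabs z)).+1%:R by rewrite truncnS_gt.
  have -> : N1%:R = (Num.truncn (cabs z)).+1%:R + 3 :> R by rewrite -natrD addn3.
  have := le_trans (ler_norm _) (le_trans (cabs_geRe (- z)) _); rewrite cabsN.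
  move=> /(_ _ (lexx _)); rewrite ReN; lra.
by rewrite (contF_add N zN1) (contF_add N1 zN) addnC.
Qed.

(** At z = 0 the function x^(-z) is constant: all its differences vanish, and only the boundary term
    of the first summation remains. *)
Lemma contE0 : contE 0 = (avg chi)%:C.
Proof.
rewrite (@contE_eq _ 3) ?add0r // /contF /partialF.
have n0 N x : nab d N.+1 (logpow 0 0) x = 0.
  elim: N x => [|N IH] x; last by rewrite nabS !IH subrr.
  by rewrite nabS /= !logpow00 subrr.
rewrite big_ord_recl big1 => [|j _]; last by rewrite lift0 n0 mulr0.
rewrite /= logpow00 mulr1.
rewrite (csums_unique (@tailsumP 0 3 _) (_ : csums _ 0)) ?addr0 ?add0r //.
move=> e e0; exists 0%N => M _; rewrite big1 ?subrr ?cabs0 ?(ltW e0) // => m _.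
by rewrite /term n0 mulr0.
Qed.

Lemma contE_series z : 3 <= Re z ->
  csums (fun m => (chi m)%:C * cpowR (node m) (- z)) (contE z).
Proof.
move=> z3; have z30 : 3 <= Re z + 0%:R by rewrite addr0.
rewrite (contE_eq z30) /contF /partialF big_ord0 add0r.
have := tailsumP z30; congr csums; apply/funext => m.
by rewrite /term /= logpow0.
Qed.

(** One N serves the whole disc of radius 1 around p; there the expansions of [nab_logpow_taylor]
    are summed over j and m, with a remainder that stays quadratic. *)
Lemma contE_derivable p : derivable contE p 1.
Proof.
pose r := cabs p + 1; pose N := (Num.truncn r).+4.
have rN : r + 3 <= N%:R.
  have : r < (Num.truncn r).+1%:R by rewrite truncnS_gt.
  have -> : N%:R = (Num.truncn r).+1%:R + 3 :> R by rewrite -natrD addn3.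
  lra.
have okN z : cabs z <= r -> 3 <= Re z + N%:R.
  move=> zr; have := le_trans (ler_norm _) (le_trans (cabs_geRe (- z)) _); rewrite cabsN.
  move=> /(_ _ zr); rewrite ReN; lra.
have [K K0 H] := nab_logpow_taylor d_gt0 N r.
have [B B0 HB] := periodic_bounded (coef_bal N).1.
have pr : cabs p <= r by rewrite lerDl.
have [Q HQ] : exists Q, csums (fun m => (coef N m)%:C * nab d N (logpow 1 p) (node m)) Q.
  have [K1 K10 H1] := nab_logpow_bound d_gt0 N 1 (cabs p).
  have h : forall m, cabs (nab d N (logpow 1 p) (node m)) <= K1 * node m ^- 2.
    by apply: (small_node p N K10 _ (H1 p (lexx _))); have := okN _ pr; lra.
  exact: csums_exists (sum_bound B0 HB h) (fun M => sum_node_le M (mulr_ge0 B0 K10)).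
have /choice [Kj HKj] : forall j, exists k : R, 0 <= k /\ forall z, cabs z <= r ->
    cabs (nab d j (logpow 0 z) 1 - nab d j (logpow 0 p) 1 + (z - p) * nab d j (logpow 1 p) 1)
    <= k * cabs (z - p) ^+ 2.
  move=> j.
  have [k k0 Hk] := nab_logpow_taylor d_gt0 j r; exists k; split=> // z zr.
  by have := Hk _ _ zr pr 1 (lexx _); rewrite ln1 mulr0 expR0 mulr1.
(* The termwise derivative; the signs come from d/dz x^(-z) = - (ln x) x^(-z). *)
pose D := - \sum_(j < N) (avg (coef j))%:C * nab d j (logpow 1 p) 1 - Q.
pose KK := \sum_(j < N) `|avg (coef j)| * Kj j + B * K * (1 + d^-1).
apply: (@derivable_quadratic _ _ _ D 1 KK) => // [|h h1].
  rewrite addr_ge0 ?mulr_ge0 // ?addr_ge0 ?invr_ge0 ?(ltW d_gt0) //.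
  by apply: sumr_ge0 => j _; rewrite mulr_ge0 //; have [] := HKj j.
have phr : cabs (p + h) <= r by rewrite (le_trans (cabsD _ _)) // lerD2l ltW.
rewrite (contE_eq (okN _ phr)) (contE_eq (okN _ pr)) /contF.
have -> : partialF N (p + h) + tailsum N (p + h) - (partialF N p + tailsum N p) - h * D =
  \sum_(j < N) (avg (coef j))%:C * (nab d j (logpow 0 (p + h)) 1 - nab d j (logpow 0 p) 1
      + h * nab d j (logpow 1 p) 1)
  + (tailsum N (p + h) - tailsum N p + h * Q).
  have -> : \sum_(j < N) (avg (coef j))%:C * (nab d j (logpow 0 (p + h)) 1 - nab d j (logpow 0 p) 1
      + h * nab d j (logpow 1 p) 1) =
    partialF N (p + h) - partialF N p + h * \sum_(j < N) (avg (coef j))%:C * nab d j (logpow 1 p) 1.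
    rewrite /partialF mulr_sumr -sumrB -big_split /=; apply: eq_bigr => j _; ring.
  by rewrite /D; ring.
rewrite /KK mulrDl; apply: le_trans (cabsD _ _) _; apply: lerD.
  apply: le_trans (cabs_sum _ _ _) _; rewrite mulr_suml; apply: ler_sum => j _.
  rewrite cabsM cabsR -mulrA ler_wpM2l //.
  by have [_ Hj] := HKj j; have := Hj _ phr; rewrite (addrC p) addrK.
have cs := csumsD (csumsD (tailsumP (okN _ phr)) (csumsN (tailsumP (okN _ pr)))) (csumsZ h HQ).
apply: csums_le cs => M.
have -> : B * K * (1 + d^-1) * cabs h ^+ 2 = B * (K * cabs h ^+ 2) * (1 + d^-1) by ring.
apply: le_trans (cabs_sum _ _ _) _.
apply: le_trans (sum_node_le M _); last by rewrite !mulr_ge0 ?exprn_ge0 ?cabs_ge0.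
apply: ler_sum => m _; rewrite /term.
set a := nab _ _ _ _; set b := nab _ _ _ _; set e := nab _ _ _ _.
have -> : (coef N m)%:C * a - (coef N m)%:C * b + h * ((coef N m)%:C * e) =
   (coef N m)%:C * (a - b + h * e) by ring.
rewrite cabsM cabsR -mulrA; apply: ler_pM; rewrite ?cabs_ge0 // mulrAC.
have := H _ _ phr pr _ (node_ge1 m); rewrite (_ : p + h - p = h) -/a -/b -/e; last by rewrite addrC addKr.
move=> /le_trans; apply; rewrite ler_wpM2r ?exprn_ge0 ?cabs_ge0 // ler_wpM2l //.
by rewrite -expR_node ler_expR ler_wpM2r ?ln_ge0 ?node_ge1 //; lra.
Qed.

End DirichletContinuation.

Lemma dirichlet_continuation (R : realType) (n : nat) (d c : R) (chi : nat -> R) :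
  (0 < n)%N -> 0 < d -> 0 < c -> balanced n chi ->
  exists eta : CC R -> CC R,
  [/\ forall p, derivable eta p 1, eta 0 = (avg n chi)%:C &
   forall z, 3 <= Re z ->
     csums (fun m => (chi m)%:C * cpowR (c * node d m) (- z)) (eta z)].
Proof.
move=> n0 d0 c0 bal.
exists (fun z => cpowR c (- z) * contE n d chi z); split.
- move=> p; apply: derivableM; last exact: contE_derivable.
  have [K K0 H] := nab_logpow_taylor d0 0 (cabs p + 1).
  apply: (@derivable_quadratic _ _ _ (- cexp (- p * (ln c)%:C) * (ln c)%:C) 1
     (4 * (`|ln c| ^+ 2 * expR ((cabs p + 1) * `|ln c|)))) => //.
  move=> h h1; pose L := ln c.
  pose psi i (s : R) : CC R := (- (h * L%:C)) ^+ i * cexp (- (p + s%:C * h) * L%:C).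
  have dpsi i s : cder (psi i) s (psi i.+1 s).
    have e1 := cderD (cder_cst p s) (cderM (cder_id s) (cder_cst h s)).
    have e2 := cderM (cderN e1) (cder_cst L%:C s).
    have := cderZ ((- (h * L%:C)) ^+ i) (cder_cexp e2); congr cder.
    by rewrite /psi exprS; ring.
  have := @cTaylor2 R (psi 0%N) (psi 1%N) (psi 2%N) 0 1
     (`|L| ^+ 2 * expR ((cabs p + 1) * `|L|) * cabs h ^+ 2) ler01
     (fun s _ => dpsi 0%N s) (fun s _ => dpsi 1%N s).
  have -> : psi 0%N (0 + 1) = cpowR c (- (p + h)).
    by rewrite /psi expr0 mul1r add0r mul1r cpowRE.
  have -> : psi 0%N 0 = cpowR c (- p) by rewrite /psi expr0 mul1r mul0r addr0 cpowRE.
  have -> : psi 1%N 0 = h * (- cexp (- p * L%:C) * L%:C).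
    by rewrite /psi expr1 mul0r addr0; ring.
  rewrite add0r expr1n mulr1 rmorph1 mul1r -/L => T.
  rewrite -mulrA; apply: T => s /andP[s0 s1]; rewrite /psi.
  rewrite cabsM cabsX cabsN cabsM cabsR cabs_cexp Re_mulR ReN.
  rewrite exprMn [leRHS]mulrC -[leLHS]mulrA.
  rewrite ler_wpM2l ?exprn_ge0 ?cabs_ge0 // ler_wpM2l ?exprn_ge0 // ler_expR.
  apply: le_trans (ler_norm _) _; rewrite normrM normrN ler_wpM2r //.
  apply: le_trans (cabs_geRe _) _; apply: le_trans (cabsD _ _) _; rewrite lerD2l.
  rewrite cabsM cabsR ger0_norm // -[leRHS]mulr1; apply: ler_pM; rewrite ?cabs_ge0 //.
  exact: ltW.
- by rewrite oppr0 cpowR0 mul1r contE0.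
- move=> z z3; have := csumsZ (cpowR c (- z)) (contE_series n0 d0 bal z3).
  congr csums; apply/funext => m.
  by rewrite cpowRM ?node_gt0 // mulrCA.
Qed.

(** * Fourier coefficients along a generalized limit *)

Section GeneralizedLimit.
Variable R : realType.
Implicit Types (u v : nat -> R).

Definition bounded_seq u := exists B : R, forall m, `|u m| <= B.

Definition limit_functional (L : (nat -> R) -> R) :=
  [/\ forall u v, bounded_seq u -> bounded_seq v -> L (fun m => u m + v m) = L u + L v,
      forall c u, bounded_seq u -> L (fun m => c * u m) = c * L u,
      forall u, bounded_seq u -> (forall m, 0 <= u m) -> 0 <= L u,
      L (fun=> 1) = 1 &
      forall u, (forall e : R, 0 < e -> exists M0, forall M, (M0 <= M)%N -> `|u M| <= e) ->
        L u = 0].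

(** The limit along an ultrafilter finer than the filter at infinity: a bounded sequence stays in a
    compact interval, where the ultrafilter converges. *)
Lemma limit_functional_exists : exists L, limit_functional L.
Proof.
have [U [UU sU]] := ultraFilterLemma (eventually_filter : ProperFilter (\oo : set_system nat)).
have UP : ProperFilter U by exact: ultra_proper.
pose L u : R := lim (u @ U).
have cvgU u : bounded_seq u -> u @ U --> L u.
  move=> [B HB]; have cB := @segment_compact R (- B) B.
  have UB : (u @ U) `[- B, B]%classic.
    apply: (@filterS _ U _ setT) => [m _ /=|]; last exact: filterT.
    by rewrite in_itv /= -ler_norml.
  have [p [_ Hp]] := cB (u @ U) _ UB.
  have {}Hp : u @ U --> p.
    move=> A pA; have [//|UnA] := in_ultra_setVsetC (u @^-1` A) UU.
    have [x [nAx Ax]] := Hp (~` A) A UnA pA; by [].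
  by apply/cvg_ex; exists p.
exists L; split.
- by move=> u v bu bv; apply/cvg_lim => //; apply: cvgD; exact: cvgU.
- by move=> c u bu; apply/cvg_lim => //; apply: cvgMr; exact: cvgU.
- move=> u bu u0; apply: limr_ge; first by apply/cvg_ex; exists (L u); exact: cvgU.
  by apply: filterS filterT => m _; exact: u0.
- by apply/cvg_lim => //; exact: cvg_cst.
- move=> u Hu; apply/cvg_lim => //; apply/cvgrPdist_le => e e0.
  have [M0 HM] := Hu _ e0; apply: sU; exists M0 => // M /= MM.
  by rewrite sub0r normrN HM.
Qed.

Definition glim : (nat -> R) -> R := sval (cid limit_functional_exists).

Lemma glimP : limit_functional glim. Proof. by rewrite /glim; case: cid. Qed.

End GeneralizedLimit.

(** * The characters e^(2 pi i x) *)

Section Characters.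
Variable R : realType.
Local Notation C := (CC R).

Definition ex (x : R) : C := cexp ('i * (2 * pi * x)%:C).

Lemma exD x y : ex (x + y) = ex x * ex y.
Proof. by rewrite /ex mulrDr rmorphD mulrDr cexpD. Qed.

Lemma ex0 : ex 0 = 1. Proof. by rewrite /ex mulr0 mulr0 cexp0. Qed.

Lemma exN x : ex (- x) = (ex x)^-1.
Proof. by rewrite /ex mulrN rmorphN mulrN cexpN. Qed.

Lemma ex_neq0 x : ex x != 0. Proof. exact: cexp_neq0. Qed.

Lemma Re_i2 (y : R) : Re ('i * y%:C : C) = 0.
Proof. by rewrite RecM /= mul0r mulr0 subr0. Qed.

Lemma Im_i2 (y : R) : Im ('i * y%:C : C) = y.
Proof. by rewrite ImcM /= mul0r mul1r add0r. Qed.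

Lemma cabs_ex x : cabs (ex x) = 1.
Proof. by rewrite cabs_cexp Re_i2 expR0. Qed.

Lemma Re_ex x : Re (ex x) = cos (2 * pi * x).
Proof. by rewrite Re_cexp Re_i2 Im_i2 expR0 mul1r. Qed.

Lemma Im_ex x : Im (ex x) = sin (2 * pi * x).
Proof. by rewrite Im_cexp Re_i2 Im_i2 expR0 mul1r. Qed.

Lemma conj_ex x : (ex x)^*%C = ex (- x).
Proof.
apply: ReIm_eq; rewrite ?Re_ex ?Im_ex mulrN ?cosN ?sinN -?Re_ex -?Im_ex; by case: (ex x).
Qed.

Lemma exMn (m : nat) x : ex (m%:R * x) = ex x ^+ m.
Proof.
elim: m => [|m IH]; first by rewrite mul0r ex0 expr0.
by rewrite -natr1 mulrDl mul1r exD IH exprSr.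
Qed.

Lemma ex1 : ex 1 = 1.
Proof.
apply: ReIm_eq; rewrite ?Re_ex ?Im_ex mulr1 mulr_natl /=.
  by rewrite -[pi *+ 2]add0r cosD2pi cos0.
by rewrite -[pi *+ 2]add0r sinD2pi sin0.
Qed.

Lemma ex_int (x : R) : x \is a Num.int -> ex x = 1.
Proof.
have en (m : nat) : ex m%:R = 1 by rewrite -[m%:R]mulr1 exMn ex1 expr1n.
move=> /intrP[[m|m] ->]; first exact: en.
by rewrite NegzE mulrNz -pmulrn exN en invr1.
Qed.

Lemma ex_far (t : R) : 1 / 4 <= t <= 3 / 4 -> 1 <= cabs (ex t - 1).
Proof.
move=> /andP[t1 t2]; apply: le_trans (cabs_geRe _); rewrite ReB Re_ex /=.
have p0 := @pi_gt0 R.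
have : 0 <= cos (2 * pi * t - pi).
  apply: cos_ge0_pihalf; rewrite lerBrDl lerBlDl.
  have -> : 2 * pi * t = (pi * 4 * t) / 2 :> R by field.
  have h1 : pi * 4 * (1 / 4) <= pi * 4 * t by rewrite ler_wpM2l // mulr_ge0 // ltW.
  have h2 : pi * 4 * t <= pi * 4 * (3 / 4) by rewrite ler_wpM2l // mulr_ge0 // ltW.
  apply/andP; split; lra.
set y := _ - pi => c0; have -> : 2 * pi * t = y + pi by rewrite subrK.
rewrite cosDpi ler0_norm; lra.
Qed.

(** For small t choose m with m t in [1/4, 1/2]. With z = ex t, [ex_far] gives 1 <= |z^m - 1| <= m
    |z - 1|, and 1 / m >= 2 t. *)
Lemma ex_near (t : R) : 0 <= t <= 1 / 2 -> 2 * t <= cabs (ex t - 1).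
Proof.
move=> /andP[t0 t2]; have [t4|t4] := leP (1 / 4) t.
  by apply: le_trans (ex_far _); lra.
have [t00|tp] := eqVneq t 0; first by rewrite t00 mulr0 cabs_ge0.
have {}tp : 0 < t by rewrite lt_neqAle eq_sym tp.
have pw m : cabs (ex t ^+ m - 1) <= m%:R * cabs (ex t - 1).
  elim: m => [|m IH]; first by rewrite expr0 subrr cabs0 mul0r.
  have -> : ex t ^+ m.+1 - 1 = ex t * (ex t ^+ m - 1) + (ex t - 1) by rewrite exprS; ring.
  apply: le_trans (cabsD _ _) _; rewrite cabsM cabs_ex mul1r -natr1 mulrDl mul1r.
  by rewrite lerD2r.
pose m := Num.truncn (1 / (2 * t)).
have q0 : 0 <= 1 / (2 * t) by rewrite divr_ge0 // mulr_ge0.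
have m1 : m%:R * t <= 1 / 2.
  have := truncn_le (1 / (2 * t)); rewrite q0 -/m.
  by rewrite ler_pdivlMr ?mulr_gt0 //; lra.
have m2 : 1 / 2 < (m%:R + 1) * t.
  have : 1 / (2 * t) < m.+1%:R by rewrite truncnS_gt.
  by rewrite ltr_pdivrMr ?mulr_gt0 // -natr1; lra.
have : 1 <= m%:R * cabs (ex t - 1).
  by apply: le_trans (pw m); rewrite -exMn; apply: ex_far; apply/andP; split; lra.
have c0 := cabs_ge0 (ex t - 1) => h.
have m0 : 0 < m%:R :> R.
  by rewrite lt_neqAle ler0n andbT; apply/eqP => e; move: h; rewrite -e mul0r ler10.
rewrite -(ler_pM2l m0); apply: le_trans h; lra.
Qed.

Lemma ex_eq1 (x : R) : (ex x == 1) = (x \is a Num.int).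
Proof.
apply/eqP/idP => [h|]; last exact: ex_int.
pose f := x - (Num.floor x)%:~R.
have f01 : 0 <= f < 1.
  have /andP[a b] := floor_itv x; rewrite subr_ge0 a /=.
  by rewrite ltrBlDl -intrD1.
have ef : ex f = 1.
  by rewrite exD h mul1r ex_int // rpredN; apply/intrP; exists (Num.floor x).
have f0 : f = 0.
  apply/eqP; rewrite eq_le; move/andP: f01 => [f0 f1]; rewrite f0 andbT.
  have [f2|f2] := leP f (1 / 2).
    have := @ex_near f; rewrite f0 f2 ef subrr cabs0 => /(_ isT); lra.
  have e1 : ex (1 - f) = 1 by rewrite exD ex1 mul1r exN ef invr1.
  have := @ex_near (1 - f); rewrite e1 subrr cabs0.
  have -> : 0 <= 1 - f <= 1 / 2 by apply/andP; split; lra.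
  move=> /(_ isT); lra.
have -> : x = (Num.floor x)%:~R by apply/eqP; rewrite -subr_eq0 -/f f0.
by apply/intrP; exists (Num.floor x).
Qed.

Lemma mul_iR (a b : R) : 'i * a%:C * b%:C = 'i * (a * b)%:C :> C.
Proof. by rewrite rmorphM mulrA. Qed.

Lemma cder_ex (th x : R) : cder (fun t => ex (th * t)) x ('i * (2 * pi * th)%:C * ex (th * x)).
Proof.
have h := cderZ ('i * (2 * pi * th)%:C) (cder_id x).
have := cder_cexp h; rewrite mulr1; congr cder.
  by apply/funext => t; rewrite /ex mul_iR; congr (cexp (_ * _%:C)); ring.
by rewrite /ex mul_iR; congr (_ * cexp (_ * _%:C)); ring.
Qed.

Lemma ex_taylor (th : R) : exists K : R, forall x h,
  cabs (ex (th * (x + h)) - ex (th * x) - h%:C * ('i * (2 * pi * th)%:C * ex (th * x))) <= K * h ^+ 2.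
Proof.
pose w : C := 'i * (2 * pi * th)%:C.
exists (4 * cabs w ^+ 2) => x h.
apply: (@cTaylor2T R (fun t => ex (th * t)) (fun t => w * ex (th * t))
  (fun t => w * (w * ex (th * t)))) => y.
- exact: cder_ex.
- exact/cderZ/cder_ex.
- by rewrite cabsM cabsM cabs_ex mulr1 expr2.
Qed.

End Characters.

(** * Means over the circle and uniqueness of Fourier coefficients *)

Section Mean.
Variable R : realType.
Local Notation C := (CC R).
Implicit Types (F G : R -> C) (f : R -> R).

(* A mean over the grids j / m of [0, 1), along a generalized limit: it is defined on
   every bounded function, so no integrability has to be checked. *)
Definition gridR f (m : nat) : R := (\sum_(j < m.+1) f (j%:R / m.+1%:R)) / m.+1%:R.
Definition meanR f : R := glim (gridR f).
Definition Mean F : C := meanR (fun t => Re (F t)) +i* meanR (fun t => Im (F t)).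

Definition bdd F := exists B : R, forall t, 0 <= t < 1 -> cabs (F t) <= B.

Lemma grid01 (m : nat) (j : 'I_m.+1) : 0 <= (j%:R / m.+1%:R : R) < 1.
Proof. by rewrite divr_ge0 //= ltr_pdivrMr // mul1r ltr_nat. Qed.

Lemma gridR_bound f (B : R) : (forall t, 0 <= t < 1 -> `|f t| <= B) -> forall m, `|gridR f m| <= B.
Proof.
move=> fB m; rewrite normrM normfV (ger0_norm (_ : 0 <= m.+1%:R)) // ler_pdivrMr //.
apply: le_trans (ler_norm_sum _ _ _) _.
apply: (@le_trans _ _ (\sum_(j < m.+1) B)).
  by apply: ler_sum => j _; apply: fB; exact: grid01.
by rewrite sumr_const card_ord mulr_natr.
Qed.

Lemma bdd_Re F : bdd F -> bounded_seq (gridR (fun t => Re (F t))).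
Proof.
move=> [B HB]; exists B; apply: gridR_bound => t t01.
exact: le_trans (cabs_geRe _) (HB t t01).
Qed.

Lemma bdd_Im F : bdd F -> bounded_seq (gridR (fun t => Im (F t))).
Proof.
move=> [B HB]; exists B; apply: gridR_bound => t t01.
exact: le_trans (cabs_geIm _) (HB t t01).
Qed.

Lemma gridRD f g m : gridR (fun t => f t + g t) m = gridR f m + gridR g m.
Proof. by rewrite /gridR big_split mulrDl. Qed.

Lemma gridRZ c f m : gridR (fun t => c * f t) m = c * gridR f m.
Proof. by rewrite /gridR -mulr_sumr mulrA. Qed.

Lemma gridR_cst c m : gridR (fun=> c) m = c.
Proof. by rewrite /gridR sumr_const card_ord -[c *+ _]mulr_natr mulfK // pnatr_eq0. Qed.

Lemma bddD F G : bdd F -> bdd G -> bdd (fun t => F t + G t).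
Proof.
move=> [B HB] [D HD]; exists (B + D) => t t01.
by apply: le_trans (cabsD _ _) _; apply: lerD; [exact: HB|exact: HD].
Qed.

Lemma bddM F G : bdd F -> bdd G -> bdd (fun t => F t * G t).
Proof.
move=> [B HB] [D HD]; exists (B * D) => t t01.
by rewrite cabsM; apply: ler_pM; rewrite ?cabs_ge0 // ?HB ?HD.
Qed.

Lemma bdd_cst c : bdd (fun=> c). Proof. by exists (cabs c). Qed.

Lemma bddZ c F : bdd F -> bdd (fun t => c * F t).
Proof. by move=> bF; apply: bddM bF; exact: bdd_cst. Qed.

Lemma bddN F : bdd F -> bdd (fun t => - F t).
Proof. by move=> [B HB]; exists B => t t01; rewrite cabsN HB. Qed.

Lemma bddB F G : bdd F -> bdd G -> bdd (fun t => F t - G t).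
Proof. by move=> bF bG; apply: bddD => //; exact: bddN. Qed.

Lemma bdd_ex th : bdd (fun t => ex (th * t)).
Proof. by exists 1 => t _; rewrite cabs_ex. Qed.

Lemma bdd_sum (I : Type) (r : seq I) (F : I -> R -> C) : (forall i, bdd (F i)) ->
  bdd (fun t => \sum_(i <- r) F i t).
Proof.
move=> bF; elim: r => [|i r IH].
  by exists 0 => t _; rewrite big_nil cabs0.
rewrite (_ : (fun _ => _) = fun t => F i t + \sum_(i <- r) F i t); first exact: bddD.
by apply/funext => t; rewrite big_cons.
Qed.

Lemma eq_Mean F G : (forall t, 0 <= t < 1 -> F t = G t) -> Mean F = Mean G.
Proof.
move=> FG; rewrite /Mean /meanR; congr (glim _ +i* glim _); apply/funext => m;
  rewrite /gridR; congr (_ / _); apply: eq_bigr => j _; rewrite FG //; exact: grid01.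
Qed.

Lemma MeanD F G : bdd F -> bdd G -> Mean (fun t => F t + G t) = Mean F + Mean G.
Proof.
move=> bF bG; have [LD _ _ _ _] := glimP R; apply: ReIm_eq; rewrite ?ReD ?ImD /= /meanR.
  rewrite -LD; [|exact: bdd_Re|exact: bdd_Re].
  by congr glim; apply/funext => m; rewrite -gridRD; congr gridR; apply/funext => t; rewrite ReD.
rewrite -LD; [|exact: bdd_Im|exact: bdd_Im].
by congr glim; apply/funext => m; rewrite -gridRD; congr gridR; apply/funext => t; rewrite ImD.
Qed.

Lemma MeanZ c F : bdd F -> Mean (fun t => c * F t) = c * Mean F.
Proof.
move=> bF; have [LD LZ _ _ _] := glimP R.
have bR := bdd_Re bF; have bI := bdd_Im bF.
have bZ (r : R) u : bounded_seq u -> bounded_seq (fun m => r * u m).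
  by move=> [B HB]; exists (`|r| * B) => m; rewrite normrM ler_wpM2l.
apply: ReIm_eq; rewrite ?RecM ?ImcM /= /meanR.
  rewrite -mulNr -!LZ // -LD; [|exact: bZ|exact: bZ].
  congr glim; apply/funext => m; rewrite -!gridRZ -gridRD; congr gridR; apply/funext => t.
  by rewrite RecM mulNr.
rewrite -!LZ // -LD; [|exact: bZ|exact: bZ].
congr glim; apply/funext => m; rewrite -!gridRZ -gridRD; congr gridR; apply/funext => t.
by rewrite ImcM.
Qed.

Lemma MeanB F G : bdd F -> bdd G -> Mean (fun t => F t - G t) = Mean F - Mean G.
Proof.
move=> bF bG; rewrite MeanD //; last exact: bddN.
congr (_ + _); rewrite -mulN1r -MeanZ //; congr Mean; apply/funext => t.
by rewrite mulN1r.
Qed.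

Lemma Mean_sum (I : Type) (r : seq I) (F : I -> R -> C) : (forall i, bdd (F i)) ->
  Mean (fun t => \sum_(i <- r) F i t) = \sum_(i <- r) Mean (F i).
Proof.
move=> bF; elim: r => [|i r IH].
  rewrite big_nil -[RHS](mul0r (Mean (fun=> 0))) -MeanZ; last exact: bdd_cst.
  by apply: eq_Mean => t _; rewrite big_nil mul0r.
rewrite big_cons -IH -MeanD //; last exact: bdd_sum.
by apply: eq_Mean => t _; rewrite big_cons.
Qed.

Lemma Mean_Re_ge0 F : bdd F -> (forall t, 0 <= t < 1 -> 0 <= Re (F t)) -> 0 <= Re (Mean F).
Proof.
move=> bF F0; have [_ _ Lp _ _] := glimP R; apply: Lp; first exact: bdd_Re.
by move=> m; rewrite divr_ge0 // sumr_ge0 // => j _; apply: F0; exact: grid01.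
Qed.

Lemma meanR_le f (B : R) : (forall t, 0 <= t < 1 -> `|f t| <= B) -> `|meanR f| <= B.
Proof.
move=> fB; have [LD LZ Lp L1 _] := glimP R.
have gB := gridR_bound fB.
have bg : bounded_seq (gridR f) by exists B.
have b1 : bounded_seq (fun=> 1 : R) by exists 1 => m; rewrite normr1.
have bc c : bounded_seq (fun=> c * 1 : R) by exists `|c * 1|.
have bm : bounded_seq (fun m => -1 * gridR f m).
  by exists B => m; rewrite mulN1r normrN.
rewrite ler_norml; apply/andP; split.
  have := Lp (fun m => gridR f m + B * 1); rewrite LD // LZ // L1 mulr1 -/(meanR f).
  rewrite -lerBlDr sub0r; apply.
    by exists (B + `|B|) => m; rewrite (le_trans (ler_normD _ _)) // lerD2r.
  by move=> m; rewrite -lerBlDr sub0r; have := gB m; rewrite ler_norml => /andP[].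
have := Lp (fun m => B * 1 + -1 * gridR f m); rewrite LD // !LZ // L1 mulr1 mulN1r subr_ge0.
apply.
  by exists (`|B| + B) => m; rewrite mulN1r (le_trans (ler_normB _ _)) // lerD2l.
by move=> m; rewrite mulN1r subr_ge0; have := gB m; rewrite ler_norml => /andP[].
Qed.

Lemma Mean_le F (B : R) : (forall t, 0 <= t < 1 -> cabs (F t) <= B) -> cabs (Mean F) <= 2 * B.
Proof.
move=> FB; apply: le_trans (cabs_leReIm _) _; rewrite mulr_natl mulr2n /=; apply: lerD.
  by apply: meanR_le => t /FB; exact: le_trans (cabs_geRe _).
by apply: meanR_le => t /FB; exact: le_trans (cabs_geIm _).
Qed.

Lemma Mean_cst c : Mean (fun=> c) = c.
Proof.
have [_ LZ _ L1 _] := glimP R.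
have b1 : bounded_seq (fun=> 1 : R) by exists 1 => m; rewrite normr1.
have Lc (r : R) : glim (gridR (fun=> r)) = r.
  rewrite (_ : gridR _ = fun=> r * 1); first by rewrite LZ // L1 mulr1.
  by apply/funext => m; rewrite gridR_cst mulr1.
by rewrite /Mean /meanR !Lc; case: c.
Qed.

Lemma Mean_grid0 F : (forall e : R, 0 < e -> exists M0, forall M, (M0 <= M)%N ->
    cabs ((\sum_(j < M.+1) F (j%:R / M.+1%:R)) * (M.+1%:R^-1)%:C) <= e) -> Mean F = 0.
Proof.
move=> H; have [_ _ _ _ L0] := glimP R; apply: ReIm_eq; apply: L0 => e /H [M0 HM];
  exists M0 => M /HM; apply: le_trans; rewrite /gridR.
  by rewrite -Re_sum -Re_mulR cabs_geRe.
by rewrite -Im_sum -Im_mulR cabs_geIm.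
Qed.

Lemma inv_small (B e : R) : 0 < e -> exists M0, forall M, (M0 <= M)%N -> B / M.+1%:R <= e.
Proof.
move=> e0; exists (Num.truncn (`|B| / e)) => M MM; rewrite ler_pdivrMr //.
have : `|B| / e < (Num.truncn (`|B| / e)).+1%:R by rewrite truncnS_gt.
rewrite ltr_pdivrMr // mulrC => h; apply: le_trans (ler_norm _) _.
apply: le_trans (ltW h) _; rewrite ler_wpM2l ?(ltW e0) // ler_nat ltnS //.
Qed.

(** With step h = 1 / N the increments of F telescope to 0 over a period, while each differs from h
    F' by O(h^2); the grid mean of F' is therefore O(h). *)
Lemma Mean_derivative F F' (K B : R) : (forall t, F (t + 1) = F t) ->
  (forall t, cabs (F t) <= B) ->
  (forall t h, cabs (F (t + h) - F t - h%:C * F' t) <= K * h ^+ 2) -> Mean F' = 0.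
Proof.
move=> per FB FK; apply: Mean_grid0 => e e0.
have [M0 HM] := inv_small K e0; exists M0 => M /HM; apply: le_trans.
pose N := M.+1; pose h : R := N%:R^-1.
have N0 : N%:R != 0 :> R by rewrite pnatr_eq0.
have Nh : N%:R * h = 1 by rewrite divff.
have tele : \sum_(j < N) (F (j%:R * h + h) - F (j%:R * h)) = 0.
  have -> : \sum_(j < N) (F (j%:R * h + h) - F (j%:R * h)) = F (N%:R * h) - F (0%:R * h).
    rewrite -(@telescope_sumr _ 0 N (fun j => F (j%:R * h))) // big_mkord.
    by apply: eq_bigr => j _; rewrite -natr1 mulrDl mul1r.
  by rewrite Nh mul0r -[1]add0r per subrr.
have -> : (\sum_(j < N) F' (j%:R / N%:R)) * h%:C =
   - \sum_(j < N) (F (j%:R * h + h) - F (j%:R * h) - h%:C * F' (j%:R * h)).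
  by rewrite sumrB tele sub0r opprK -mulr_sumr mulrC.
rewrite cabsN; apply: le_trans (cabs_sum _ _ _) _.
apply: (@le_trans _ _ (\sum_(j < N) K * h ^+ 2)); first by apply: ler_sum => j _; exact: FK.
rewrite sumr_const card_ord -[(_ * _) *+ N]mulr_natr.
have -> : K * h ^+ 2 * N%:R = K * h * (N%:R * h) by ring.
by rewrite Nh mulr1.
Qed.

(** For th != 0 the character is a multiple of its own derivative, which has mean 0. *)
Lemma Mean_ex (th : R) : th \is a Num.int -> Mean (fun t => ex (th * t)) = (th == 0)%:R.
Proof.
move=> thi; have [->|th0] := eqVneq th 0.
  by rewrite -[RHS]Mean_cst; apply: eq_Mean => t _; rewrite mul0r ex0.
have [K HK] := ex_taylor th.
have w0 : ('i * (2 * pi * th)%:C : C) != 0.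
  apply/eqP => /(congr1 (@complex.Im R)); rewrite Im_i2 /= => /eqP.
  by rewrite !mulf_eq0 (negPf th0) (gt_eqF (pi_gt0 R)) pnatr_eq0.
apply: (mulfI w0); rewrite mulr0 -MeanZ; last exact: bdd_ex.
apply: (@Mean_derivative (fun t => ex (th * t)) _ K 1) => [t|t|t h].
- by rewrite mulrDr mulr1 exD (ex_int thi) mulr1.
- by rewrite cabs_ex.
- exact: HK.
Qed.

Lemma conjcD_ (z w : C) : (z + w)^*%C = z^*%C + w^*%C.
Proof. by case: z => a b; case: w => c e; apply: ReIm_eq => //=; rewrite opprD. Qed.

Lemma conjc_sum (I : Type) (r : seq I) (F : I -> C) :
  (\sum_(i <- r) F i)^*%C = \sum_(i <- r) (F i)^*%C.
Proof. by elim/big_rec2: _ => [|i y z _ <-]; rewrite ?conjc0 // conjcD_. Qed.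

(** A form of Bessel's inequality: with s the sum of M of the characters, the mean of |g - A s|^2 >=
    0 gives M |A|^2 <= mean of |g|^2, for every M. *)
Lemma bessel_constant (g : R -> C) (k : nat -> R) (A : C) : bdd g ->
  (forall i, k i \is a Num.int) -> injective k ->
  (forall i, Mean (fun t => g t * ex (- k i * t)) = A) -> A = 0.
Proof.
move=> bg ki kinj HA.
have bgg : bdd (fun t => g t * (g t)^*%C).
  apply: bddM => //; have [B HB] := bg; exists B => t /HB; congr (_ <= _).
  by rewrite !cabsE; case: (g t) => a b /=; rewrite sqrrN.
pose B0 := Re (Mean (fun t => g t * (g t)^*%C)).
pose a := Re (A * A^*%C).
have aE : A * A^*%C = a%:C.
  by rewrite /a; apply: ReIm_eq => //=; case: (A) => x y /=; ring.
have key M : M%:R * a <= B0.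
  (* The two conjugate cross terms are replaced by twice one of them, so that only the real part of
     H is |g - A s|^2. *)
  pose H t := g t * (g t)^*%C - 2 * A^*%C * (\sum_(i < M) g t * ex (- k i * t))
    + A * A^*%C * \sum_(i < M) \sum_(j < M) ex ((k i - k j) * t).
  have b1 : bdd (fun t => \sum_(i < M) g t * ex (- k i * t)).
    by apply: bdd_sum => i; apply: bddM => //; exact: bdd_ex.
  have b2 : bdd (fun t => \sum_(i < M) \sum_(j < M) ex ((k i - k j) * t)).
    by apply: bdd_sum => i; apply: bdd_sum => j; exact: bdd_ex.
  have bH : bdd H by apply: bddD (bddZ _ b2); apply: bddB => //; exact: bddZ.
  have H0 t : 0 <= t < 1 -> 0 <= Re (H t).
    move=> _; pose s := \sum_(i < M) ex (k i * t).
    have sC : s^*%C = \sum_(i < M) ex (- k i * t).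
      rewrite (_ : s^*%C = \sum_(i < M) (ex (k i * t))^*%C); last exact: conjc_sum.
      by apply: eq_bigr => i _; rewrite mulNr; exact: conj_ex.
    have e1 : \sum_(i < M) g t * ex (- k i * t) = g t * s^*%C.
      by rewrite -mulr_sumr sC.
    have e2 : \sum_(i < M) \sum_(j < M) ex ((k i - k j) * t) = s * s^*%C.
      rewrite sC mulr_suml; apply: eq_bigr => i _; rewrite mulr_sumr.
      by apply: eq_bigr => j _; rewrite -exD mulNr mulrBl.
    have -> : Re (H t) = Re ((g t - A * s) * (g t - A * s)^*%C).
      rewrite /H e1 e2 (rmorphB conjc) (rmorphM conjc); case: (g t) => ? ?; case: (A) => ? ?.
      by case: (s) => ? ? /=; simpc => /=; ring.
    by case: (g t - A * s) => x y /=; rewrite mulrN opprK addr_ge0 // -expr2 sqr_ge0.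
  have := Mean_Re_ge0 bH H0.
  rewrite MeanD; [|by apply: bddB => //; exact: bddZ|exact: bddZ].
  rewrite MeanB //; last exact: bddZ.
  rewrite !MeanZ // !Mean_sum; first last.
  - by move=> i; apply: bddM => //; exact: bdd_ex.
  - by move=> i; apply: bdd_sum => j; exact: bdd_ex.
  have -> : \sum_(i < M) Mean (fun t => g t * ex (- k i * t)) = A *+ M.
    by rewrite -[in RHS](card_ord M) -sumr_const; apply: eq_bigr => i _; rewrite HA.
  have -> : \sum_(i < M) Mean (fun t => \sum_(j < M) ex ((k i - k j) * t)) = M%:R.
    rewrite -[in RHS](card_ord M) -sumr_const; apply: eq_bigr => i _.
    rewrite Mean_sum; last by move=> j; exact: bdd_ex.
    rewrite (bigD1 i) //= subrr big1 => [|j ji].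
      by rewrite Mean_ex // eqxx addr0.
    rewrite Mean_ex ?rpredB // subr_eq0; case: eqP => // /kinj e.
    by move: ji; rewrite -val_eqE /= e eqxx.
  have eM : (M%:R : C) = (M%:R : R)%:C by rewrite (rmorph_nat (real_complex R)).
  have e2 : (2 : C) = (2 : R)%:C by rewrite (rmorph_nat (real_complex R)).
  have -> : 2 * A^*%C * (A *+ M) = 2 * (A * A^*%C) * M%:R by rewrite -[A *+ M]mulr_natr; ring.
  rewrite aE e2 eM -!(rmorphM (real_complex R)) ReD ReB -/B0 /=; lra.
have a0 : a = 0.
  apply/eqP; rewrite eq_le; apply/andP; split; last first.
    by rewrite /a; case: (A) => x y /=; rewrite mulrN opprK addr_ge0 // -expr2 sqr_ge0.
  rewrite leNgt; apply/negP => a0.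
  have := key (Num.truncn (B0 / a)).+1; rewrite -ler_pdivlMr // leNgt.
  by rewrite truncnS_gt.
move: aE; rewrite a0 => /eqP; rewrite mulf_eq0 conjc_eq0 orbb => /eqP.
by [].
Qed.

(* Writing F - F(0) = (e^(2 pi i t) - 1) g, the Fourier coefficients of g are constant on
   each half line, hence zero by Bessel, and F(0) is their jump at 0. *)
Lemma fourier_uniqueness F (L : R) : (forall t, F (t + 1) = F t) ->
  (forall t, cabs (F t - F 0) <= L * `|t|) ->
  (forall m : R, m \is a Num.int -> Mean (fun t => F t * ex (- m * t)) = 0) -> F 0 = 0.
Proof.
move=> per lip H.
pose g t := (F t - F 0) / (ex t - 1).
have F01 : F 1 = F 0 by rewrite -[1]add0r per.
have gF t : 0 <= t < 1 -> F t - F 0 = (ex t - 1) * g t.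
  move=> /andP[t0 t1].
  have [->|tn] := eqVneq t 0; first by rewrite subrr ex0 subrr mul0r.
  rewrite /g mulrC divfK //; rewrite subr_eq0 ex_eq1; apply/negP => /intrP[z tz].
  move: t0 t1; rewrite tz ler0z -[1]/(1%:~R) ltr_int => z0 z1.
  have z00 : z = 0 by apply/eqP; rewrite eq_le z0 andbT -ltzD1 add0r.
  by move: tn; rewrite tz z00 eqxx.
have bg : bdd g.
  exists (`|L| / 2) => t /andP[t0 t1]; have [->|tn] := eqVneq t 0.
    by rewrite /g subrr mul0r cabs0 divr_ge0.
  have {}t0 : 0 < t by rewrite lt_neqAle eq_sym tn.
  (* s is the distance from t to the nearer end of [0, 1]; at both ends F - F 0 and ex t - 1
     vanish. *)
  suff [s [s0 Fs es]] : exists s : R, [/\ 0 < s, cabs (F t - F 0) <= L * s & 2 * s <= cabs (ex t - 1)].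
    have e0 : 0 < cabs (ex t - 1) by apply: lt_le_trans es; rewrite mulr_gt0.
    have n0 : ex t - 1 != 0 by apply/eqP => z; move: e0; rewrite z cabs0 ltxx.
    rewrite /g cabsM; have -> : cabs (ex t - 1)^-1 = (cabs (ex t - 1))^-1 by exact: Normc.normcV.
    rewrite ler_pdivrMr //; apply: le_trans Fs _.
    apply: (@le_trans _ _ (`|L| / 2 * (2 * s))).
      by rewrite mulrA divfK // ler_wpM2r ?(ltW s0) // ler_norm.
    by rewrite ler_wpM2l // divr_ge0.
  have [t2|t2] := leP t (1 / 2).
    exists t; split=> //; first by have := lip t; rewrite gtr0_norm.
    by apply: ex_near; rewrite ltW.
  exists (1 - t); split; first by rewrite subr_gt0.
    have := lip (t - 1); rewrite -per subrK distrC gtr0_norm ?subr_gt0 //.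
  have := @ex_near R (1 - t); have -> : 0 <= 1 - t <= 1 / 2 by apply/andP; split; lra.
  move=> /(_ isT) h; apply: le_trans h _.
  have -> : ex (1 - t) - 1 = - ex (- t) * (ex t - 1).
    by rewrite exD ex1 mul1r mulrBr mulr1 mulNr -exD addNr ex0; ring.
  by rewrite cabsM cabsN cabs_ex mul1r.
have bF : bdd F.
  exists (cabs (F 0) + `|L|) => t /andP[t0 t1].
  have -> : F t = F 0 + (F t - F 0) by ring.
  apply: le_trans (cabsD _ _) _; rewrite lerD2l; apply: le_trans (lip t) _.
  apply: (@le_trans _ _ (`|L| * `|t|)); first by rewrite ler_wpM2r // ler_norm.
  by rewrite ler_piMr // ger0_norm // ltW.
pose gh (m : R) := Mean (fun t => g t * ex (- m * t)).
(* Multiplication by ex t - 1 shifts frequencies by one: the jump of the coefficients of g at m is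
   the coefficient of F - F 0, and those of F are zero. *)
have step (m : R) : m \is a Num.int -> gh (m - 1) - gh m = - (F 0 * (m == 0)%:R).
  move=> mi; have mi' : - m \is a Num.int by rewrite rpredN.
  have b1 c : bdd (fun t => c * ex (- m * t)) by apply: bddZ; exact: bdd_ex.
  have b2 G r : bdd G -> bdd (fun t => G t * ex (- r * t)).
    by move=> bG; apply: bddM => //; exact: bdd_ex.
  suff -> : gh (m - 1) - gh m =
      Mean (fun t => F t * ex (- m * t)) - Mean (fun t => F 0 * ex (- m * t)).
    by rewrite H // MeanZ ?Mean_ex ?oppr_eq0 ?sub0r //; exact: bdd_ex.
  rewrite -!MeanB; try (by apply: b1); try (by apply: b2).
  apply: eq_Mean => t t01; rewrite -mulrBl gF // opprB mulrBl mulrBl mul1r mulrBl mul1r.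
  by rewrite !mulNr exD; ring.
have int_nat (i : nat) : (i%:R : R) \is a Num.int by rewrite rpred_nat.
have gp (i : nat) : gh i%:R = gh 0.
  elim: i => // i <-; have := step i.+1%:R (int_nat _).
  rewrite pnatr_eq0 mulr0 oppr0 -natr1 addrK => /eqP; rewrite subr_eq0 => /eqP.
  by [].
have gn (i : nat) : gh (- i.+1%:R) = gh (-1).
  elim: i => [|i <-] //; have := step (- i.+1%:R); rewrite rpredN int_nat => /(_ isT).
  rewrite oppr_eq0 pnatr_eq0 mulr0 oppr0 => /eqP; rewrite subr_eq0 => /eqP <-.
  by rewrite -[in LHS]natr1 opprD.
have g0 : gh 0 = 0.
  apply: (@bessel_constant g (fun i => i%:R) _ bg int_nat _ gp) => i j /eqP.
  by rewrite eqr_nat => /eqP.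
have g1 : gh (-1) = 0.
  apply: (@bessel_constant g (fun i => - i.+1%:R) _ bg _ _ gn) => [i|i j].
    by rewrite rpredN int_nat.
  by move=> /oppr_inj /eqP; rewrite eqr_nat eqSS => /eqP.
have := step 0 (int_nat 0%N); rewrite sub0r g0 g1 subrr eqxx mulr1 => /eqP.
by rewrite eq_sym oppr_eq0 => /eqP.
Qed.

End Mean.

(** * Fourier components of quasi-periodic functions of several variables *)

Section QuasiPeriodic.
Variables (R : realType) (V : lmodType R) (N : nat) (a : 'I_N -> V) (delta : 'I_N -> R).
Local Notation C := (CC R).
Implicit Types (f g : V -> C) (df : V -> V -> C) (x v : V) (th : 'I_N -> R).

(* df v is the derivative of f in the direction v. Only the second order bound
   [nice_taylor] is used from smoothness, and it passes to generalized means. *)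
Record nice f df := Nice {
  nice_bound : exists B : R, forall x, cabs (f x) <= B;
  nice_dbound : forall v, exists B : R, forall x, cabs (df v x) <= B;
  nice_taylor : forall v, exists K : R, forall x (h : R),
    cabs (f (x + h *: v) - f x - h%:C * df v x) <= K * h ^+ 2;
  nice_dD : forall u v x, df (u + v) x = df u x + df v x;
  nice_dZ : forall (c : R) v x, df (c *: v) x = c%:C * df v x;
  nice_period : forall i x, f (x + a i) = ex (delta i) * f x
}.

Definition cbounded f := exists B : R, forall x, cabs (f x) <= B.

Lemma bounded_bdd f x v : cbounded f -> bdd (fun t => f (x + t *: v)).
Proof. by move=> [B HB]; exists B => t _; exact: HB. Qed.

Lemma bounded_bddM f x v (r : R) : cbounded f -> bdd (fun t => f (x + t *: v) * ex (r * t)).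
Proof. by move=> bf; apply: bddM; [exact: bounded_bdd|exact: bdd_ex]. Qed.

Definition proj i (r : R) f x : C := Mean (fun t => f (x + t *: a i) * ex (- r * t)).

Lemma proj_le i r f x (B : R) : (forall x, cabs (f x) <= B) -> cabs (proj i r f x) <= 2 * B.
Proof. by move=> fB; apply: Mean_le => t _; rewrite cabsM cabs_ex mulr1. Qed.

Lemma proj_bounded i r f : cbounded f -> cbounded (proj i r f).
Proof. by move=> [B HB]; exists (2 * B) => x; exact: proj_le. Qed.

Lemma projD i r f g x : cbounded f -> cbounded g ->
  proj i r (fun y => f y + g y) x = proj i r f x + proj i r g x.
Proof.
move=> bf bg; rewrite /proj -MeanD; [|exact: bounded_bddM|exact: bounded_bddM].
by apply: eq_Mean => t _; rewrite mulrDl.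
Qed.

Lemma projZ i r c f x : cbounded f -> proj i r (fun y => c * f y) x = c * proj i r f x.
Proof.
move=> bf; rewrite /proj -MeanZ; last exact: bounded_bddM.
by apply: eq_Mean => t _; rewrite mulrA.
Qed.

Lemma boundedZ c f : cbounded f -> cbounded (fun y => c * f y).
Proof.
by move=> [B HB]; exists (cabs c * B) => x; rewrite cabsM ler_wpM2l ?cabs_ge0.
Qed.

Lemma boundedD f g : cbounded f -> cbounded g -> cbounded (fun y => f y + g y).
Proof.
move=> [B HB] [D HD]; exists (B + D) => x; apply: le_trans (cabsD _ _) _.
by apply: lerD; [exact: HB|exact: HD].
Qed.

Lemma nice_proj f df i r : nice f df -> nice (proj i r f) (fun v => proj i r (df v)).
Proof.
move=> [bf bdf tf fD fZ fp]; split.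
- exact: proj_bounded.
- by move=> v; exact: proj_bounded (bdf v).
- move=> v; have [K HK] := tf v; exists (2 * K) => x h.
  rewrite -mulrA.
  have -> : proj i r f (x + h *: v) - proj i r f x - h%:C * proj i r (df v) x =
    Mean (fun t => (f (x + t *: a i + h *: v) - f (x + t *: a i) - h%:C * df v (x + t *: a i))
       * ex (- r * t)).
    rewrite /proj -MeanZ; last exact/bounded_bddM/bdf.
    rewrite -MeanB; [|exact: bounded_bddM|exact: bounded_bddM].
    rewrite -MeanB; last 2 first.
    - by apply: bddB; exact: bounded_bddM.
    - by apply: bddZ; exact/bounded_bddM/bdf.
    by apply: eq_Mean => t _; rewrite (addrAC x); ring.
  by apply: Mean_le => t _; rewrite cabsM cabs_ex mulr1.
- move=> u v x; rewrite -projD; [|exact: bdf|exact: bdf].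
  by apply: eq_Mean => t _; rewrite fD.
- move=> c v x; rewrite -projZ; last exact: bdf.
  by apply: eq_Mean => t _; rewrite fZ.
- move=> j x; rewrite -projZ //.
  by apply: eq_Mean => t _; rewrite addrAC fp.
Qed.

(** The product rule for second order remainders, the form in which [Mean_derivative] takes a
    derivative. *)
Lemma taylorM (F F1 G G1 : R -> C) (BF B1 BG K L : R) :
  (forall t, cabs (F t) <= BF) -> (forall t, cabs (F1 t) <= B1) -> (forall t, cabs (G t) <= BG) ->
  (forall t h, cabs (F (t + h) - F t - h%:C * F1 t) <= K * h ^+ 2) ->
  (forall t h, cabs (G (t + h) - G t - h%:C * G1 t) <= K * h ^+ 2) ->
  (forall t h, cabs (G (t + h) - G t) <= L * `|h|) ->
  forall t h, cabs (F (t + h) * G (t + h) - F t * G t - h%:C * (F1 t * G t + F t * G1 t))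
    <= (K * BG + B1 * L + BF * K) * h ^+ 2.
Proof.
move=> HF HF1 HG tF tG lG t h.
have -> : F (t + h) * G (t + h) - F t * G t - h%:C * (F1 t * G t + F t * G1 t) =
  (F (t + h) - F t - h%:C * F1 t) * G (t + h) + h%:C * F1 t * (G (t + h) - G t)
  + F t * (G (t + h) - G t - h%:C * G1 t) by ring.
have B10 : 0 <= B1 by apply: le_trans (HF1 0); exact: cabs_ge0.
have BF0 : 0 <= BF by apply: le_trans (HF 0); exact: cabs_ge0.
apply: le_trans (cabsD _ _) _; rewrite [leRHS]mulrDl; apply: lerD.
  apply: le_trans (cabsD _ _) _; rewrite [leRHS]mulrDl; apply: lerD.
    rewrite cabsM mulrAC; apply: ler_pM; rewrite ?cabs_ge0 //.
  rewrite !cabsM cabsR mulrAC.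
  have -> : B1 * L * h ^+ 2 = (`|h| * (L * `|h|)) * B1.
    by rewrite -(real_normK (num_real h)); ring.
  apply: ler_pM; rewrite ?mulr_ge0 ?cabs_ge0 //.
  by apply: ler_wpM2l.
by rewrite cabsM -mulrA; apply: ler_pM; rewrite ?cabs_ge0.
Qed.

Lemma nice_lip f df v : nice f df -> exists L : R, forall x (h : R), cabs (f (x + h *: v) - f x) <= L * `|h|.
Proof.
move=> [[B HB] bdf tf _ _ _]; have [K HK] := tf v; have [B1 HB1] := bdf v.
exists (`|K| + B1 + 2 * B) => x h.
have B0 : 0 <= B by apply: le_trans (HB 0); exact: cabs_ge0.
have B10 : 0 <= B1 by apply: le_trans (HB1 0); exact: cabs_ge0.
have [h1|h1] := leP `|h| 1.
  have -> : f (x + h *: v) - f x = (f (x + h *: v) - f x - h%:C * df v x) + h%:C * df v x by ring.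
  apply: le_trans (cabsD _ _) _; rewrite [leRHS]mulrDl [X in _ <= X + _]mulrDl -[leLHS]addr0; apply: lerD.
    apply: lerD.
      apply: le_trans (HK _ _) _; apply: (@le_trans _ _ (`|K| * h ^+ 2)).
        by rewrite ler_wpM2r ?sqr_ge0 // ler_norm.
      by rewrite ler_wpM2l // -(real_normK (num_real h)) expr2 ler_piMl.
    by rewrite cabsM cabsR mulrC ler_wpM2r.
  by rewrite !mulr_ge0.
apply: le_trans (cabsB _ _) _; apply: (@le_trans _ _ (2 * B * 1)).
  by rewrite mulr1 mulr_natl mulr2n; apply: lerD.
apply: ler_pM; rewrite ?mulr_ge0 ?ler01 //; last exact: ltW.
by rewrite lerDr addr_ge0.
Qed.

Lemma shift_affine x v (t h : R) : x + (t + h) *: v = x + t *: v + h *: v.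
Proof. by rewrite scalerDl addrA. Qed.

Lemma ex_lip (th : R) : exists L : R, forall t h, cabs (ex (th * (t + h)) - ex (th * t)) <= L * `|h|.
Proof.
have [K HK] := ex_taylor th; pose w : C := 'i * (2 * pi * th)%:C.
exists (`|K| + cabs w + 2) => t h; have [h1|h1] := leP `|h| 1.
  have -> : ex (th * (t + h)) - ex (th * t) = (ex (th * (t + h)) - ex (th * t) -
     h%:C * (w * ex (th * t))) + h%:C * (w * ex (th * t)) by ring.
  apply: le_trans (cabsD _ _) _; rewrite [leRHS]mulrDl [X in _ <= X + _]mulrDl -[leLHS]addr0; apply: lerD; last by rewrite mulr_ge0.
  apply: lerD.
    apply: le_trans (HK _ _) _; apply: (@le_trans _ _ (`|K| * h ^+ 2)).
      by rewrite ler_wpM2r ?sqr_ge0 // ler_norm.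
    by rewrite ler_wpM2l // -(real_normK (num_real h)) expr2 ler_piMl.
  by rewrite cabsM cabsR cabsM cabs_ex mulr1 mulrC.
apply: le_trans (cabsB _ _) _; rewrite !cabs_ex; apply: (@le_trans _ _ (2 * 1)).
  by rewrite mulr1.
apply: ler_pM; rewrite ?ler01 //; last exact: ltW.
by rewrite lerDr addr_ge0 // cabs_ge0.
Qed.

(** Integration by parts: f(x + t a_i) e^(-2 pi i r t) has period 1 in t because r - delta i is an
    integer, so its derivative has mean 0. *)
Lemma proj_derivative f df i r x : nice f df -> r - delta i \is a Num.int ->
  proj i r (df (a i)) x = 'i * (2 * pi * r)%:C * proj i r f x.
Proof.
move=> nf ri; have [[B HB] bdf tf _ _ fp] := nf.
have [B1 HB1] := bdf (a i); have [K1 HK1] := tf (a i).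
have [K2 HK2] := ex_taylor (- r); have [L HL] := ex_lip (- r).
pose K := Num.max K1 K2.
pose F t := f (x + t *: a i); pose F1 t := df (a i) (x + t *: a i).
pose G (t : R) := ex (- r * t); pose G1 t := 'i * (2 * pi * - r)%:C * G t.
have := @taylorM F F1 G G1 B B1 1 K L (fun t => HB _) (fun t => HB1 _) _ _ _ HL.
have h1 t : cabs (G t) <= 1 by rewrite cabs_ex.
have h2 t h : cabs (F (t + h) - F t - h%:C * F1 t) <= K * h ^+ 2.
  rewrite /F shift_affine; apply: le_trans (HK1 _ _) _.
  by rewrite ler_wpM2r ?sqr_ge0 // le_max lexx.
have h3 t h : cabs (G (t + h) - G t - h%:C * G1 t) <= K * h ^+ 2.
  by apply: le_trans (HK2 _ _) _; rewrite ler_wpM2r ?sqr_ge0 // le_max lexx orbT.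
move=> /(_ h1 h2 h3) T.
have per t : F (t + 1) * G (t + 1) = F t * G t.
  rewrite /F /G shift_affine scale1r fp mulrDr mulr1 exD.
  have -> : ex (delta i) * f (x + t *: a i) * (ex (- r * t) * ex (- r)) =
    f (x + t *: a i) * ex (- r * t) * (ex (delta i) * ex (- r)) by ring.
  by rewrite -exD -(opprB r) (ex_int (x := - (r - delta i))) ?mulr1 // rpredN.
have bFG t : cabs (F t * G t) <= B by rewrite cabsM [cabs (G t)]cabs_ex mulr1; exact: HB.
have := @Mean_derivative R (fun t => F t * G t) _ _ B per bFG T.
have b1 : bdd (fun t => F1 t * G t) by apply: bounded_bddM; exists B1.
have b2 : bdd (fun t => F t * G t) by apply: bounded_bddM; exists B.
have -> : (fun t => F1 t * G t + F t * G1 t) =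
  (fun t => F1 t * G t - 'i * (2 * pi * r)%:C * (F t * G t)).
  apply/funext => t; congr (_ + _); rewrite /G1 mulrN rmorphN; ring.
rewrite MeanB //; last exact: bddZ.
by rewrite MeanZ // => /eqP; rewrite subr_eq0 => /eqP.
Qed.

(** The factor e^(-2 pi i delta_i t) makes the restriction of f to a line periodic, and
    [fourier_uniqueness] applies. *)
Lemma proj_uniqueness f df i x : nice f df ->
  (forall r, r - delta i \is a Num.int -> proj i r f x = 0) -> f x = 0.
Proof.
move=> nf H; have [[B HB] _ _ _ _ fp] := nf.
have [L HL] := nice_lip (a i) nf; have [L2 HL2] := ex_lip (- delta i).
pose F t := f (x + t *: a i) * ex (- delta i * t).
have F0 : F 0 = f x by rewrite /F scale0r addr0 mulr0 ex0 mulr1.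
rewrite -F0; apply: (@fourier_uniqueness _ F (`|L| + B * L2)) => [t|t|m mi].
- rewrite /F shift_affine scale1r fp mulrDr mulr1 exD exN.
  by field; exact: ex_neq0.
- rewrite F0 /F.
  have -> : f (x + t *: a i) * ex (- delta i * t) - f x = (f (x + t *: a i) - f x) * ex (- delta i * t)
    + f x * (ex (- delta i * (0 + t)) - ex (- delta i * 0)) by rewrite add0r mulr0 ex0; ring.
  apply: le_trans (cabsD _ _) _; rewrite [leRHS]mulrDl; apply: lerD.
    rewrite cabsM cabs_ex mulr1; apply: le_trans (HL _ _) _.
    by rewrite ler_wpM2r // ler_norm.
  rewrite cabsM -mulrA; apply: ler_pM; rewrite ?cabs_ge0 //.
- rewrite -[RHS](H (m + delta i)); last by rewrite addrK.
  apply: eq_Mean => t _; rewrite -mulrA -exD; congr (_ * ex _); ring.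
Qed.

(* the Fourier component of f at the character taking the values th on the periods a *)
Definition projs (s : seq 'I_N) th f : V -> C := foldr (fun i g => proj i (th i) g) f s.

Lemma projs_bounded s th f : cbounded f -> cbounded (projs s th f).
Proof. by move=> bf; elim: s => //= i s IH; exact: proj_bounded. Qed.

Lemma projsD s th f g : cbounded f -> cbounded g ->
  projs s th (fun y => f y + g y) = (fun y => projs s th f y + projs s th g y).
Proof.
move=> bf bg; elim: s => //= i s ->; apply/funext => y.
by rewrite projD //; exact: projs_bounded.
Qed.

Lemma projsZ s th c f : cbounded f ->
  projs s th (fun y => c * f y) = (fun y => c * projs s th f y).
Proof.
move=> bf; elim: s => //= i s ->; apply/funext => y.
by rewrite projZ //; exact: projs_bounded.
Qed.

Lemma bounded_fsum (I : Type) (r : seq I) (f : I -> V -> C) : (forall k, cbounded (f k)) ->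
  cbounded (fun y => \sum_(k <- r) f k y).
Proof.
move=> bf; elim: r => [|i r IH].
  by exists 0 => y; rewrite big_nil cabs0.
rewrite (_ : (fun _ => _) = fun y => f i y + \sum_(k <- r) f k y); first exact: boundedD.
by apply/funext => y; rewrite big_cons.
Qed.

Lemma projs_sum s th (I : Type) (r : seq I) (f : I -> V -> C) : (forall k, cbounded (f k)) ->
  projs s th (fun y => \sum_(k <- r) f k y) = (fun y => \sum_(k <- r) projs s th (f k) y).
Proof.
move=> bf; elim: r => [|i r IH].
  have b0 : cbounded (fun=> 0) by exists 0 => x; rewrite cabs0.
  have := projsZ s th 0 b0; rewrite (_ : (fun y => 0 * _) = fun=> 0); last by apply/funext => y; rewrite mul0r.
  have -> : (fun y => \sum_(k <- [::]) f k y) = fun=> 0 by apply/funext => y; rewrite big_nil.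
  by move=> ->; apply/funext => y; rewrite big_nil mul0r.
have -> : (fun y => \sum_(k <- i :: r) f k y) = fun y => f i y + \sum_(k <- r) f k y.
  by apply/funext => y; rewrite big_cons.
rewrite projsD //; last exact: bounded_fsum.
by rewrite IH; apply/funext => y; rewrite big_cons.
Qed.

Lemma nice_projs s th f df : nice f df -> nice (projs s th f) (fun v => projs s th (df v)).
Proof. by move=> nf; elim: s => //= i s IH; exact: nice_proj. Qed.

Definition admissible th := forall i, th i - delta i \is a Num.int.

Lemma projs_derivative s th f df i : admissible th -> nice f df -> i \in s ->
  projs s th (df (a i)) = fun x => 'i * (2 * pi * th i)%:C * projs s th f x.
Proof.
move=> adm nf; elim: s => // j s IH; rewrite inE => /orP[/eqP <-|/IH] /=.
  by apply/funext => x; apply: proj_derivative (nice_projs s th nf) (adm i).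
move=> ->; apply/funext => x; rewrite projZ //.
by apply: projs_bounded; exact: nice_bound nf.
Qed.

(** One direction at a time: [proj_uniqueness] in the direction i removes i from the list. *)
Lemma projs_uniqueness s f df : uniq s -> nice f df ->
  (forall th, admissible th -> projs s th f = fun=> 0) ->
  (exists th, admissible th) -> f = fun=> 0.
Proof.
move=> + nf + [th0 adm0]; elim: s => [|i s IH] /=; first by move=> _ /(_ _ adm0).
move=> /andP[si us] H; apply: IH => // th adm; apply/funext => x.
apply: (proj_uniqueness (i := i) (nice_projs s th nf)) => r ri.
(* The frequency along i is changed alone; as i does not occur in s, the components along s stay the
   same. *)
pose th1 j := if j == i then r else th j.
have adm1 : admissible th1 by move=> j; rewrite /th1; case: eqP => [->|_].
have := congr1 (@^~ x) (H _ adm1); rewrite /= {1}/th1 eqxx.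
suff -> : projs s th1 f = projs s th f by [].
elim: s si us {H} => //= j s IH; rewrite inE negb_or => /andP[ij si] /andP[_ us].
by rewrite IH // {1}/th1 eq_sym (negPf ij).
Qed.

Definition linear_form (l : V -> R) :=
  (forall u v, l (u + v) = l u + l v) /\ (forall (c : R) v, l (c *: v) = c * l v).

Lemma nice_ex (l : V -> R) : linear_form l -> (forall i, l (a i) - delta i \is a Num.int) ->
  nice (fun x => ex (l x)) (fun v x => 'i * (2 * pi * l v)%:C * ex (l x)).
Proof.
move=> [lD lZ] adm; split.
- by exists 1 => x; rewrite cabs_ex.
- by move=> v; exists (cabs ('i * (2 * pi * l v)%:C)) => x; rewrite cabsM cabs_ex mulr1.
- move=> v; have [K HK] := ex_taylor (l v); exists K => x h.
  have := HK 0 h; rewrite add0r mulr0 ex0 mulr1; apply: le_trans.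
  rewrite lD lZ exD (mulrC h); set w := 'i * _.
  have -> : ex (l x) * ex (l v * h) - ex (l x) - h%:C * (w * ex (l x)) =
    ex (l x) * (ex (l v * h) - 1 - h%:C * w) by ring.
  by rewrite cabsM cabs_ex mul1r.
- by move=> u v x; rewrite lD mulrDr rmorphD; ring.
- move=> c v x; have -> : 2 * pi * l (c *: v) = c * (2 * pi * l v) by rewrite lZ; ring.
  by rewrite rmorphM; ring.
- move=> i x; rewrite lD exD mulrC; congr (_ * _).
  by rewrite -[l (a i)](subrK (delta i)) exD ex_int // mul1r.
Qed.

Lemma nice_lincomb (I : Type) (r : seq I) (f : I -> V -> C) (df : I -> V -> V -> C) (c : I -> C) :
  (forall k, nice (f k) (df k)) ->
  nice (fun x => \sum_(k <- r) c k * f k x) (fun v x => \sum_(k <- r) c k * df k v x).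
Proof.
move=> nf; split.
- by apply: bounded_fsum => k; apply: boundedZ; exact: nice_bound (nf k).
- by move=> v; apply: bounded_fsum => k; apply: boundedZ; exact: nice_dbound (nf k) v.
- move=> v; elim: r => [|k r [K HK]].
    by exists 0 => x h; rewrite !big_nil mulr0 !subr0 cabs0 mul0r.
  have [K1 HK1] := nice_taylor (nf k) v; exists (cabs (c k) * K1 + K) => x h.
  rewrite !big_cons mulrDl; set S := \sum_(_ <- _) _; set T := \sum_(_ <- _) _; set Q := \sum_(_ <- _) _.
  have -> : c k * f k (x + h *: v) + S - (c k * f k x + T) - h%:C * (c k * df k v x + Q) =
    c k * (f k (x + h *: v) - f k x - h%:C * df k v x) + (S - T - h%:C * Q) by ring.
  apply: le_trans (cabsD _ _) _; apply: lerD; last exact: HK.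
  by rewrite cabsM -mulrA ler_wpM2l ?cabs_ge0.
- by move=> u v x; rewrite -big_split; apply: eq_bigr => k _; rewrite (nice_dD (nf k)) mulrDr.
- move=> e v x; rewrite mulr_sumr; apply: eq_bigr => k _; rewrite (nice_dZ (nf k)); ring.
- move=> i x; rewrite mulr_sumr; apply: eq_bigr => k _; rewrite (nice_period (nf k)); ring.
Qed.

Lemma projs_ex (l : V -> R) s th x : linear_form l -> (forall i, l (a i) - delta i \is a Num.int) ->
  admissible th -> projs s th (fun x => ex (l x)) x = (all (fun i => th i == l (a i)) s)%:R * ex (l x).
Proof.
move=> [lD lZ] adl adm; elim: s x => [|i s IH] x; first by rewrite mul1r.
rewrite /= (_ : projs _ _ _ = fun y => (all (fun i => th i == l (a i)) s)%:R * ex (l y)); last exact/funext/IH.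
rewrite projZ; last by exists 1 => y; rewrite cabs_ex.
have -> : proj i (th i) (fun y => ex (l y)) x = (th i == l (a i))%:R * ex (l x).
  rewrite /proj; have -> : (th i == l (a i)) = (l (a i) - th i == 0) by rewrite subr_eq0 eq_sym.
  have ii : l (a i) - th i \is a Num.int.
    have -> : l (a i) - th i = (l (a i) - delta i) - (th i - delta i) by ring.
    by apply: rpredB; [exact: adl|exact: adm].
  rewrite -(Mean_ex ii) mulrC -MeanZ; last exact: bdd_ex.
  by apply: eq_Mean => t _; rewrite lD lZ -!exD; congr ex; ring.
by case: (th i == _); case: (all _ _); rewrite /= ?mul1r ?mul0r ?mulr0.
Qed.

Section Expansion.
Variables (T : eqType) (S : seq T) (l : T -> V -> R).
Hypotheses (uS : uniq S) (lin : forall k, linear_form (l k))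
  (adl : forall k i, l k (a i) - delta i \is a Num.int)
  (sep : forall k k', k \in S -> k' \in S -> (forall i, l k (a i) = l k' (a i)) -> k = k').

Let coefs k := fun i => l k (a i).

Lemma projs_lincomb k (c : T -> C) x : k \in S ->
  projs (enum 'I_N) (coefs k) (fun y => \sum_(j <- S) c j * ex (l j y)) x = c k * ex (l k x).
Proof.
move=> kS; have bex j : cbounded (fun y => ex (l j y)) by exists 1 => y; rewrite cabs_ex.
rewrite projs_sum; last by move=> j; exact: boundedZ.
rewrite (bigD1_seq k) //= projsZ // (projs_ex _ _ (lin k)) //; last by move=> i; exact: adl.
have -> : all (fun i => coefs k i == l k (a i)) (enum 'I_N) by apply/allP => i _.
rewrite mul1r big_seq_cond big1 ?addr0 // => j /andP[jS jk].
rewrite projsZ // (projs_ex _ _ (lin j)) //; last by move=> i; exact: adl.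
case: allP => [H|_]; last by rewrite mul0r mulr0.
case/negP: jk; apply/eqP/(sep jS kS) => i.
by have /eqP := H i (mem_enum _ i).
Qed.

Lemma characters_independent (c : T -> C) : (forall x, \sum_(j <- S) c j * ex (l j x) = 0) ->
  forall k, k \in S -> c k = 0.
Proof.
move=> H k kS; have := projs_lincomb c 0 kS.
rewrite (_ : (fun y => _) = fun y => 0 * 0); last by apply/funext => y; rewrite H mulr0.
rewrite projsZ; last by exists 0 => y; rewrite cabs0.
rewrite mul0r => /esym/eqP; rewrite mulf_eq0 (negPf (ex_neq0 _)) orbF.
by move/eqP.
Qed.

(** The difference of f and the finite sum has no nonzero component: characters outside S contribute
    to neither, and on S the components agree by [projs_lincomb]. *)
Lemma fourier_expansion f df : nice f df -> (exists th, admissible th) ->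
  (forall th, admissible th -> (forall k, k \in S -> exists i, th i != l k (a i)) ->
     projs (enum 'I_N) th f = fun=> 0) ->
  (forall k x, k \in S -> projs (enum 'I_N) (coefs k) f x =
     ex (l k x) * projs (enum 'I_N) (coefs k) f 0) ->
  forall x, f x = \sum_(k <- S) projs (enum 'I_N) (coefs k) f 0 * ex (l k x).
Proof.
move=> nf ex_adm H0 Hex x; pose c k := projs (enum 'I_N) (coefs k) f 0.
pose g y := \sum_(k <- S) c k * ex (l k y).
have ng := nice_lincomb S c (fun k => nice_ex (lin k) (adl k)).
(* f - g is written as a linear combination indexed by the booleans, to which [nice_lincomb] and
   [projs_sum] apply. *)
pose pair (b : bool) := if b then f else g.
pose pair' b := if b then df else (fun v x => \sum_(k <- S) c k * ('i * (2 * pi * l k v)%:C * ex (l k x))).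
have np b : nice (pair b) (pair' b) by case: b.
have nfg := nice_lincomb [:: true; false] (fun b => if b then 1 else -1) np.
have := projs_uniqueness (enum_uniq 'I_N) nfg; move/(_ _ ex_adm) => U.
suff /(congr1 (@^~ x)) : (fun y => \sum_(b <- [:: true; false]) (if b then 1 else -1) * pair b y) = fun=> 0.
  by rewrite !big_cons big_nil addr0 mul1r mulN1r => /eqP; rewrite subr_eq0 => /eqP.
apply: U => th adm; apply/funext => y.
have bf : cbounded f by exact: nice_bound nf.
have bg : cbounded g by exact: nice_bound ng.
rewrite projs_sum; last by case; apply: boundedZ.
rewrite !big_cons big_nil addr0 !projsZ // mul1r mulN1r.
have [[k kS Hk]|nk] := pselect (exists2 k, k \in S & forall i, th i = l k (a i)).
  have -> : th = coefs k by exact/funext/Hk.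
  by rewrite projs_lincomb // Hex // mulrC subrr.
have dif k : k \in S -> exists i, th i != l k (a i).
  move=> kS; apply: contrapT => nex; apply: nk; exists k => // i.
  by apply/eqP; apply: contrapT => /negP h; apply: nex; exists i.
rewrite H0 // sub0r projs_sum; last first.
  by move=> j; apply: boundedZ; exists 1 => z; rewrite cabs_ex.
rewrite big_seq big1 ?oppr0 // => j jS; rewrite projsZ; last by exists 1 => z; rewrite cabs_ex.
rewrite (projs_ex _ _ (lin j)) //; case: allP => [HH|_]; last by rewrite mul0r mulr0.
have [i /negP []] := dif _ jS; exact: HH (mem_enum _ i).
Qed.

End Expansion.

(** Along the segment from 0 to x, f e^(-2 pi i l) has increments O(h^2) over steps of length h;
    summing 1 / h of them shows that it is constant. *)
Lemma exponential_ode f df (l : V -> R) : linear_form l -> nice f df ->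
  (forall v x, df v x = 'i * (2 * pi * l v)%:C * f x) -> forall x, f x = ex (l x) * f 0.
Proof.
move=> [lD lZ] nf H x; have [[B HB] bdf tf _ _ _] := nf.
have [B1 HB1] := bdf x; have [K1 HK1] := tf x.
have [K2 HK2] := ex_taylor (- l x); have [L HL] := ex_lip (- l x).
pose K := Num.max K1 K2.
pose F t := f (0 + t *: x); pose F1 t := df x (0 + t *: x).
pose G (t : R) := ex (- l x * t); pose G1 t := 'i * (2 * pi * - l x)%:C * G t.
have := @taylorM F F1 G G1 B B1 1 K L (fun t => HB _) (fun t => HB1 _) _ _ _ HL.
have h1 t : cabs (G t) <= 1 by rewrite cabs_ex.
have h2 t h : cabs (F (t + h) - F t - h%:C * F1 t) <= K * h ^+ 2.
  rewrite /F shift_affine; apply: le_trans (HK1 _ _) _.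
  by rewrite ler_wpM2r ?sqr_ge0 // le_max lexx.
have h3 t h : cabs (G (t + h) - G t - h%:C * G1 t) <= K * h ^+ 2.
  by apply: le_trans (HK2 _ _) _; rewrite ler_wpM2r ?sqr_ge0 // le_max lexx orbT.
move=> /(_ h1 h2 h3); set Q := K * 1 + _ + _ => T.
have {}T t h : cabs (F (t + h) * G (t + h) - F t * G t) <= Q * h ^+ 2.
  have := T t h; rewrite (_ : F1 t * G t + F t * G1 t = 0) ?mulr0 ?subr0 //.
  by rewrite /F1 H /G1 mulrN rmorphN -/(F t); ring.
have cst : F 1 * G 1 = F 0 * G 0.
  apply/eqP; rewrite -subr_eq0; apply/eqP/cabs0_eq0/eqP.
  rewrite eq_le cabs_ge0 andbT; apply/ler_addgt0Pr => e e0; rewrite add0r.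
  have [M0 HM] := inv_small Q e0; have {HM} := HM M0 (leqnn _); apply: le_trans.
  pose n := M0.+1; pose h : R := n%:R^-1.
  have Nh : n%:R * h = 1 by rewrite divff // pnatr_eq0.
  have -> : F 1 * G 1 - F 0 * G 0 = \sum_(j < n) (F (j%:R * h + h) * G (j%:R * h + h) - F (j%:R * h) * G (j%:R * h)).
    transitivity (F (n%:R * h) * G (n%:R * h) - F (0%:R * h) * G (0%:R * h)).
      by rewrite Nh mul0r.
    rewrite -(@telescope_sumr _ 0 n (fun j => F (j%:R * h) * G (j%:R * h))) // big_mkord.
    by apply: eq_bigr => j _; rewrite -natr1 mulrDl mul1r.
  apply: le_trans (cabs_sum _ _ _) _.
  apply: (@le_trans _ _ (\sum_(j < n) Q * h ^+ 2)); first by apply: ler_sum => j _; exact: T.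
  rewrite sumr_const card_ord -[(_ * _) *+ _]mulr_natr.
  have -> : Q * h ^+ 2 * n%:R = Q * h * (n%:R * h) by ring.
  by rewrite Nh mulr1.
move: cst; rewrite /F /G scale1r scale0r !add0r mulr1 mulr0 ex0 mulr1 => <-.
by rewrite exN mulrC -mulrA mulVf ?ex_neq0 // mulr1.
Qed.

End QuasiPeriodic.

(** * The Clifford action on spinors *)

Section SpinorOperators.
Variables (R : realType) (k : nat).
Local Notation C := (CC R).
Local Notation n := k.*2.+1.
Local Notation index := {ffun 'I_k -> 'I_2}.
Local Notation W := (spinor R k).
Implicit Types (w u v : W) (I J : index) (c : C) (m : 'I_k -> 'M[C]_2).

Lemma spinorP u v : (forall I, u I = v I) -> u = v.
Proof. by move=> uv; apply/ffunP. Qed.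

Lemma spDE u v I : (u + v) I = u I + v I. Proof. by rewrite ffunE. Qed.
Lemma spZE c w I : (c *: w) I = c * w I. Proof. by rewrite ffunE. Qed.
Lemma sp_sumE (T : Type) (r : seq T) (P : pred T) (F : T -> W) I :
  (\sum_(i <- r | P i) F i) I = \sum_(i <- r | P i) F i I.
Proof. by elim/big_rec2: _ => [|i y z _ <-]; rewrite ffunE. Qed.

Lemma tensor_opE m w I : tensor_op m w I = \sum_(J : index) (\prod_s m s (I s) (J s)) * w J.
Proof. by rewrite ffunE. Qed.

Lemma tensor_opD m u v : tensor_op m (u + v) = tensor_op m u + tensor_op m v.
Proof.
apply: spinorP => I; rewrite spDE !tensor_opE -big_split; apply: eq_bigr => J _.
by rewrite spDE mulrDr.
Qed.

Lemma tensor_opZ m c w : tensor_op m (c *: w) = c *: tensor_op m w.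
Proof.
apply: spinorP => I; rewrite spZE !tensor_opE mulr_sumr; apply: eq_bigr => J _.
by rewrite spZE mulrCA.
Qed.

Lemma tensor_opM m m' w : tensor_op m (tensor_op m' w) = tensor_op (fun s => m s *m m' s) w.
Proof.
apply: spinorP => I; rewrite !tensor_opE.
under eq_bigr => J _ do rewrite tensor_opE mulr_sumr.
rewrite exchange_big /=; apply: eq_bigr => K _.
under eq_bigr => J _ do rewrite mulrA -big_split /=.
rewrite -mulr_suml; congr (_ * _).
under [RHS]eq_bigr => s _ do rewrite mxE.
by rewrite bigA_distr_bigA.
Qed.

Lemma eq_tensor_op m m' w : (forall s, m s = m' s) -> tensor_op m w = tensor_op m' w.
Proof.
move=> mm; apply: spinorP => I; rewrite !tensor_opE; apply: eq_bigr => J _.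
by congr (_ * _); apply: eq_bigr => s _; rewrite mm.
Qed.

Lemma tensor_op_scale (sg : 'I_k -> C) m w :
  tensor_op (fun s => sg s *: m s) w = (\prod_s sg s) *: tensor_op m w.
Proof.
apply: spinorP => I; rewrite spZE !tensor_opE mulr_sumr; apply: eq_bigr => J _.
by rewrite mulrA -big_split; congr (_ * _); apply: eq_bigr => s _; rewrite mxE.
Qed.

Lemma tensor_op_diag (d : 'I_k -> 'I_2 -> C) w I :
  tensor_op (fun s => diag_mx (\row_i d s i)) w I = (\prod_s d s (I s)) * w I.
Proof.
rewrite tensor_opE (bigD1 I) //= [X in _ + X]big1 ?addr0 => [|J JI].
  by congr (_ * _); apply: eq_bigr => s _; rewrite !mxE eqxx mulr1n.
have [s Hs] : exists s, I s != J s.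
  apply/existsP; apply: contraNT JI; rewrite negb_exists => /forallP H.
  by apply/eqP/ffunP => s; apply/eqP; rewrite eq_sym; have := H s; rewrite negbK.
by rewrite (bigD1 s) //= !mxE (negPf Hs) mulr0n !mul0r.
Qed.

Lemma tensor_op1 w : tensor_op (fun=> 1%:M) w = w.
Proof.
apply: spinorP => I; rewrite (@eq_tensor_op _ (fun=> diag_mx (\row_i 1))).
  by rewrite tensor_op_diag big1 ?mul1r.
by move=> s; apply/matrixP => i j; rewrite !mxE.
Qed.

Lemma mx22P (A B : 'M[C]_2) : A 0 0 = B 0 0 -> A 0 1 = B 0 1 -> A 1 0 = B 1 0 -> A 1 1 = B 1 1 -> A = B.
Proof.
move=> h00 h01 h10 h11; apply/matrixP => i j.
have H (l : 'I_2) : l = 0 \/ l = 1 by case: l => [[|[|//]] p]; [left|right]; apply/val_inj.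
by case: (H i) => ->; case: (H j) => ->.
Qed.

Lemma mul22E (A B : 'M[C]_2) i j : (A *m B) i j = A i 0 * B 0 j + A i 1 * B 1 j.
Proof. by rewrite mxE !big_ord_recl big_ord0 addr0; congr (_ * _ + A i _ * B _ j); apply/val_inj. Qed.

Lemma ii : ('i : C) * 'i = -1. Proof. by rewrite -expr2 sqr_i. Qed.

Lemma T_sq : mx_T R *m mx_T R = 1%:M.
Proof. by apply: mx22P; rewrite mul22E !mxE /= ?mulNr ?mulrN ?ii; ring. Qed.

Lemma g1_sq : mx_g1 R *m mx_g1 R = (-1) *: 1%:M.
Proof. by apply: mx22P; rewrite mul22E !mxE /= ?mulNr ?mulrN ?ii; ring. Qed.

Lemma g2_sq : mx_g2 R *m mx_g2 R = (-1) *: 1%:M.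
Proof. by apply: mx22P; rewrite mul22E !mxE /= ?mulNr ?mulrN ?ii; ring. Qed.

Lemma g1g2 : mx_g1 R *m mx_g2 R = (- 'i) *: mx_T R.
Proof. by apply: mx22P; rewrite mul22E !mxE /= ?mulNr ?mulrN ?ii; ring. Qed.

Lemma g2g1 : mx_g2 R *m mx_g1 R = (-1) *: (mx_g1 R *m mx_g2 R).
Proof. by apply: mx22P; rewrite [RHS]mxE !mul22E !mxE /= ?mulNr ?mulrN ?ii; ring. Qed.

Lemma g1T : mx_g1 R *m mx_T R = (-1) *: (mx_T R *m mx_g1 R).
Proof. by apply: mx22P; rewrite [RHS]mxE !mul22E !mxE /= ?mulNr ?mulrN ?ii; ring. Qed.

Lemma g2T : mx_g2 R *m mx_T R = (-1) *: (mx_T R *m mx_g2 R).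
Proof. by apply: mx22P; rewrite [RHS]mxE !mul22E !mxE /= ?mulNr ?mulrN ?ii; ring. Qed.

Definition gmx (i : 'I_n) (s : 'I_k) : 'M[C]_2 :=
  if i == ord_max then mx_T R
  else if (s + i./2 < k.-1)%N then 1%:M
  else if (s + i./2 == k.-1)%N then (if odd i then mx_g2 R else mx_g1 R) else mx_T R.

Definition gcoef (i : 'I_n) : C := if i == ord_max then 'i else 1.

Lemma gammaE i w : gamma i w = gcoef i *: tensor_op (gmx i) w.
Proof. by rewrite /gamma /gcoef /gmx; case: eqP => _; rewrite ?scale1r. Qed.

Lemma gammaD i u v : gamma i (u + v) = gamma i u + gamma i v.
Proof. by rewrite !gammaE tensor_opD scalerDr. Qed.

Lemma gammaZ i c w : gamma i (c *: w) = c *: gamma i w.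
Proof. by rewrite !gammaE tensor_opZ !scalerA mulrC. Qed.

Lemma gamma_sum i (T : Type) (r : seq T) (P : pred T) (F : T -> W) :
  gamma i (\sum_(j <- r | P j) F j) = \sum_(j <- r | P j) gamma i (F j).
Proof.
elim/big_rec2: _ => [|j y z _ <-]; last by rewrite gammaD.
by rewrite -[X in gamma i X](scale0r 0) gammaZ scale0r.
Qed.

(* the position of the only tensor factor g_1 or g_2 in the action of e_(i+1) *)
Lemma gpos (i : 'I_n) : i != ord_max -> exists2 s0 : 'I_k, (s0 + i./2 = k.-1)%N &
  gmx i s0 = (if odd i then mx_g2 R else mx_g1 R).
Proof.
move=> im; have ik : (i./2 < k)%N.
  have := ltn_ord i; rewrite ltnS leq_eqVlt -val_eqE /= in im *.
  by rewrite (negPf im) /= => h; rewrite ltn_half_double.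
have h : (k.-1 - i./2 < k)%N by rewrite (leq_ltn_trans (leq_subr _ _)) // prednK // (leq_ltn_trans _ ik).
have e : (Ordinal h + i./2 = k.-1)%N by rewrite /= subnK // -ltnS prednK // (leq_ltn_trans _ ik).
by exists (Ordinal h) => //; rewrite /gmx (negPf im) e ltnn eqxx.
Qed.

(** Records that two tensor operators anticommute in the factor s0 and commute in all others; the
    product of these scalars is the global sign -1. *)
Definition single (s0 s : 'I_k) : C := if s == s0 then -1 else 1.

Lemma prod_single s0 : \prod_s single s0 s = -1.
Proof.
rewrite (bigD1 s0) //= /single eqxx big1 ?mulr1 // => s /negPf ->.
by [].
Qed.

Lemma tensor_single s0 m m' w : (forall s, m s = single s0 s *: m' s) ->
  tensor_op m w = - tensor_op m' w.
Proof. by move=> H; rewrite (eq_tensor_op _ H) tensor_op_scale prod_single scaleN1r. Qed.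

Lemma gmx_other (i : 'I_n) (s : 'I_k) : i != ord_max -> (s + i./2 != k.-1)%N ->
  gmx i s = 1%:M \/ gmx i s = mx_T R.
Proof. by move=> /negPf im /negPf h; rewrite /gmx im h; case: ifP; [left|right]. Qed.

Lemma gamma_sq i w : gamma i (gamma i w) = - w.
Proof.
rewrite !gammaE tensor_opZ tensor_opM scalerA.
have [im|im] := eqVneq i ord_max.
  rewrite (@eq_tensor_op _ (fun=> 1%:M)); last by move=> s; rewrite /gmx im eqxx T_sq.
  by rewrite tensor_op1 /gcoef im eqxx ii scaleN1r.
have [s0 es0 gs0] := gpos im.
rewrite (@tensor_single s0 _ (fun=> 1%:M)).
  by rewrite tensor_op1 /gcoef (negPf im) mul1r scale1r.
move=> s; rewrite /single; case: eqP => [->|ss0].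
  by rewrite gs0; case: odd; rewrite (g1_sq, g2_sq).
rewrite scale1r; have : (s + i./2 != k.-1)%N.
  by apply/eqP => e; apply: ss0; apply/val_inj/(@addIn i./2); rewrite e es0.
by case/(gmx_other im) => ->; rewrite ?mulmx1 ?T_sq.
Qed.

Lemma gmx_comm1T (A B : 'M[C]_2) : A = 1%:M \/ A = mx_T R -> B = 1%:M \/ B = mx_T R ->
  A *m B = B *m A.
Proof. by case=> -> [] ->; rewrite ?mulmx1 ?mul1mx. Qed.

Lemma gT (i : 'I_n) (X := if odd i then mx_g2 R else mx_g1 R) :
  X *m mx_T R = (-1) *: (mx_T R *m X) /\ mx_T R *m X = (-1) *: (X *m mx_T R).
Proof.
have h : X *m mx_T R = (-1) *: (mx_T R *m X) by rewrite /X; case: odd; rewrite (g1T, g2T).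
by split=> //; rewrite h scalerA mulrNN mulr1 scale1r.
Qed.

(** At s0, where e_j has its factor g_1 or g_2, e_i already has T, which anticommutes with it.
    Before s0 the factor of e_j is 1; after s0 that of e_i is T and that of e_j is 1 or T. *)
Lemma anti_lt (i j : 'I_n) s0 : j != ord_max -> gmx j s0 = (if odd j then mx_g2 R else mx_g1 R) ->
   (s0 + j./2 = k.-1)%N -> (i == ord_max) || (j./2 < i./2)%N ->
  forall s, gmx i s *m gmx j s = single s0 s *: (gmx j s *m gmx i s).
Proof.
move=> jm gs0 es0 ij s; rewrite /single.
have iT (s1 : 'I_k) : (s0 <= s1)%N -> gmx i s1 = mx_T R.
  move=> s01; rewrite /gmx; case: eqP ij => //= _ ij.
  have lt : (k.-1 < s1 + i./2)%N by rewrite -es0 -addnS leq_add.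
  by rewrite ltnNge (ltnW lt) /= gtn_eqF.
case: eqP => [->|ss0].
  by rewrite iT // gs0; have [_ ->] := gT j.
rewrite scale1r.
have j1 : (s + j./2 != k.-1)%N.
  by apply/eqP => e; apply: ss0; apply/val_inj/(@addIn j./2); rewrite e es0.
have [s_lt|s_ge] := ltnP s s0.
  have -> : gmx j s = 1%:M.
    by rewrite /gmx (negPf jm) -es0 ltn_add2r s_lt.
  by rewrite mulmx1 mul1mx.
by rewrite (iT s) //; apply: gmx_comm1T; [right|exact: gmx_other].
Qed.

Lemma gamma_anti i j w : i != j -> gamma i (gamma j w) = - gamma j (gamma i w).
Proof.
wlog ij : i j / (i == ord_max) || ((j != ord_max) && (j./2 <= i./2)%N).
  move=> H ne; have [im|im] := eqVneq i ord_max; first by apply: H => //; rewrite im eqxx.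
  have [jm|jm] := eqVneq j ord_max.
    by rewrite (H j i) ?opprK //; [rewrite jm eqxx|rewrite eq_sym].
  have [h|h] := leqP j./2 i./2; first by apply: H; rewrite // jm h orbT.
  by rewrite (H j i) ?opprK 1?eq_sym // im (ltnW h) orbT.
move=> ne; rewrite !gammaE !tensor_opZ !tensor_opM !scalerA mulrC -scalerN; congr (_ *: _).
have jm : j != ord_max.
  by case/orP: ij => [/eqP <-|/andP[] //]; rewrite eq_sym.
have [s0 es0 gs0] := gpos jm.
apply: (@tensor_single s0).
have [ij2|ij2] := boolP ((i == ord_max) || (j./2 < i./2)%N); first exact: anti_lt.
move: ij ij2; rewrite negb_or => /orP[-> //|/andP[_ ji]] /andP[im]; rewrite -leqNgt => i_j.
have hij : i./2 = j./2 by apply/eqP; rewrite eqn_leq i_j ji.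
have odd_ne : odd i != odd j.
  apply: contraNneq ne => o; apply/eqP/val_inj.
  by rewrite /= -(odd_double_half i) -(odd_double_half j) o hij.
have [s1 es1 gs1] := gpos im.
have s10 : s1 = s0 by apply/val_inj/(@addIn j./2); rewrite es0 -hij es1.
move=> s; rewrite /single; case: eqP => [->|ss0].
  rewrite gs0 -s10 gs1; case: (odd i) (odd j) odd_ne => [] [] //= _; first exact: g2g1.
  by rewrite g2g1 scalerA mulrNN mulr1 scale1r.
rewrite scale1r.
have ns : (s + j./2 != k.-1)%N.
  by apply/eqP => e; apply: ss0; apply/val_inj/(@addIn j./2); rewrite e es0.
by apply: gmx_comm1T; apply: gmx_other; rewrite // hij.
Qed.

(** The factors T of the two operators square to 1, so e_(2j-1) e_(2j) acts through g_1 g_2 = - i T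
    in a single tensor factor. *)
Lemma gamma_pair (i j : 'I_n) (s0 : 'I_k) w : ~~ odd i -> j = i.+1 :> nat -> (s0 + i./2 = k.-1)%N ->
  gamma i (gamma j w) = tensor_op (fun s => if s == s0 then (- 'i) *: mx_T R else 1%:M) w.
Proof.
move=> oi ji es0.
have im : i != ord_max by apply/eqP => im; have := ltn_ord j; rewrite ji im /= ltnn.
have jm : j != ord_max.
  by apply/eqP => jm; have : odd i.+1 by []; rewrite -ji jm /= odd_double.
have hj : j./2 = i./2 by rewrite ji /= uphalf_half (negPf oi).
rewrite !gammaE tensor_opZ tensor_opM /gcoef (negPf im) (negPf jm) !scale1r.
apply: eq_tensor_op => s; have [->|ss0] := eqVneq s s0.
  rewrite /gmx (negPf im) (negPf jm) hj es0 ltnn eqxx ji /= oi (negPf oi).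
  exact: g1g2.
have ns : (s + i./2 != k.-1)%N.
  by apply: contraNneq ss0 => e; apply/eqP/val_inj/(@addIn i./2); rewrite e es0.
rewrite /gmx (negPf im) (negPf jm) hj (negPf ns); case: ifP => _; first by rewrite mulmx1.
exact: T_sq.
Qed.

End SpinorOperators.

(** * Spinors as a module over the Clifford algebra *)

Section CliffordAction.
Variables (R : realType) (k : nat).
Local Notation C := (CC R).
Local Notation n := k.*2.+1.
Local Notation W := (spinor R k).
Local Notation Cl := (clifford R n).
Implicit Types (w u v : W) (S T U : {set 'I_n}) (c : C) (s : seq 'I_n) (x y : Cl).

(** The action of the part of e_S lying in the list s; products of blades are then treated by
    induction on s. *)
Definition gammas s S w : W := foldr (@gamma R k) w [seq i <- s | i \in S].

Lemma gammas_enum S w : foldr (@gamma R k) w (enum S) = gammas (enum 'I_n) S w.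
Proof. by rewrite /gammas enumT {1}/enum_mem. Qed.

Lemma gammas_cons i s S w : gammas (i :: s) S w = if i \in S then gamma i (gammas s S w) else gammas s S w.
Proof. by rewrite /gammas /=; case: ifP. Qed.

Lemma gammasZ s S c w : gammas s S (c *: w) = c *: gammas s S w.
Proof. by elim: s => // i s IH; rewrite !gammas_cons IH gammaZ; case: ifP. Qed.

Lemma gammasD s S u v : gammas s S (u + v) = gammas s S u + gammas s S v.
Proof. by elim: s => // i s IH; rewrite !gammas_cons IH gammaD; case: ifP. Qed.

Lemma gammas_gamma i s S w : i \notin s ->
  gammas s S (gamma i w) = (\prod_(a <- s) (-1) ^+ (a \in S)) *: gamma i (gammas s S w).
Proof.
elim: s => [|a s IH]; first by rewrite big_nil scale1r.
rewrite inE negb_or => /andP[ia si]; rewrite !gammas_cons big_cons IH //.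
case: ifP => _; last by rewrite expr0 mul1r.
by rewrite gammaZ (gamma_anti _ (_ : a != i)) 1?eq_sym // expr1 mulN1r scaleNr scalerN.
Qed.

(** The scalar is [blade_sign] restricted to s. The smallest generator e_i of the second factor
    passes the rest of the first with one sign for each element of S, and meets another e_i with
    e_i^2 = -1. *)
Lemma gammas_mul s S T w : sorted (fun i j : 'I_n => i < j)%N s ->
  gammas s S (gammas s T w) =
  (\prod_(a <- s) \prod_(b <- s) (-1) ^+ [&& a \in S, b \in T & (b <= a)%N]) *: gammas s (symdiff S T) w.
Proof.
elim: s => [|i s IH]; first by rewrite big_nil scale1r.
move=> pth; have ss := path_sorted pth.
have tr : transitive (fun i j : 'I_n => i < j)%N by move=> ? ? ?; exact: ltn_trans.
have lt : all (fun j : 'I_n => i < j)%N s by exact: order_path_min tr pth.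
have si : i \notin s by apply/negP => /(allP lt); rewrite ltnn.
pose P := \prod_(a <- s) \prod_(b <- s) (-1) ^+ [&& a \in S, b \in T & (b <= a)%N] : C.
have eP : \prod_(a <- i :: s) \prod_(b <- i :: s) (-1) ^+ [&& a \in S, b \in T & (b <= a)%N]
   = (-1) ^+ ((i \in S) && (i \in T)) * ((\prod_(a <- s) (-1) ^+ (a \in S)) ^+ (i \in T)) * P.
  rewrite big_cons -mulrA; congr (_ * _).
    rewrite big_cons leqnn andbT big1_seq ?mulr1 // => b /= bs.
    by rewrite leqNgt (allP lt _ bs) /= !andbF.
  rewrite /P -prodrXl -big_split; apply: eq_big_seq => a as_ /=.
  rewrite big_cons; congr (_ * _); rewrite (ltnW (allP lt _ as_)) andbT.
  by case: (a \in S); case: (i \in T).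
have step : gammas s S (gammas (i :: s) T w) =
    ((\prod_(a <- s) (-1) ^+ (a \in S)) ^+ (i \in T) * P) *:
    (if i \in T then gamma i (gammas s (symdiff S T) w) else gammas s (symdiff S T) w).
  rewrite gammas_cons; case: ifP => _.
    by rewrite gammas_gamma // IH // gammaZ scalerA expr1.
  by rewrite IH // expr0 mul1r.
rewrite eP gammas_cons step [in RHS]gammas_cons in_symdiff gammaZ.
case: (i \in S); case: (i \in T); rewrite /= ?expr0 ?expr1 ?mul1r //.
by rewrite gamma_sq scalerN -mulrA mulN1r scaleNr.
Qed.

Lemma sorted_enum_ord : sorted (fun i j : 'I_n => i < j)%N (enum 'I_n).
Proof.
have := iota_ltn_sorted 0 n; rewrite -val_enum_ord sorted_map.
by apply: sub_sorted.
Qed.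

Lemma blade_signC S T : (blade_sign R S T)%:C =
  \prod_(a <- enum 'I_n) \prod_(b <- enum 'I_n) (-1) ^+ [&& a \in S, b \in T & (b <= a)%N] :> C.
Proof.
rewrite /blade_sign (rmorph_prod (real_complex R)) /= big_enum; apply: eq_bigr => a _.
rewrite (rmorph_prod (real_complex R)) /= big_enum; apply: eq_bigr => b _.
by rewrite rmorphXn rmorphN1.
Qed.

Lemma cl_actE y w : cl_act y w = \sum_(S : {set 'I_n}) (y S)%:C *: gammas (enum 'I_n) S w.
Proof. by apply: eq_bigr => S _; rewrite gammas_enum. Qed.

Lemma cl_actDr y u v : cl_act y (u + v) = cl_act y u + cl_act y v.
Proof. by rewrite !cl_actE -big_split; apply: eq_bigr => S _; rewrite gammasD scalerDr. Qed.

Lemma cl_actZr y c w : cl_act y (c *: w) = c *: cl_act y w.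
Proof.
rewrite !cl_actE scaler_sumr; apply: eq_bigr => S _.
by rewrite gammasZ !scalerA mulrC.
Qed.

Lemma cl_act_sumr y (T : Type) (r : seq T) (P : pred T) (F : T -> W) :
  cl_act y (\sum_(i <- r | P i) F i) = \sum_(i <- r | P i) cl_act y (F i).
Proof.
elim/big_rec2: _ => [|i u v _ <-]; last by rewrite cl_actDr.
by rewrite -[X in cl_act y X](scale0r 0) cl_actZr scale0r.
Qed.

Lemma gammas_suml s S (T : Type) (r : seq T) (P : pred T) (F : T -> W) :
  gammas s S (\sum_(i <- r | P i) F i) = \sum_(i <- r | P i) gammas s S (F i).
Proof.
elim/big_rec2: _ => [|i u v _ <-]; last by rewrite gammasD.
by rewrite -[X in gammas s S X](scale0r 0) gammasZ scale0r.
Qed.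

Lemma cl_actM x y w : cl_act (x * y) w = cl_act x (cl_act y w).
Proof.
rewrite [cl_act y w]cl_actE [RHS]cl_actE cl_actE.
under eq_bigr => U _.
  rewrite -[x * y]/(cl_mul x y) cl_mulE (rmorph_sum (real_complex R)) /= scaler_suml.
  over.
rewrite exchange_big /=; apply: eq_bigr => S _.
rewrite gammas_suml scaler_sumr [RHS](reindex_inj (can_inj (symdiffK S))) /=.
apply: eq_bigr => U _.
rewrite gammasZ gammas_mul ?sorted_enum_ord // -blade_signC symdiffK !scalerA.
by rewrite !rmorphM; congr (_ *: _); rewrite [RHS]mulrC mulrA.
Qed.

Lemma cl_actDl x y w : cl_act (x + y) w = cl_act x w + cl_act y w.
Proof.
rewrite !cl_actE -big_split; apply: eq_bigr => S _.
by rewrite cl_addE rmorphD scalerDl.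
Qed.

Lemma cl_actZl (r : R) x w : cl_act (r *: x) w = r%:C *: cl_act x w.
Proof.
rewrite !cl_actE scaler_sumr; apply: eq_bigr => S _.
by rewrite cl_scaleE rmorphM scalerA.
Qed.

Lemma cl_act_blade S w : cl_act (blade R S) w = gammas (enum 'I_n) S w.
Proof.
rewrite cl_actE (bigD1 S) //= bladeE eqxx scale1r big1 ?addr0 // => T /negPf TS.
by rewrite bladeE TS scale0r.
Qed.

Lemma cl_act1 w : cl_act 1 w = w.
Proof.
by rewrite (_ : (1 : Cl) = blade R finset.set0) // cl_act_blade -gammas_enum enum_set0.
Qed.

Lemma cl_act_gen i w : cl_act (cl_gen R i) w = gamma i w.
Proof. by rewrite cl_act_blade -gammas_enum enum_set1. Qed.

Lemma cl_act0 w : cl_act 0 w = 0.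
Proof. by rewrite -[0 : Cl](scale0r 0) cl_actZl scale0r. Qed.

Lemma cl_actNl x w : cl_act (- x) w = - cl_act x w.
Proof. by rewrite -scaleN1r cl_actZl rmorphN1 scaleN1r. Qed.

Lemma cl_act_suml (T : Type) (r : seq T) (P : pred T) (F : T -> Cl) w :
  cl_act (\sum_(i <- r | P i) F i) w = \sum_(i <- r | P i) cl_act (F i) w.
Proof. by elim/big_rec2: _ => [|i u v _ <-]; rewrite ?cl_act0 ?cl_actDl. Qed.

End CliffordAction.

(** * The element alpha and its diagonalization *)

Section Alpha.
Variables (R : realType) (k : nat).
Local Notation C := (CC R).
Local Notation n := k.*2.+1.
Local Notation W := (spinor R k).
Local Notation Cl := (clifford R n).
Local Notation e := (cl_gen R).

Lemma ix_val (j : nat) : (0 < j <= n)%N -> ix k j = j.-1 :> nat.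
Proof. by case: j => // j /= jn; rewrite inordK. Qed.

Lemma ix_odd (j : nat) : (1 <= j <= k)%N -> ix k j.*2.-1 = (j.-1).*2 :> nat.
Proof.
by case: j => // j /= jk; rewrite ix_val //= ltnS leq_double ltnW.
Qed.

Lemma ix_even (j : nat) : (1 <= j <= k)%N -> ix k j.*2 = (j.-1).*2.+1 :> nat.
Proof.
by case: j => // j /= jk; rewrite ix_val //= ltnS ltn_double.
Qed.

Lemma rotor_comm (j : nat) (i : 'I_n) : i != ix k j.*2.-1 -> i != ix k j.*2 ->
  rotor R k j * e i = e i * rotor R k j.
Proof.
move=> i1 i2; rewrite /rotor mulrDl mulrDr -!scalerAl -!scalerAr mul1r mulr1.
congr (_ + _ *: _); rewrite -mulrA (cl_gen_anti R (_ : ix k j.*2 != i)) 1?eq_sym //.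
rewrite mulrN mulrA (cl_gen_anti R (_ : ix k j.*2.-1 != i)) 1?eq_sym //.
by rewrite mulNr opprK mulrA.
Qed.

Local Notation angle j := (2 * pi * j%:R / n%:R : R).

(** Conjugation by the half-angle rotor turns the plane of e_a and e_b by 2t; it is written as an
    intertwining relation, without inverses. *)
Lemma rotor_pair (a b : 'I_n) (t : R) : a != b ->
  let r := cos t *: 1 + sin t *: (e a * e b) in
  r * e a = (cos (t + t) *: e a + sin (t + t) *: e b) * r /\
  r * e b = (- sin (t + t) *: e a + cos (t + t) *: e b) * r.
Proof.
move=> ab r; have anti := cl_gen_anti R ab; have sa := cl_gen_sq R a; have sb := cl_gen_sq R b.
have aba : e a * e b * e a = e b by rewrite -mulrA -[e b * e a]opprK -anti mulrN mulrA sa mulN1r opprK.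
have abb : e a * e b * e b = - e a by rewrite -mulrA sb mulrN1.
have aab : e a * (e a * e b) = - e b by rewrite mulrA sa mulN1r.
have bab : e b * (e a * e b) = e a by rewrite mulrA -[e b * e a]opprK -anti mulNr abb opprK.
have tr := cos2Dsin2 t.
have c2 : cos t = cos (t + t) * cos t + sin (t + t) * sin t.
  by rewrite cosD sinD; rewrite -[LHS]mulr1 -tr; ring.
have s2 : sin t = sin (t + t) * cos t - cos (t + t) * sin t.
  by rewrite cosD sinD; rewrite -[LHS]mulr1 -tr; ring.
have swap (p q u v : Cl) : p - q + (u + v) = (p + v) + (u - q).
  by rewrite (addrC u) addrACA (addrC (- q)).
rewrite /r; split.
  rewrite !mulrDl !mulrDr -!scalerAl -!scalerAr !mul1r !mulr1 aba aab bab !scalerN !scalerA.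
  by rewrite swap -scalerDl -scalerBl -c2 -s2.
rewrite !mulrDl !mulrDr -!scalerAl -!scalerAr !mul1r !mulr1 abb aab bab !scalerN !scalerA.
rewrite swap -scalerDl -scalerBl !mulNr opprK (addrC (_ *: e a)); congr (_ + _).
  by rewrite {1}c2.
by rewrite -scaleNr {1}s2; congr (_ *: _); ring.
Qed.

Lemma alpha_comm (i : 'I_n) (x : Cl) :
  (forall j, (1 <= j < k.+1)%N -> rotor R k j * x = x * rotor R k j) -> alpha R k * x = x * alpha R k.
Proof.
move=> H; rewrite /alpha big_nat; elim/big_rec: _ => [|j y jk yx]; first by rewrite mul1r mulr1.
by rewrite -mulrA yx !mulrA H.
Qed.

Lemma ix_pair_neq (j j' : nat) : (1 <= j <= k)%N -> (1 <= j' <= k)%N -> j != j' ->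
  [/\ ix k j.*2.-1 != ix k j'.*2.-1, ix k j.*2.-1 != ix k j'.*2,
      ix k j.*2 != ix k j'.*2.-1 & ix k j.*2 != ix k j'.*2].
Proof.
move=> jk jk' jj; have pj : j.-1 != j'.-1.
  by case: j jk jj => // j _; case: j' jk' => // j' _; rewrite eqSS.
have inj (a b : nat) : a != b -> a.*2 != b.*2.
  by apply: contraNneq => e; rewrite -(doubleK a) e doubleK.
split; rewrite -val_eqE /= ?ix_odd ?ix_even //.
- exact: inj.
- by apply/eqP => /(congr1 odd); rewrite /= !odd_double.
- by apply/eqP => /(congr1 odd); rewrite /= !odd_double.
- by rewrite eqSS; exact: inj.
Qed.

(** Only the j-th rotor moves e_(2j-1) and e_(2j); the others commute with both. *)
Lemma alpha_pair (j : nat) : (1 <= j <= k)%N ->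
  alpha R k * e (ix k j.*2.-1) =
    (cos (angle j) *: e (ix k j.*2.-1) + sin (angle j) *: e (ix k j.*2)) * alpha R k /\
  alpha R k * e (ix k j.*2) =
    (- sin (angle j) *: e (ix k j.*2.-1) + cos (angle j) *: e (ix k j.*2)) * alpha R k.
Proof.
move=> jk; have /andP[j1 jk'] := jk.
have ab : ix k j.*2.-1 != ix k j.*2.
  rewrite -val_eqE /= ix_odd // ix_even //.
  by apply/eqP => /(congr1 odd); rewrite /= !odd_double.
have comm j' x : (1 <= j' <= k)%N -> j' != j -> x = ix k j.*2.-1 \/ x = ix k j.*2 ->
    rotor R k j' * e x = e x * rotor R k j'.
  move=> jk2 jj; rewrite eq_sym in jj; have [h1 h2 h3 h4] := ix_pair_neq jk jk2 jj.
  by case=> ->; apply: rotor_comm.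
have prod_comm (s : seq nat) x : all (fun j' => (1 <= j' <= k)%N && (j' != j)) s ->
    x = ix k j.*2.-1 \/ x = ix k j.*2 ->
    (\prod_(j' <- s) rotor R k j') * e x = e x * \prod_(j' <- s) rotor R k j'.
  move=> + hx; elim: s => [|j' s IH] /=; first by rewrite big_nil mul1r mulr1.
  case/andP => /andP[h1 h2] /IH {}IH; rewrite big_cons -mulrA IH !mulrA.
  by rewrite (comm _ _ h1 h2 hx).
have split_alpha : alpha R k =
   (\prod_(j' <- index_iota 1 j) rotor R k j') * rotor R k j * \prod_(j' <- index_iota j.+1 k.+1) rotor R k j'.
  rewrite /alpha (big_cat_nat _ (n := j)) //=; last by rewrite ltnW.
  by rewrite -mulrA; congr (_ * _); rewrite big_ltn.
have all1 : all (fun j' => (1 <= j' <= k)%N && (j' != j)) (index_iota 1 j).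
  apply/allP => j'; rewrite mem_index_iota => /andP[h1 h2].
  by rewrite h1 (leq_trans (ltnW h2)) //= ltn_eqF.
have all2 : all (fun j' => (1 <= j' <= k)%N && (j' != j)) (index_iota j.+1 k.+1).
  apply/allP => j'; rewrite mem_index_iota ltnS => /andP[h1 h2].
  by rewrite h2 (leq_trans j1 (ltnW h1)) gtn_eqF.
have key x y : x = ix k j.*2.-1 \/ x = ix k j.*2 ->
    (exists c d, y = c *: e (ix k j.*2.-1) + d *: e (ix k j.*2)) ->
    rotor R k j * e x = y * rotor R k j -> alpha R k * e x = y * alpha R k.
  move=> hx [c [d ey]] rx; rewrite split_alpha -!mulrA (prod_comm _ _ all2 hx).
  rewrite (mulrA (rotor R k j)) rx -!mulrA (mulrA _ y) [RHS]mulrA; congr (_ * _).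
  rewrite ey mulrDr mulrDl -!scalerAr -!scalerAl.
  by rewrite (prod_comm _ _ all1 (or_introl erefl)) (prod_comm _ _ all1 (or_intror erefl)).
have tt : j%:R * (pi / n%:R) + j%:R * (pi / n%:R) = angle j :> R by field; rewrite nat1r pnatr_eq0.
have [r1 r2] := rotor_pair (j%:R * (pi / n%:R)) ab; rewrite tt in r1 r2.
split; apply: key; [by left| |exact: r1|by right| |exact: r2]; by do 2 eexists.
Qed.

Lemma alpha_last : alpha R k * e (ix k n) = e (ix k n) * alpha R k.
Proof.
apply: (alpha_comm ord0) => j /andP[j1]; rewrite ltnS => jk.
have jj : (1 <= j <= k)%N by rewrite j1.
have vn : ix k n = k.*2 :> nat by rewrite ix_val //= leqnn.
have pk : (j.-1 < k)%N by rewrite prednK.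
apply: rotor_comm; rewrite -val_eqE /= vn ?ix_odd ?ix_even //.
  by rewrite gtn_eqF // ltn_double.
by apply/eqP => /(congr1 odd); rewrite /= !odd_double.
Qed.

Local Notation index := {ffun 'I_k -> 'I_2}.

(** Its columns are eigenvectors of T for 1 and -1. *)
Definition Bmx : 'M[C]_2 := mx22 1 1 'i (- 'i).
Definition BVmx : 'M[C]_2 := mx22 (2^-1) (- ('i / 2)) (2^-1) ('i / 2).

Lemma half2 : (2^-1 + 2^-1 : C) = 1.
Proof. by rewrite -[RHS](@divff _ 2) ?pnatr_eq0 // mulrDl mul1r. Qed.

Lemma BK : Bmx *m BVmx = 1%:M.
Proof.
have h := half2; have i1 := ii R.
have i2 : ('i : C) * ('i / 2) = - 2^-1 by rewrite mulrA i1 mulN1r.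
by apply: mx22P; rewrite mul22E !mxE /= ?mulrN ?mulNr ?mul1r ?i2 ?opprK ?h ?addNr ?subrr.
Qed.

Lemma BVK : BVmx *m Bmx = 1%:M.
Proof.
have h := half2; have i1 := ii R.
have i2 : ('i / 2 : C) * 'i = - 2^-1 by rewrite mulrAC i1 mulN1r.
by apply: mx22P; rewrite mul22E !mxE /= ?mulrN ?mulNr ?mulr1 ?i2 ?opprK ?h ?addNr ?subrr.
Qed.

Definition sg2 (x : 'I_2) : C := (-1) ^+ x.

Lemma TB : mx_T R *m Bmx = Bmx *m diag_mx (\row_i sg2 i).
Proof.
have i1 := ii R.
by apply: mx22P; rewrite !mul22E !mxE /= /sg2 ?expr0 ?expr1 ?mulr1n ?mulr0n; ring: i1.
Qed.

(* Bmx diagonalizes T, hence Bop diagonalizes alpha and e_n simultaneously. *)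
Definition Bop (w : W) : W := tensor_op (fun=> Bmx) w.
Definition BVop (w : W) : W := tensor_op (fun=> BVmx) w.

Lemma BopK w : BVop (Bop w) = w.
Proof. by rewrite /BVop /Bop tensor_opM (@eq_tensor_op _ _ _ (fun=> 1%:M)) ?tensor_op1 // => s; exact: BVK. Qed.

Lemma BVopK w : Bop (BVop w) = w.
Proof. by rewrite /BVop /Bop tensor_opM (@eq_tensor_op _ _ _ (fun=> 1%:M)) ?tensor_op1 // => s; exact: BK. Qed.

Definition dg (f : index -> C) (w : W) : W := [ffun I : index => f I * w I].

Lemma dgE f w I : dg f w I = f I * w I. Proof. by rewrite ffunE. Qed.

Lemma Bop_diag (m : 'I_k -> 'M[C]_2) (d : 'I_k -> 'I_2 -> C) w :
  (forall s, m s *m Bmx = Bmx *m diag_mx (\row_i d s i)) ->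
  tensor_op m (Bop w) = Bop (dg (fun I => \prod_s d s (I s)) w).
Proof.
move=> H; rewrite /Bop tensor_opM (eq_tensor_op _ H) -tensor_opM; congr tensor_op.
by apply: spinorP => I; rewrite tensor_op_diag dgE.
Qed.

Lemma BopZ c w : Bop (c *: w) = c *: Bop w. Proof. exact: tensor_opZ. Qed.
Lemma BopD u v : Bop (u + v) = Bop u + Bop v. Proof. exact: tensor_opD. Qed.

Lemma gamma_last_Bop w : gamma ord_max (Bop w) = Bop (dg (fun I => 'i * \prod_s sg2 (I s)) w).
Proof.
rewrite /gamma eqxx (@Bop_diag _ (fun=> sg2)) => [|s]; last exact: TB.
by rewrite -BopZ; congr Bop; apply: spinorP => I; rewrite spZE !dgE mulrA.
Qed.

(** The action counts tensor factors from the right, so the j-th rotor acts in the factor k - j.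
    There e_(2j-1) e_(2j) = - i T has eigenvalues - i sg with sg = 1 or -1, and the rotor e^(- i sg
    j pi / n). *)
Lemma rotor_Bop (j : nat) (s0 : 'I_k) w : (1 <= j)%N -> (s0 + j = k)%N ->
  cl_act (rotor R k j) (Bop w) =
  Bop (dg (fun I => ex (- ((-1) ^+ (I s0) * j%:R / (2 * n%:R)))) w).
Proof.
move=> j1 sj; have jk : (1 <= j <= k)%N by rewrite j1 -sj leq_addl.
rewrite /rotor cl_actDl !cl_actZl cl_act1 cl_actM !cl_act_gen.
rewrite (@gamma_pair _ _ _ _ s0); first last.
- rewrite ix_odd // doubleK; apply/eqP; rewrite -eqSS -addnS !prednK ?sj //.
  exact: leq_ltn_trans (ltn_ord s0).
- by rewrite ix_odd // ix_even.
- by rewrite ix_odd // odd_double.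
rewrite (@Bop_diag _ (fun s x => if s == s0 then - 'i * sg2 x else 1)); last first.
  move=> s; case: eqP => _; last by rewrite mul1mx -[LHS]mulmx1; congr (_ *m _); apply/matrixP => i j'; rewrite !mxE.
  rewrite -scalemxAl TB scalemxAr; congr (_ *m _); apply/matrixP => i j'; rewrite !mxE.
  by rewrite mulrnAr.
rewrite -!BopZ -BopD; congr Bop; apply: spinorP => I; rewrite spDE !spZE !dgE.
rewrite (bigD1 s0) //= eqxx big1 ?mulr1 => [|s /negPf -> //].
rewrite [X in _ + X]mulrA -mulrDl; congr (_ * _).
set t := j%:R * (pi / n%:R).
have eang (r : R) : 2 * pi * - (r * j%:R / (2 * n%:R)) = - (r * t).
  by rewrite /t; field; rewrite nat1r pnatr_eq0.
apply: ReIm_eq; rewrite ?Re_ex ?Im_ex eang ?cosN ?sinN.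
  rewrite ReD mulrC Re_mulR /= /sg2; case: (I s0) => [[|[|//]] p] /=; rewrite ?expr0 ?expr1 ?mul1r ?mulN1r ?cosN /=; ring.
rewrite ImD mulrC Im_mulR /= /sg2; case: (I s0) => [[|[|//]] p] /=; rewrite ?expr0 ?expr1 ?mul1r ?mulN1r ?sinN /=; ring.
Qed.

(** This is mu_eps read off a tensor index; the factor s carries the rotor of index k - s, whence
    the reversed weights. *)
Definition muI (I : index) : R := \sum_(s < k) (-1) ^+ (I s) * (k - s)%:R.

Lemma alpha_Bop w : cl_act (alpha R k) (Bop w) = Bop (dg (fun I => ex (- (muI I / (2 * n%:R)))) w).
Proof.
pose S m (I : index) : R := \sum_(s < k | (k - s <= m)%N) (-1) ^+ (I s) * (k - s)%:R.
have H m v : (m <= k)%N -> cl_act (\prod_(1 <= j < m.+1) rotor R k j) (Bop v) =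
    Bop (dg (fun I => ex (- (S m I / (2 * n%:R)))) v).
  elim: m v => [|m IH] v mk.
    rewrite big_geq // cl_act1; congr Bop; apply: spinorP => I; rewrite dgE /S big1 ?mul0r ?oppr0 ?ex0 ?mul1r //.
    by move=> s; rewrite leqn0 subn_eq0 leqNgt ltn_ord.
  have sk : (k - m.+1 < k)%N by rewrite ltn_subrL (leq_ltn_trans _ mk).
  pose s0 := Ordinal sk.
  have es0 : (s0 + m.+1 = k)%N by rewrite /= subnK.
  rewrite big_nat_recr //= cl_actM (rotor_Bop _ _ es0) // IH ?(ltnW mk) //.
  have eS I : S m.+1 I = (-1) ^+ (I s0) * m.+1%:R + S m I.
    rewrite /S (bigD1 s0) /=; last by rewrite subKn.
    rewrite subKn //; congr (_ + _); apply: eq_bigl => s.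
    have [->|ss0] := eqVneq s s0; first by rewrite andbF /= subKn // ltnn.
    rewrite andbT leq_eqVlt ltnS; case: eqP => // e; case/eqP: ss0; apply/val_inj => /=.
    by rewrite -e subKn // ltnW.
  congr Bop; apply: spinorP => I; rewrite !dgE mulrA -exD; congr (ex _ * _).
  by rewrite eS [(_ + S m I) / _]mulrDl opprD addrC.
have eS I : S k I = muI I by apply: eq_bigl => s; rewrite leq_subr.
by rewrite /alpha H //; congr Bop; apply: spinorP => I; rewrite !dgE eS.
Qed.

End Alpha.

(** * Geometry of the flat manifold *)

Section Geometry.
Variables (R : realType) (k : nat) (M : CHD R k).
Local Notation C := (CC R).
Local Notation n := k.*2.+1.
Local Notation V := 'cV[R]_n.
Local Notation W := (spinor R k).
Local Notation Cl := (clifford R n).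
Local Notation A := (chd_A M).
Local Notation e := (chd_e M).
Local Notation a := (chd_a M).
Local Notation dot := (chd_dot M).
Implicit Types (i j : 'I_n) (u v x : V) (th : 'rV[R]_n) (w : W).

Lemma ixE i : i = ix k i.+1.
Proof. by apply/val_inj; rewrite /= ix_val //=; exact: ltn_ord i. Qed.

Lemma ix_last : ix k n = ord_max.
Proof. by apply/val_inj; rewrite /= ix_val //= leqnn. Qed.

Lemma ix_cases i : i = ord_max \/ exists2 j, (1 <= j <= k)%N & i = ix k j.*2.-1 \/ i = ix k j.*2.
Proof.
have [->|im] := eqVneq i ord_max; [by left|right].
have ik : (i < k.*2)%N.
  by have := ltn_ord i; rewrite ltnS leq_eqVlt -val_eqE /= in im *; rewrite (negPf im).
have jk : (1 <= i./2.+1 <= k)%N by rewrite /= ltn_half_double.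
exists i./2.+1 => //; case o : (odd i); [right|left]; apply/val_inj.
  by rewrite /= ix_even //= -{1}(odd_double_half i) o.
rewrite (_ : \val (ix k _) = (i./2.+1.-1).*2); last exact: ix_odd.
by rewrite /= -{1}(odd_double_half i) o.
Qed.

Lemma dotDl u v x : dot (u + v) x = dot u x + dot v x. Proof. exact: linearDl. Qed.
Lemma dotZl (c : R) u x : dot (c *: u) x = c * dot u x. Proof. by rewrite linearZl_LR. Qed.
Lemma dotDr u v x : dot x (u + v) = dot x u + dot x v. Proof. exact: linearDr. Qed.
Lemma dotZr (c : R) u x : dot x (c *: u) = c * dot x u. Proof. by rewrite linearZr. Qed.
Lemma dot0l x : dot 0 x = 0. Proof. by rewrite -(scale0r x) dotZl mul0r. Qed.
Lemma dot_suml (T : Type) (r : seq T) (F : T -> V) x : dot (\sum_(t <- r) F t) x = \sum_(t <- r) dot (F t) x.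
Proof. by elim: r => [|t r IH]; rewrite ?big_nil ?dot0l // !big_cons dotDl IH. Qed.

Definition Emx : 'M[R]_n := \matrix_(r, i) e i r 0.
Definition Lmx : 'M[R]_n := \matrix_(i, r) dot (delta_mx r 0) (e i).

Lemma Lmx_mul v i : (Lmx *m v) i 0 = dot v (e i).
Proof.
rewrite [in RHS](matrix_sum_delta v) dot_suml mxE; apply: eq_bigr => r _.
by rewrite big_ord_recl big_ord0 addr0 (_ : ord0 = 0) // dotZl mxE mulrC.
Qed.

Lemma mul_Emx x : Emx *m x = \sum_i x i 0 *: e i.
Proof.
apply/colP => r; rewrite mxE summxE; apply: eq_bigr => i _.
by rewrite !mxE mulrC.
Qed.

Lemma LE1 : Lmx *m Emx = 1%:M.
Proof.
apply/matrixP => i j; have <- : (Lmx *m e j) i 0 = (Lmx *m Emx) i j.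
  by rewrite !mxE; apply: eq_bigr => r _; rewrite !mxE.
by rewrite Lmx_mul chd_e_orthonormal mxE eq_sym.
Qed.

Lemma EL1 : Emx *m Lmx = 1%:M. Proof. exact: mulmx1C LE1. Qed.

Lemma e_expand v : v = \sum_i dot v (e i) *: e i.
Proof.
rewrite -[LHS]mul1mx -EL1 -mulmxA mul_Emx; apply: eq_bigr => i _.
by rewrite Lmx_mul.
Qed.

Lemma parseval u v : dot u v = \sum_i dot u (e i) * dot v (e i).
Proof.
rewrite {1}(e_expand u) dot_suml; apply: eq_bigr => i _; rewrite dotZl; congr (_ * _).
rewrite {1}(e_expand v).
have -> : dot (e i) (\sum_j dot v (e j) *: e j) = \sum_j dot v (e j) * dot (e i) (e j).
  elim: (index_enum _) => [|j s IH]; last by rewrite !big_cons dotDr dotZr IH.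
  by rewrite !big_nil -(scale0r 0) dotZr mul0r.
rewrite (bigD1 i) //= chd_e_orthonormal eqxx mulr1 big1 ?addr0 // => j ji.
by rewrite chd_e_orthonormal eq_sym (negPf ji) mulr0.
Qed.

Lemma dotC u v : dot u v = dot v u.
Proof. by rewrite parseval [RHS]parseval; apply: eq_bigr => i _; rewrite mulrC. Qed.

Lemma dot_e_eq u v : (forall i, dot u (e i) = dot v (e i)) -> u = v.
Proof. by move=> h; rewrite (e_expand u) (e_expand v); apply: eq_bigr => i _; rewrite h. Qed.

Lemma dot_ge0 u : 0 <= dot u u.
Proof. by rewrite parseval sumr_ge0 // => i _; rewrite -expr2 sqr_ge0. Qed.

Lemma A_last : A *m e ord_max = e ord_max.
Proof. by rewrite -ix_last chd_e_last chd_A_last. Qed.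

Lemma ex_cos (j : nat) : cos (2 * pi * j%:R) = 1 :> R.
Proof. by rewrite -Re_ex ex_int ?rpred_nat. Qed.

Lemma ex_sin (j : nat) : sin (2 * pi * j%:R) = 0 :> R.
Proof. by rewrite -Im_ex ex_int ?rpred_nat. Qed.

Lemma A_pow_pair (j m : nat) : (1 <= j <= k)%N ->
  let phi : R := 2 * pi * j%:R / n%:R in
  iter m (mulmx A) (e (ix k j.*2.-1)) =
     cos (m%:R * phi) *: e (ix k j.*2.-1) + sin (m%:R * phi) *: e (ix k j.*2) /\
  iter m (mulmx A) (e (ix k j.*2)) =
     - sin (m%:R * phi) *: e (ix k j.*2.-1) + cos (m%:R * phi) *: e (ix k j.*2).
Proof.
move=> jk phi; have Ao := chd_A_odd M jk; have Ae := chd_A_even M jk.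
elim: m => [|m [IH1 IH2]] /=.
  by rewrite mul0r cos0 sin0 oppr0 !scale1r !scale0r addr0 add0r.
rewrite IH1 IH2 !mulmxDr -!scalemxAr Ao Ae !scalerDr !scalerA -/phi.
have -> : m.+1%:R * phi = m%:R * phi + phi by rewrite -natr1 mulrDl mul1r.
rewrite cosD sinD; split; rewrite addrACA -!scalerDl; congr (_ *: _ + _ *: _); ring.
Qed.

(** A turns each coordinate plane by a multiple of 2 pi / n and fixes e_n. *)
Lemma A_pow_n v : iter n (mulmx A) v = v.
Proof.
have lin m : exists B : 'M[R]_n, forall x, iter m (mulmx A) x = B *m x.
  elim: m => [|m [B HB]]; first by exists 1%:M => x; rewrite mul1mx.
  by exists (A *m B) => x; rewrite iterS HB mulmxA.
have [B HB] := lin n; rewrite HB (e_expand v) mulmx_sumr; apply: eq_bigr => i _.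
rewrite -scalemxAr -HB; congr (_ *: _).
have fix_last m : iter m (mulmx A) (e ord_max) = e ord_max.
  by elim: m => // m IH; rewrite iterS IH A_last.
have [->|[j jk]] := ix_cases i; first exact: fix_last.
have [h1 h2] := A_pow_pair n jk.
have ang : n%:R * (2 * pi * j%:R / n%:R) = 2 * pi * j%:R :> R.
  by rewrite mulrC divfK // pnatr_eq0.
rewrite ang ex_cos ex_sin oppr0 scale0r scale1r in h1 h2.
by case=> ->; rewrite ?h1 ?h2 ?scale0r ?scale1r ?addr0 ?add0r.
Qed.

Lemma A_unit : A \in unitmx.
Proof.
have lin m : exists B : 'M[R]_n, forall x, iter m (mulmx A) x = B *m x.
  elim: m => [|m [B HB]]; first by exists 1%:M => x; rewrite mul1mx.
  by exists (A *m B) => x; rewrite iterS HB mulmxA.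
(* [k.*2] is n - 1: the inverse of A is A^(n-1). *)
have [B HB] := lin k.*2; suff /mulmx1_unit [] : A *m B = 1%:M by [].
apply/matrixP => i j; have := congr1 (fun z : V => z i 0) (A_pow_n (delta_mx j 0)).
rewrite iterS HB mulmxA.
have -> : (A *m B *m delta_mx j 0 : V) i 0 = (A *m B) i j.
  by rewrite -colE mxE.
by move=> ->; rewrite !mxE andbT.
Qed.

Lemma cl_vecD u v : cl_vec M (u + v) = cl_vec M u + cl_vec M v.
Proof.
by rewrite /cl_vec -big_split; apply: eq_bigr => i _; rewrite dotDl scalerDl.
Qed.

Lemma cl_vecZ (c : R) u : cl_vec M (c *: u) = c *: cl_vec M u.
Proof.
by rewrite /cl_vec scaler_sumr; apply: eq_bigr => i _; rewrite dotZl scalerA.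
Qed.

Lemma cl_vec_e i : cl_vec M (e i) = cl_gen R i.
Proof.
rewrite /cl_vec (bigD1 i) //= chd_e_orthonormal eqxx scale1r big1 ?addr0 // => j ji.
by rewrite chd_e_orthonormal eq_sym (negPf ji) scale0r.
Qed.

Lemma cl_vec_anti u v : cl_vec M u * cl_vec M v + cl_vec M v * cl_vec M u = (- (2 * dot u v)) *: 1.
Proof.
have prod x y : cl_vec M x * cl_vec M y =
    \sum_i \sum_j (dot x (e i) * dot y (e j)) *: (cl_gen R i * cl_gen R j).
  rewrite /cl_vec mulr_suml; apply: eq_bigr => i _; rewrite mulr_sumr; apply: eq_bigr => j _.
  by rewrite -scalerAl -scalerAr scalerA.
rewrite prod prod [X in _ + X]exchange_big /= -big_split /=.
rewrite parseval mulr_sumr -sumrN scaler_suml; apply: eq_bigr => i _.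
rewrite -big_split (bigD1 i) //= big1 ?addr0 => [|j ji].
  by rewrite cl_gen_sq [X in _ + X *: _]mulrC -scalerDl -scaleN1r scalerA; congr (_ *: _); ring.
by rewrite (mulrC (dot v (e j))) (cl_gen_anti R ji) scalerN subrr.
Qed.

(** The relation lambda(alpha) = A, in intertwining form. *)
Lemma alpha_vec x : alpha R k * cl_vec M x = cl_vec M (A *m x) * alpha R k.
Proof.
have vec_lin (B : 'M[R]_n) v : cl_vec M (B *m v) = \sum_i dot v (e i) *: cl_vec M (B *m e i).
  rewrite {1}(e_expand v) mulmx_sumr.
  elim: (index_enum _) => [|i s IH].
    by rewrite !big_nil -(scale0r 0) cl_vecZ scale0r.
  by rewrite !big_cons cl_vecD -scalemxAr cl_vecZ IH.
rewrite -{1}(mul1mx x) !vec_lin mulr_sumr mulr_suml; apply: eq_bigr => i _.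
rewrite -scalerAr -scalerAl mul1mx cl_vec_e; congr (_ *: _).
have [->|[j jk]] := ix_cases i.
  by rewrite A_last cl_vec_e -ix_last alpha_last.
have [h1 h2] := alpha_pair R jk.
case=> ->; rewrite (chd_A_odd, chd_A_even) // cl_vecD !cl_vecZ !cl_vec_e //.
Qed.

(* [uvec th] represents the linear form [th] through the scalar product. *)
Definition uvec th : V := \sum_i (th *m e i) 0 0 *: e i.

Lemma uvecE th i : dot (uvec th) (e i) = (th *m e i) 0 0.
Proof.
rewrite dot_suml (bigD1 i) //= dotZl chd_e_orthonormal eqxx mulr1 big1 ?addr0 // => j ji.
by rewrite dotZl chd_e_orthonormal (negPf ji) mulr0.
Qed.

Lemma uvec_dot th v : dot (uvec th) v = (th *m v) 0 0.
Proof.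
rewrite parseval [in RHS](e_expand v) mulmx_sumr summxE; apply: eq_bigr => i _.
by rewrite uvecE -scalemxAr [RHS]mxE mulrC.
Qed.

Lemma uvec_inj : injective uvec.
Proof.
move=> th th' eq_u; have h v : (th *m v) 0 0 = (th' *m v) 0 0 by rewrite -!uvec_dot eq_u.
by apply/rowP => j; have := h (delta_mx j 0); rewrite -!colE !mxE.
Qed.

Lemma uvecA th : A *m uvec (th *m A) = uvec th.
Proof.
have AA v : exists v', v = A *m v' by exists (invmx A *m v); rewrite mulKVmx ?A_unit.
apply: dot_e_eq => i; have [v ->] := AA (e i).
by rewrite chd_dot_A !uvec_dot mulmxA.
Qed.

(** The squared dual norm |th|^2; [sth] below is th(e_n), and th lies on the axis exactly when
    |th|^2 = th(e_n)^2. *)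
Definition Nth th : R := dot (uvec th) (uvec th).
Definition sth th : R := (th *m e ord_max) 0 0.

Lemma Nth_ge0 th : 0 <= Nth th. Proof. exact: dot_ge0. Qed.

Lemma NthA th : Nth (th *m A) = Nth th.
Proof. by rewrite /Nth -chd_dot_A uvecA. Qed.

Lemma sthA th : sth (th *m A) = sth th.
Proof. by rewrite /sth -mulmxA A_last. Qed.

Lemma cauchy_schwarz u v : dot u v ^+ 2 <= dot u u * dot v v.
Proof.
have [v0|v0] := eqVneq (dot v v) 0.
  have vv i : dot v (e i) = 0.
    apply/eqP; rewrite -sqrf_eq0; move: v0; rewrite parseval => /eqP; rewrite psumr_eq0; last first.
      by move=> j _; rewrite -expr2 sqr_ge0.
    by move/allP/(_ i (mem_index_enum _)); rewrite expr2.
  have -> : v = 0 by apply: dot_e_eq => i; rewrite vv dot0l.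
  by rewrite dotC dot0l expr0n /= mulr_ge0 ?dot_ge0.
have vp : 0 < dot v v by rewrite lt_neqAle eq_sym v0 dot_ge0.
have := dot_ge0 (u - (dot u v / dot v v) *: v).
rewrite -scaleNr dotDl !dotDr !dotZl !dotZr (dotC v u).
set p := dot u v; set q := dot v v in vp v0 *; set r := dot u u.
have -> : r + - (p / q) * p + (- (p / q) * p + - (p / q) * (- (p / q) * q)) = r - p ^+ 2 / q.
  by field.
by rewrite subr_ge0 ler_pdivrMr.
Qed.

(* w = |th|^2 e_n - th(e_n) u, with u dual to th, is orthogonal to u, and A maps the w of
   [th *m A] to the w of [th]. *)
Definition wvec th : V := Nth th *: e ord_max - sth th *: uvec th.

Lemma wvecA th : A *m wvec (th *m A) = wvec th.
Proof. by rewrite /wvec mulmxBr -!scalemxAr A_last uvecA NthA sthA. Qed.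

Lemma wvec_dot_u th : dot (wvec th) (uvec th) = 0.
Proof.
rewrite /wvec -scaleNr dotDl !dotZl dotC uvec_dot -/(sth th) -/(Nth th).
by rewrite mulNr mulrC subrr.
Qed.

Lemma wvec_norm th : dot (wvec th) (wvec th) = Nth th * (Nth th - sth th ^+ 2).
Proof.
rewrite {2}/wvec -scaleNr dotDr !dotZr wvec_dot_u mulr0 addr0; congr (_ * _).
rewrite /wvec -scaleNr dotDl !dotZl chd_e_orthonormal eqxx mulr1 uvec_dot -/(sth th).
by rewrite mulNr expr2.
Qed.

(** |u - th(e_n) e_n|^2 = |th|^2 - th(e_n)^2 for the vector u dual to th. *)
Lemma axis_uvec th : Nth th = sth th ^+ 2 -> uvec th = sth th *: e ord_max.
Proof.
move=> h; apply/eqP; rewrite -subr_eq0; apply/eqP; apply: dot_e_eq => i; rewrite dot0l.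
apply/eqP; rewrite -sqrf_eq0 eq_le sqr_ge0 andbT; apply: le_trans (cauchy_schwarz _ _) _.
rewrite chd_e_orthonormal eqxx mulr1.
rewrite -scaleNr dotDl !dotDr !dotZl !dotZr (dotC (e ord_max)) -/(Nth th) h uvec_dot.
by rewrite -/(sth th) chd_e_orthonormal eqxx mulr1; lra.
Qed.

(* the linear form [x |-> <x, e_n>] *)
Definition axis : 'rV[R]_n := \row_r dot (delta_mx r 0) (e ord_max).

Lemma axisE v : (axis *m v) 0 0 = dot v (e ord_max).
Proof.
by rewrite -Lmx_mul !mxE; apply: eq_bigr => r _; rewrite !mxE.
Qed.

Lemma axis_A : axis *m A = axis.
Proof.
have h v : (axis *m A *m v) 0 0 = (axis *m v) 0 0.
  by rewrite -mulmxA !axisE -{1}A_last chd_dot_A.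
by apply/rowP => j; have := h (delta_mx j 0); rewrite -!colE !mxE.
Qed.

(** The form is A-invariant, so it has one value s on a_1, ..., a_(n-1); the relation for A a_(n-1)
    gives s = - (n - 1) s. *)
Lemma axis_a : (0 < k)%N -> forall i, i != ord_max -> (axis *m a i) 0 0 = 0.
Proof.
move=> k0.
have inv v : (axis *m (A *m v)) 0 0 = (axis *m v) 0 0 by rewrite mulmxA axis_A.
pose s : R := (axis *m a (ix k 1)) 0 0.
have all_s (j : nat) : (1 <= j < n)%N -> (axis *m a (ix k j)) 0 0 = s.
  elim: j => // -[|j] IH // jn; rewrite -chd_A_shift; first by rewrite inv; apply: IH; rewrite /= (ltn_trans _ jn).
  by rewrite /= -ltnS.
have s0 : s = 0.
  have kn : (1 <= k.*2 < n)%N by rewrite double_gt0 k0 /=.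
  have := inv (a (ix k k.*2)); rewrite (chd_A_wrap M k0) (all_s _ kn) mulmxN mxE mulmx_sumr summxE.
  have -> : \sum_(1 <= j < n) (axis *m a (ix k j)) 0 0 = s *+ k.*2.
    rewrite big_nat_cond (eq_bigr (fun=> s)) => [|j /andP[jn _]]; last exact: all_s.
    by rewrite -big_nat_cond sumr_const_nat subn1.
  move=> /eqP; rewrite eq_sym -addr_eq0 -{1}(mulr1n s) -mulrnDr add1n -mulr_natr mulf_eq0 pnatr_eq0 orbF.
  by move/eqP.
move=> i im; rewrite (ixE i) all_s ?s0 //=; rewrite ltnS.
by have := ltn_ord i; rewrite ltnS leq_eqVlt -val_eqE /= in im *; rewrite (negPf im).
Qed.

Lemma axis_form th : Nth th = sth th ^+ 2 -> th = sth th *: axis.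
Proof.
move=> /axis_uvec h; apply: uvec_inj; rewrite h; apply: dot_e_eq => i.
by rewrite dotZl uvecE -scalemxAl mxE axisE; congr (_ * _); exact: dotC.
Qed.

Lemma sth_axis (c : R) : sth (c *: axis) = c.
Proof. by rewrite /sth -scalemxAl mxE axisE chd_e_orthonormal eqxx mulr1. Qed.

Lemma Nth_axis (c : R) : Nth (c *: axis) = c ^+ 2.
Proof.
have h : uvec (c *: axis) = c *: e ord_max.
  apply: dot_e_eq => i; rewrite dotZl uvecE -scalemxAl [LHS]mxE axisE; congr (_ * _); exact: dotC.
by rewrite /Nth h dotZl dotZr chd_e_orthonormal eqxx mulr1 expr2.
Qed.

Lemma a_expand v : exists t : 'I_n -> R, v = \sum_i t i *: a i.
Proof.
have bas := chd_basis M; rewrite basisEfree in bas; case/and3P: bas => _ _ _.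
have := chd_basis M; rewrite /basis_of => /andP[/eqP sp fr].
pose X : n.-tuple V := [tuple a i | i < n].
have eX : [seq a i | i <- enum 'I_n] = X by [].
have vX : v \in <<X>>%VS by rewrite -eX sp memvf.
exists (fun i => coord X i v); rewrite {1}(coord_span vX); apply: eq_bigr => i _.
by rewrite -tnth_nth tnth_mktuple.
Qed.

End Geometry.

(** * Smooth quasi-periodic functions *)

Section PeriodicSmooth.
Variables (R : realType) (k : nat) (a : 'I_(k.*2.+1) -> 'cV[R]_(k.*2.+1)).
Local Notation n := k.*2.+1.
Local Notation V := 'cV[R]_n.
Hypothesis a_span : forall v : V, exists t : 'I_n -> R, v = \sum_i t i *: a i.
Implicit Types (f : V -> R) (x u v : V).

(** Real multipliers suffice because delta is 0 or 1/2: the real and imaginary parts of a field can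
    be treated separately. *)
Definition sign_periodic f := forall i, exists s : R, `|s| = 1 /\ forall x, f (x + a i) = s * f x.

Lemma lincomb_continuous : continuous (fun t : 'rV[R]_n => \sum_i t 0 i *: a i).
Proof.
apply: (@continuous_big 'cV[R]_n 'I_n +%R 0 xpredT _ 'rV[R]_n _ (fun i (t : 'rV[R]_n) => t 0 i *: a i)).
  by move=> x; exact: add_continuous.
move=> i _ t; apply: (@cvgZr_tmp R 'cV[R]_n 'rV[R]_n (nbhs t)).
exact: (@coord_continuous R 1 n 0 i).
Qed.

(** |f| is periodic, hence bounded by its maximum over the unit cube in the coordinates of the basis
    [a]. *)
Lemma sign_periodic_bounded f : continuous f -> sign_periodic f -> exists B : R, forall x, `|f x| <= B.
Proof.
move=> cf pf.
have per_nat i (m : nat) x : `|f (x + m%:R *: a i)| = `|f x|.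
  elim: m x => [|m IH] x; first by rewrite scale0r addr0.
  have [s [s1 Hs]] := pf i.
  by rewrite -natr1 scalerDl scale1r addrA Hs normrM s1 mul1r IH.
have per_int i (z : int) x : `|f (x + z%:~R *: a i)| = `|f x|.
  case: z => m; first exact: per_nat.
  by rewrite -(per_nat i m.+1) NegzE mulrNz scaleNr subrK.
have per_all (z : 'I_n -> int) (s : seq 'I_n) x : `|f (x + \sum_(i <- s) (z i)%:~R *: a i)| = `|f x|.
  elim: s x => [|i s IH] x; first by rewrite big_nil addr0.
  by rewrite big_cons addrCA addrC per_int IH.
pose cube : set 'rV[R]_n := [set t | forall i j, 0 <= t i j <= 1].
have cc : compact cube.
  have := @rV_compact R n (fun=> `[0, 1]%classic) (fun=> @segment_compact R 0 1).
  congr compact; apply/seteqP; split => t /= H.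
    by move=> i j; rewrite (ord1 i); have := H j; rewrite in_itv.
  
  by move=> j; rewrite in_itv; exact: H.
pose g (t : 'rV[R]_n) : R := `|f (\sum_i t 0 i *: a i)|.
have cg : continuous g.
  move=> t; apply: (@continuous_comp _ _ _ (fun t : 'rV[R]_n => \sum_i t 0 i *: a i) (fun x => `|f x|)).
    exact: lincomb_continuous.
  by apply: continuous_comp; [exact: cf|exact: norm_continuous].
have [] := @EVT_max_rV R _ g cube _ cc.
- by exists 0 => i j; rewrite mxE lexx ler01.
- exact: continuous_subspaceT.
move=> c _ Hc; exists (g c) => x; have [t ->] := a_span x.
rewrite -(per_all (fun i => - Num.floor (t i)) (index_enum _)) -big_split /=.
have -> : \sum_i (t i *: a i + (- Num.floor (t i))%:~R *: a i) =
   \sum_i (\row_i (t i - (Num.floor (t i))%:~R) : 'rV[R]_n) 0 i *: a i.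
  by apply: eq_bigr => i _; rewrite -scalerDl mxE mulrNz.
apply: Hc; rewrite inE => i j; rewrite mxE.
have /andP[h1 h2] := floor_itv (t j).
by rewrite subr_ge0 h1 /= lerBlDl -intrD1 ltW.
Qed.

Lemma line_derive f x v (t : R) : derivable f (x + t *: v) v ->
  is_derive t 1 (fun s : R => f (x + s *: v)) ('D_v f (x + t *: v)).
Proof.
move=> df; have e : (fun h : R => h^-1 *: (((fun s : R => f (x + s *: v)) \o shift t) (h *: 1) - f (x + t *: v)))
   = (fun h : R => h^-1 *: ((f \o shift (x + t *: v)) (h *: v) - f (x + t *: v))).
  apply/funext => h /=; congr (_ *: (f _ - _)).
  by rewrite [h%:A]mulr1 scalerDl addrCA.
by split; rewrite /derivable /derive e.
Qed.

Definition Csmooth f := forall m, Cm m f.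

Lemma Csmooth_continuous f : Csmooth f -> continuous f. Proof. by move/(_ 0%N). Qed.
Lemma Csmooth_derivable f x v : Csmooth f -> derivable f x v.
Proof. by move=> /(_ 1%N) [+ _]; apply. Qed.
Lemma Csmooth_D f v : Csmooth f -> Csmooth (fun x => 'D_v f x).
Proof. by move=> sf m; have [_] := sf m.+1; apply. Qed.

Lemma sign_periodic_D f v : sign_periodic f -> Csmooth f -> sign_periodic (fun x => 'D_v f x).
Proof.
move=> pf sf i; have [s [s1 Hs]] := pf i; exists s; split=> // x.
rewrite -[RHS](deriveZ s (Csmooth_derivable sf)) /derive.
by apply: f_equal; apply: (f_equal (fun F : R -> R => F @ (0 : R)^')); apply/funext => h /=; rewrite addrA !Hs.
Qed.

(** The second derivative along v is again continuous and sign-periodic, hence bounded on the whole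
    space. *)
Lemma smooth_taylor f v : Csmooth f -> sign_periodic f -> exists K : R, forall x (h : R),
  `|f (x + h *: v) - f x - h * 'D_v f x| <= K * h ^+ 2.
Proof.
move=> sf pf; have sD := Csmooth_D v sf; have pD := sign_periodic_D v pf sf.
have sDD := Csmooth_D v sD; have pDD := sign_periodic_D v pD sD.
have [B HB] := sign_periodic_bounded (Csmooth_continuous sDD) pDD.
exists (4 * B) => x h.
have := @cTaylor2T R (fun t => (f (x + t *: v))%:C) (fun t => ('D_v f (x + t *: v))%:C)
  (fun t => ('D_v (fun z => 'D_v f z) (x + t *: v))%:C) B _ _ _ 0 h.
rewrite add0r scale0r addr0 -rmorphM -!rmorphB cabsR; apply.
- by move=> y; apply/cderR/line_derive/Csmooth_derivable.
- by move=> y; apply/cderR/line_derive/Csmooth_derivable.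
- by move=> y; rewrite cabsR.
Qed.

Lemma smooth_D_bounded f v : Csmooth f -> sign_periodic f -> exists B : R, forall x, `|'D_v f x| <= B.
Proof.
move=> sf pf; apply: sign_periodic_bounded; last exact: sign_periodic_D.
exact/Csmooth_continuous/Csmooth_D.
Qed.

Lemma small_linear (d C : R) : (forall h : R, `|h| <= 1 -> `|h * d| <= C * h ^+ 2) -> d = 0.
Proof.
move=> H; apply/eqP; rewrite -normr_eq0 eq_le normr_ge0 andbT.
apply/ler_addgt0Pr => e e0; rewrite add0r.
pose h := Num.min 1 (e / (`|C| + 1)); have C1 : 0 < `|C| + 1 by rewrite ltr_wpDl.
have h0 : 0 < h by rewrite lt_min ltr01 divr_gt0.
have := H h; rewrite ger0_norm ?(ltW h0) // ge_min lexx /= => /(_ isT).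
rewrite normrM (gtr0_norm h0) expr2 mulrCA ler_pM2l // => /le_trans; apply.
apply: (@le_trans _ _ ((`|C| + 1) * h)).
  by rewrite ler_wpM2r ?(ltW h0) // (le_trans (ler_norm _)) // lerDl.
have : h <= e / (`|C| + 1) by rewrite ge_min lexx orbT.
by rewrite ler_pdivlMr // mulrC.
Qed.

(** Obtained from the Taylor bounds, not from total differentiability: h (D_(u+v) f - D_u f - D_v f)
    is O(h^2). *)
Lemma smooth_D_add f u v x : Csmooth f -> sign_periodic f -> 'D_(u + v) f x = 'D_u f x + 'D_v f x.
Proof.
move=> sf pf; have [K1 H1] := smooth_taylor (u + v) sf pf.
have [K2 H2] := smooth_taylor u sf pf; have [K3 H3] := smooth_taylor v sf pf.
have sD := Csmooth_D v sf; have pD := sign_periodic_D v pf sf.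
have [K4 H4] := smooth_taylor u sD pD; have [B HB] := smooth_D_bounded u sD pD.
apply/eqP; rewrite -subr_eq0; apply/eqP.
apply: (@small_linear _ (K1 + K2 + K3 + `|K4| + B)) => h h1.
(* The path x, x + h u, x + h u + h v; the derivative along v at x + h u is brought back to x by its
   own Taylor bound. *)
have -> : h * ('D_(u + v) f x - ('D_u f x + 'D_v f x)) =
  - (f (x + h *: (u + v)) - f x - h * 'D_(u + v) f x)
  + (f (x + h *: u) - f x - h * 'D_u f x)
  + (f (x + h *: u + h *: v) - f (x + h *: u) - h * 'D_v f (x + h *: u))
  + h * ('D_v f (x + h *: u) - 'D_v f x - h * 'D_u (fun z => 'D_v f z) x)
  + h * (h * 'D_u (fun z => 'D_v f z) x).
  have -> : x + h *: (u + v) = x + h *: u + h *: v by rewrite scalerDr addrA.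
  by ring.
apply: le_trans (ler_normD _ _) _; rewrite [leRHS]mulrDl; apply: lerD; last first.
  rewrite mulrA normrM -expr2 ger0_norm ?sqr_ge0 // mulrC.
  by rewrite ler_wpM2r ?sqr_ge0.
apply: le_trans (ler_normD _ _) _; rewrite [leRHS]mulrDl; apply: lerD; last first.
  rewrite normrM; apply: le_trans (ler_wpM2l (normr_ge0 _) (H4 _ _)) _.
  apply: (@le_trans _ _ (1 * (`|K4| * h ^+ 2))); last by rewrite mul1r.
  apply: ler_pM => //; first by rewrite (le_trans _ (H4 x h)).
  by rewrite ler_wpM2r ?sqr_ge0 // ler_norm.
apply: le_trans (ler_normD _ _) _; rewrite [leRHS]mulrDl; apply: lerD; last exact: H3.
apply: le_trans (ler_normD _ _) _; rewrite [leRHS]mulrDl; apply: lerD; last exact: H2.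
by rewrite normrN.
Qed.

Lemma smooth_D_scale f (c : R) v x : Csmooth f -> sign_periodic f -> 'D_(c *: v) f x = c * 'D_v f x.
Proof.
move=> sf pf; have [K1 H1] := smooth_taylor (c *: v) sf pf.
have [K2 H2] := smooth_taylor v sf pf.
apply/eqP; rewrite -subr_eq0; apply/eqP; apply: (@small_linear _ (K1 + K2 * c ^+ 2)) => h _.
have -> : h * ('D_(c *: v) f x - c * 'D_v f x) =
  - (f (x + h *: (c *: v)) - f x - h * 'D_(c *: v) f x)
  + (f (x + (h * c) *: v) - f x - (h * c) * 'D_v f x).
  by rewrite scalerA; ring.
rewrite mulrDl; apply: le_trans (ler_normD _ _) _; apply: lerD; first by rewrite normrN.
apply: le_trans (H2 _ _) _; rewrite exprMn; by rewrite mulrA mulrAC.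
Qed.

End PeriodicSmooth.

(** * Smooth functions as [nice] functions; trigonometric sums *)

Section NiceSmooth.
Variables (R : realType) (k : nat).
Local Notation n := k.*2.+1.
Local Notation V := 'cV[R]_n.
Local Notation C := (CC R).
Implicit Types (F : V -> C) (f g : V -> R) (x u v : V).

Definition cdir v F x : C := ('D_v (fun y => Re (F y)) x) +i* ('D_v (fun y => Im (F y)) x).

Lemma nice_smooth (a : 'I_n -> V) (delta s : 'I_n -> R) F :
  (forall v : V, exists t : 'I_n -> R, v = \sum_i t i *: a i) ->
  (forall i, `|s i| = 1 /\ ex (delta i) = (s i)%:C) ->
  Csmooth (fun y => Re (F y)) -> Csmooth (fun y => Im (F y)) ->
  (forall i x, F (x + a i) = ex (delta i) * F x) -> nice a delta F (cdir^~ F).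
Proof.
move=> a_span hs sr si per.
have pr : sign_periodic a (fun y => Re (F y)).
  by move=> i; have [s1 es] := hs i; exists (s i); split=> // x; rewrite per es RecM /= mul0r subr0.
have pi' : sign_periodic a (fun y => Im (F y)).
  by move=> i; have [s1 es] := hs i; exists (s i); split=> // x; rewrite per es ImcM /= mul0r addr0.
split=> //.
- have [B1 H1] := sign_periodic_bounded a_span (Csmooth_continuous sr) pr.
  have [B2 H2] := sign_periodic_bounded a_span (Csmooth_continuous si) pi'.
  exists (B1 + B2) => x; apply: le_trans (cabs_leReIm _) _.
  exact: lerD (H1 x) (H2 x).
- move=> v; have [B1 H1] := smooth_D_bounded a_span v sr pr.
  have [B2 H2] := smooth_D_bounded a_span v si pi'.
  exists (B1 + B2) => x; apply: le_trans (cabs_leReIm _) _.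
  exact: lerD (H1 x) (H2 x).
- move=> v; have [K1 H1] := smooth_taylor a_span v sr pr.
  have [K2 H2] := smooth_taylor a_span v si pi'.
  exists (K1 + K2) => x h; apply: le_trans (cabs_leReIm _) _.
  rewrite [leRHS]mulrDl !ReB !ImB RecM ImcM /= !mul0r subr0 addr0.
  exact: lerD (H1 x h) (H2 x h).
- move=> u v x; apply: ReIm_eq; rewrite ?ReD ?ImD /=.
    exact: (smooth_D_add a_span _ _ _ sr pr).
  exact: (smooth_D_add a_span _ _ _ si pi').
- move=> c v x; apply: ReIm_eq; rewrite ?RecM ?ImcM /= mul0r ?subr0 ?addr0.
    exact: (smooth_D_scale a_span _ _ _ sr pr).
  exact: (smooth_D_scale a_span _ _ _ si pi').
Qed.

Lemma derive_of_line f x v (d : R) : is_derive (0 : R) 1 (fun s : R => f (x + s *: v)) d ->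
  is_derive x v f d.
Proof.
have e : (fun h : R => h^-1 *: (((fun s : R => f (x + s *: v)) \o shift (0 : R)) (h *: 1) - f (x + (0 : R) *: v)))
   = (fun h : R => h^-1 *: ((f \o shift x) (h *: v) - f x)).
  by apply/funext => h /=; rewrite [h%:A]mulr1 addr0 scale0r addr0 (addrC x).
by case; rewrite /derivable /derive /= e => h1 h2; split.
Qed.

Lemma Cm_add m f g : Cm m f -> Cm m g -> Cm m (fun x => f x + g x).
Proof.
elim: m f g => [|m IH] f g /=.
  by move=> cf cg x; exact: (continuousD (cf x) (cg x)).
move=> [df Df] [dg' Dg]; split=> [v x|v]; first exact: derivableD.
rewrite (_ : (fun x => _) = fun x => 'D_v f x + 'D_v g x); first exact: IH.
by apply/funext => x; rewrite -[LHS]/('D_v (f \+ g) x) deriveD.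
Qed.

Lemma linear_continuous (l : V -> R) : linear_form l -> continuous l.
Proof.
move=> [lD lZ].
have lE x : l x = \sum_i x i 0 * l (delta_mx i 0).
  have l0 : l 0 = 0 by rewrite -(scale0r (0 : V)) lZ mul0r.
  rewrite {1}(matrix_sum_delta x).
  rewrite (big_morph l lD l0); apply: eq_bigr => i _; by rewrite big_ord1 lZ.
rewrite (_ : l = fun x : V => \sum_i x i 0 * l (delta_mx i 0)); last exact/funext.
apply: (@continuous_big R 'I_n +%R 0 xpredT _ V _ (fun i (x : V) => x i 0 * l (delta_mx i 0))).
  by move=> x; exact: add_continuous.
move=> i _ x; apply: (@continuousM R V (fun x => x i 0) (fun=> l (delta_mx i 0))) => /=; last exact: cst_continuous.
exact: (@coord_continuous R n 1 i 0).
Qed.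

Lemma continuous_of_derivable (f : R -> R) : (forall t, derivable f t 1) -> continuous f.
Proof. by move=> df x; apply/differentiable_continuous/derivable1_diffP. Qed.

Lemma derivative_trig (l : V -> R) (c : C) v x : linear_form l ->
  is_derive x v (fun y => Re (c * ex (l y))) (Re ('i * (2 * pi * l v)%:C * c * ex (l x))).
Proof.
move=> [lD lZ]; apply: derive_of_line.
have -> : (fun s : R => Re (c * ex (l (x + s *: v)))) = fun s => Re (c * ex (l x) * ex (l v * s)).
  by apply/funext => s; rewrite lD lZ exD mulrA (mulrC s).
have [+ _] := cderZ (c * ex (l x)) (cder_ex (l v) 0).
rewrite mulr0 ex0 mulr1; congr (is_derive _ _ _ (Re _)); ring.
Qed.

(** A directional derivative of Re (c e^(2 pi i l)) has the same form with another c, hence an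
    induction for all c at once. *)
Lemma Cm_trig (l : V -> R) m (c : C) : linear_form l -> Cm m (fun y => Re (c * ex (l y))).
Proof.
move=> lin; elim: m c => [|m IH] c /=.
  move=> x; apply: (@continuous_comp V R R l (fun t : R => Re (c * ex t))).
    exact: linear_continuous.
  apply: continuous_of_derivable => t.
  have [[d _] _] := cderZ c (cder_ex 1 t).
  by rewrite (_ : (fun t => _) = fun t => Re (c * ex (1 * t))) //; apply/funext => s; rewrite mul1r.
split=> [v x|v]; first by case: (derivative_trig c v x lin).
rewrite (_ : (fun x => _) = fun x => Re ('i * (2 * pi * l v)%:C * c * ex (l x))); first exact: IH.
by apply/funext => x; have [_] := derivative_trig c v x lin.
Qed.

(** Reduces imaginary parts to real parts with another constant c. *)
Lemma Re_negi (z : C) : Im z = Re (- 'i * z).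
Proof. by rewrite RecM /= oppr0 mul0r mulN1r opprK add0r. Qed.

Lemma cdir_trig (l : V -> R) (c : C) v x : linear_form l ->
  cdir v (fun y => c * ex (l y)) x = 'i * (2 * pi * l v)%:C * c * ex (l x).
Proof.
move=> lin; apply: ReIm_eq => /=; first by have [_] := derivative_trig c v x lin.
rewrite (_ : (fun y => _) = fun y => Re (- 'i * c * ex (l y))); last first.
  by apply/funext => y; rewrite Re_negi mulrA.
have [_ ->] := derivative_trig (- 'i * c) v x lin; rewrite Re_negi; congr Re; ring.
Qed.

Variables (I : Type) (l : I -> V -> R) (c : I -> C).
Hypothesis lin : forall i, linear_form (l i).

Lemma Csmooth_trig_sum (r : seq I) : Csmooth (fun y => Re (\sum_(i <- r) c i * ex (l i y))) /\
  Csmooth (fun y => Im (\sum_(i <- r) c i * ex (l i y))).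
Proof.
have cst0 m : Cm m (fun _ : V => 0 : R).
  have := @Cm_trig (fun=> 0) m 0; rewrite (_ : (fun=> _) = fun=> (0 : R)); last by apply/funext => x; rewrite mul0r.
  by apply; split=> *; rewrite ?addr0 ?mulr0.
split=> m; elim: r => [|i r IH].
- by rewrite (_ : (fun=> _) = fun=> 0) //; apply/funext => x; rewrite big_nil.
- rewrite (_ : (fun=> _) = fun x => Re (c i * ex (l i x)) + Re (\sum_(j <- r) c j * ex (l j x))).
    by apply: Cm_add => //; exact: Cm_trig.
  by apply/funext => x; rewrite big_cons ReD.
- by rewrite (_ : (fun=> _) = fun=> 0) //; apply/funext => x; rewrite big_nil.
rewrite (_ : (fun=> _) = fun x => Re (- 'i * c i * ex (l i x)) + Im (\sum_(j <- r) c j * ex (l j x))).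
  by apply: Cm_add => //; exact: Cm_trig.
by apply/funext => x; rewrite big_cons ImD -mulrA -Re_negi.
Qed.

Lemma cdir_trig_sum (r : seq I) v x : cdir v (fun y => \sum_(i <- r) c i * ex (l i y)) x =
  \sum_(i <- r) 'i * (2 * pi * l i v)%:C * c i * ex (l i x).
Proof.
elim: r => [|i r IH].
  rewrite big_nil /cdir (_ : (fun y => Re _) = fun=> 0); last by apply/funext => y; rewrite big_nil.
  rewrite (_ : (fun y => Im _) = fun=> 0); last by apply/funext => y; rewrite big_nil.
  by rewrite derive_cst.
have [s1 s2] := Csmooth_trig_sum r.
have [t1 t2] := Csmooth_trig_sum [:: i].
rewrite big_cons -IH -cdir_trig //; apply: ReIm_eq; rewrite ?ReD ?ImD /=.
  rewrite -deriveD.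
  - by congr ('D_v _ x); apply/funext => y; rewrite big_cons ReD.
  - by have [] := derivative_trig (c i) v x (lin i).
  - exact: Csmooth_derivable.
rewrite -deriveD.
- by congr ('D_v _ x); apply/funext => y; rewrite big_cons ImD.
- rewrite (_ : (fun y => _) = fun y => Im (\sum_(j <- [:: i]) c j * ex (l j y))).
    exact: Csmooth_derivable.
  by apply/funext => y; rewrite big_seq1.
- exact: Csmooth_derivable.
Qed.

End NiceSmooth.

(** * Spinor fields and their Fourier coefficients *)

Section Equivariance.
Variables (R : realType) (k : nat) (M : CHD R k).
Local Notation n := k.*2.+1.
Local Notation V := 'cV[R]_n.
Local Notation C := (CC R).
Local Notation W := (spinor R k).
Local Notation a := (chd_a M).
Local Notation A := (chd_A M).
Local Notation g := (chd_g M).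
Implicit Types (phi : V -> W) (x v : V) (w : W).

Lemma Gamma_unit t : Gamma M t -> t.1 \in unitmx.
Proof.
elim=> [|j _||t1 t2 _ u1 _ u2|t1 _ u1] /=; rewrite ?unitmx1 ?A_unit //.
  by rewrite unitmx_mul u1.
by rewrite unitmx_inv.
Qed.

Lemma aff_appK t x : t.1 \in unitmx -> aff_app (aff_inv t) (aff_app t x) = x.
Proof. by move=> u; rewrite /aff_app /= mulmxDr mulKmx // addrK. Qed.

Lemma aff_appVK t x : t.1 \in unitmx -> aff_app t (aff_app (aff_inv t) x) = x.
Proof. by move=> u; rewrite /aff_app /= mulmxDr mulmxN !mulKVmx // subrK. Qed.

Lemma aff_app_comp t1 t2 x : aff_app (aff_comp t1 t2) x = aff_app t1 (aff_app t2 x).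
Proof. by rewrite /aff_app /= mulmxDr mulmxA addrA. Qed.

Lemma aff_app_translation v x : aff_app (translation v) x = x + v.
Proof. by rewrite /aff_app /= mul1mx. Qed.

Variables (y : clifford R n) (h : affine R k -> clifford R n).
Hypotheses (k0 : (0 < k)%N) (Hh : spin_structure M y h).

Lemma Gamma_ai i : i != ord_max -> Gamma M (translation (a i)) /\ h (translation (a i)) = 1.
Proof.
move=> im; have [_ _ h1 _ _] := Hh; rewrite (ixE i).
have ij : (1 <= i.+1 < n)%N.
  rewrite /= ltnS ltn_neqAle -ltnS ltn_ord andbT; apply: contraNneq im => e.
  by apply/eqP/val_inj.
by split; [exact: Gamma_a|exact: h1].
Qed.

(** Multiplicativity gives h(id) = h(id) h(a_1) = h(id a_1) = h(a_1) = 1; a translation a_1 with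
    known image exists because k > 0. *)
Lemma h_id : h (aff_id R k) = 1.
Proof.
have [_ hM _ _ _] := Hh; have i0 : (ord0 : 'I_n) != ord_max by rewrite -val_eqE /= eq_sym -lt0n double_gt0.
have [Ga ha] := Gamma_ai i0.
have := hM _ _ (Gamma_id M) Ga; rewrite ha mulr1 => <-.
by rewrite -[RHS]ha; congr h; rewrite /aff_comp /= mul1mx mul1mx addr0.
Qed.

Lemma field_equivariant phi : spinor_field M h phi ->
  forall t, Gamma M t -> forall x, phi (aff_app t x) = cl_act (h t) (phi x).
Proof.
move=> [_ inv] t Gt x; rewrite -[LHS](inv t Gt) aff_appK //; exact: Gamma_unit.
Qed.

Lemma field_translation phi i x : spinor_field M h phi -> i != ord_max -> phi (x + a i) = phi x.
Proof.
move=> fp im; have [Ga ha] := Gamma_ai im.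
by rewrite -aff_app_translation (field_equivariant fp Ga) ha cl_act1.
Qed.

Lemma field_rotation phi x : spinor_field M h phi ->
  phi (A *m x + n%:R^-1 *: a ord_max) = cl_act y (phi x).
Proof.
move=> fp; have [_ _ _ hg _] := Hh.
by have := field_equivariant fp (Gamma_g M) x; rewrite hg /aff_app /= ix_last.
Qed.

Lemma spinor_field_intro phi : smooth phi ->
  (forall i x, i != ord_max -> phi (x + a i) = phi x) ->
  (forall x, phi (A *m x + n%:R^-1 *: a ord_max) = cl_act y (phi x)) -> spinor_field M h phi.
Proof.
move=> sm ht hr; have [_ hM h1 hg _] := Hh.
suff eq t : Gamma M t -> forall x, phi (aff_app t x) = cl_act (h t) (phi x).
  by split=> // t Gt x; rewrite -eq // aff_appVK //; exact: Gamma_unit.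
elim=> [x|j jn x|x|t1 t2 G1 IH1 G2 IH2 x|t1 G1 IH x].
- by rewrite h_id cl_act1 /aff_app /= mul1mx addr0.
- rewrite aff_app_translation h1 // cl_act1 ht //.
  case/andP: jn => j1 jn; rewrite -val_eqE /= ix_val ?j1 1?ltnW //=.
  by rewrite neq_ltn -ltnS prednK // jn.
- by rewrite hg -hr /aff_app /= ix_last.
- by rewrite aff_app_comp IH1 IH2 -cl_actM -hM.
set z := aff_app _ x; have u1 := Gamma_unit G1.
have -> : x = aff_app t1 z by rewrite aff_appVK.
rewrite IH -cl_actM -hM //; last exact: Gamma_inv.
rewrite (_ : aff_comp (aff_inv t1) t1 = aff_id R k) ?h_id ?cl_act1 //.
by rewrite /aff_comp /= mulVmx // addrN.
Qed.

Lemma rotation_iter (m : nat) x :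
  iter m (fun z => A *m z + n%:R^-1 *: a ord_max) x = iter m (mulmx A) x + (m%:R / n%:R) *: a ord_max.
Proof.
elim: m x => [|m IH] x /=; first by rewrite mul0r scale0r addr0.
rewrite IH mulmxDr -scalemxAr -(ix_last k) chd_A_last -addrA -scalerDl.
by rewrite -[m.+1%:R]natr1 [in RHS]mulrDl mul1r.
Qed.

Variable delta : R.
Hypothesis y_pow : forall w, iter n (cl_act y) w = ex delta *: w.

(** The n-th power of g is the translation by a_n, because A^n = 1 and g translates by a_n / n along
    the axis; its image acts as y^n. *)
Lemma field_last phi x : spinor_field M h phi -> phi (x + a ord_max) = ex delta *: phi x.
Proof.
move=> fp; rewrite -y_pow.
have <- : iter n (fun z => A *m z + n%:R^-1 *: a ord_max) x = x + a ord_max.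
  by rewrite rotation_iter A_pow_n divff ?pnatr_eq0 // scale1r.
suff H m : phi (iter m (fun z => A *m z + n%:R^-1 *: a ord_max) x) = iter m (cl_act y) (phi x) by [].
elim: m => [//|m IH]; rewrite iterS [RHS]iterS -IH; exact: field_rotation.
Qed.

(* A field is multiplied by e^(2 pi i del) under the translation a_i. *)
Definition del (i : 'I_n) : R := if i == ord_max then delta else 0.

Lemma field_period phi i x : spinor_field M h phi -> phi (x + a i) = ex (del i) *: phi x.
Proof.
move=> fp; rewrite /del; case: eqVneq => [->|im]; first exact: field_last.
by rewrite field_translation // ex0 scale1r.
Qed.

Lemma nice_field phi I : (delta = 0 \/ delta = 1 / 2) -> spinor_field M h phi ->
  nice a del (fun x => phi x I) (fun v x => spinor_derive v phi x I).
Proof.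
move=> d01 fp; have [sm _] := fp.
have -> : (fun v x => spinor_derive v phi x I) = (fun v x => cdir v (fun z => phi z I) x).
  by apply/funext => v; apply/funext => x; rewrite /spinor_derive ffunE.
pose s (i : 'I_n) : R := if (i == ord_max) && (delta != 0) then -1 else 1.
apply: (@nice_smooth _ _ _ _ s) => //.
- exact: a_expand.
- move=> i; rewrite /s /del; case: eqVneq => _ /=; last by rewrite normr1 ex0.
  case: d01 => ->; first by rewrite eqxx normr1 ex0.
  have -> : (1 / 2 != 0 :> R) by rewrite mul1r invr_eq0 pnatr_eq0.
  split; first by rewrite normrN1.
  apply: ReIm_eq; rewrite ?Re_ex ?Im_ex (_ : 2 * pi * (1 / 2) = pi); try by field.
    by rewrite cospi.
  by rewrite sinpi.
- by move=> m; have [] := sm m I.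
- by move=> m; have [] := sm m I.
- by move=> i x; rewrite field_period // spZE.
Qed.

End Equivariance.

(** * Dimensions of subspaces given by predicates and parametrizations *)

Section Dimensions.
Variables (F : fieldType) (vT wT : vectType F).
Implicit Types (U : {vspace wT}) (f : vT -> wT).

(** A subspace of maximal dimension inside P is all of P, since a further vector of P would enlarge
    it by a line. *)
Lemma closed_vspace (P : wT -> Prop) : P 0 -> (forall c u v, P u -> P v -> P (c *: u + v)) ->
  exists U, forall v, v \in U <-> P v.
Proof.
move=> P0 PD; pose good m := `[< exists2 U, \dim U = m & forall v, v \in U -> P v >].
have ex0 : exists m, good m.
  exists 0%N; apply/asboolP; exists 0%VS; first exact: dimv0.
  by move=> v; rewrite memv0 => /eqP ->.
have ub m : good m -> (m <= \dim {:wT})%N.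
  by move=> /asboolP [U <- _]; apply: dimvS; exact: subvf.
have [m /asboolP [U dU PU] maxm] := ex_maxnP ex0 ub.
exists U => v; split; first exact: PU.
move=> Pv; apply: contrapT => /negP vU.
have : good (\dim (U + <[v]>)).
  apply/asboolP; exists (U + <[v]>)%VS => // w /memv_addP [u uU [t /vlineP [c ->] ->]].
  by rewrite addrC; apply: PD => //; exact: PU.
move=> /maxm; rewrite -dU leqNgt => /negP; apply; rewrite ltn_neqAle dimvS ?addvSl // andbT.
apply: contra vU => e; have /eqP -> : (U == U + <[v]>)%VS by rewrite eqEdim addvSl /= (eqP e).
by apply/memv_addP; exists 0; [exact: mem0v|exists v; [exact: memv_line|rewrite add0r]].
Qed.

Definition linear_fun f := forall c u v, f (c *: u + v) = c *: f u + f v.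

Lemma linear_ext f : linear_fun f -> exists h : 'Hom(vT, wT), forall v, h v = f v.
Proof.
move=> lf; pose fL := GRing.isLinear.Build F vT wT *:%R f lf.
pose fl : {linear vT -> wT} := HB.pack f fL.
by exists (linfun fl) => v; rewrite lfunE.
Qed.

Lemma dim_param U f : linear_fun f -> (forall v, f v = 0 -> v = 0) ->
  (forall w, w \in U <-> exists v, w = f v) -> \dim U = \dim {:vT}.
Proof.
move=> /linear_ext [h hf] inj HU.
have -> : U = limg h.
  apply/vspaceP => w; apply/idP/memv_imgP => [/HU [v ->]|[v _ ->]].
    by exists v; rewrite ?memvf // hf.
  by apply/HU; exists v; rewrite hf.
apply: limg_dim_eq; apply/eqP; rewrite -subv0; apply/subvP => v.
by rewrite memv_cap memv_ker hf => /andP[_ /eqP /inj ->]; exact: mem0v.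
Qed.

Lemma dim_le_inj (U1 : {vspace vT}) U2 f : linear_fun f -> (forall v, v \in U1 -> f v \in U2) ->
  (forall v, v \in U1 -> f v = 0 -> v = 0) -> (\dim U1 <= \dim U2)%N.
Proof.
move=> /linear_ext [h hf] sub inj.
have <- : \dim (h @: U1) = \dim U1.
  apply: limg_dim_eq; apply/eqP; rewrite -subv0; apply/subvP => v.
  by rewrite memv_cap memv_ker hf => /andP[vU /eqP /(inj v vU) ->]; exact: mem0v.
by apply: dimvS; apply/subvP => w /memv_imgP [v vU ->]; rewrite hf; exact: sub.
Qed.

End Dimensions.

Lemma has_dim_param (R : realType) (k : nat) (wT : vectType (CC R)) (U : {vspace wT})
    (E : set ('cV[R]_k.*2.+1 -> spinor R k)) (Phi : wT -> 'cV[R]_k.*2.+1 -> spinor R k) :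
  (forall c u v x, Phi (c *: u + v) x = c *: Phi u x + Phi v x) ->
  (forall u, u \in U -> (forall x, Phi u x = 0) -> u = 0) ->
  (forall phi, E phi <-> exists2 u, u \in U & phi = Phi u) -> has_dim E (\dim U).
Proof.
move=> lin inj EU; pose b := vbasis U.
have Phi0 x : Phi 0 x = 0.
  by have := lin (-1) 0 0 x; rewrite scaler0 add0r scaleN1r addNr.
have Phi_sum (c : 'rV[CC R]_(\dim U)) (r : seq 'I_(\dim U)) x :
    Phi (\sum_(i <- r) c 0 i *: b`_i) x = \sum_(i <- r) c 0 i *: Phi b`_i x.
  by elim: r => [|i r IH]; rewrite ?big_nil ?big_cons // lin IH.
have bU (i : 'I_(\dim U)) : b`_i \in U by apply: vbasis_mem; apply: mem_nth; rewrite size_tuple.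
exists (fun i => Phi b`_i); split=> [i|phi /EU [u uU ->]]; first by apply/EU; exists b`_i.
have ub : u \in <<b>>%VS by rewrite (span_basis (vbasisP U)).
exists (\row_i coord b i u); split.
  move=> x; rewrite {1}(coord_span ub) -[RHS]Phi_sum; congr Phi.
  by apply: eq_bigr => i _; rewrite mxE.
move=> c Hc; apply/rowP => i; rewrite mxE.
pose u' := \sum_i c 0 i *: b`_i.
have u'U : u' \in U by apply: memv_suml => j _; apply: memvZ.
have : u - u' = 0.
  apply: inj; first exact: memvB.
  by move=> x; rewrite -scaleN1r addrC lin Hc Phi_sum scaleN1r addNr.
move/eqP; rewrite subr_eq0 => /eqP ->; rewrite coord_sum_free //.
exact: basis_free (vbasisP U).
Qed.

(** * Fourier coefficients of an eigenspinor *)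

Section Coefficients.
Variables (R : realType) (k : nat) (M : CHD R k).
Local Notation n := k.*2.+1.
Local Notation V := 'cV[R]_n.
Local Notation C := (CC R).
Local Notation W := (spinor R k).
Local Notation a := (chd_a M).
Local Notation e := (chd_e M).
Local Notation A := (chd_A M).
Implicit Types (phi : V -> W) (x v : V) (w : W) (th : 'rV[R]_n).

Lemma row_with_values (m : 'I_n -> R) : exists th, forall i, (th *m a i) 0 0 = m i.
Proof.
have [B HB] : exists B : 'I_n -> 'I_n -> R, forall r, delta_mx r 0 = \sum_i B r i *: a i :> V.
  by have /choice [B HB] := fun r => a_expand M (delta_mx r 0); exists B.
pose Am : 'M[R]_n := \matrix_(r, i) a i r 0.
pose Bm : 'M[R]_n := \matrix_(i, r) B r i.
have AB : Am *m Bm = 1%:M.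
  apply/matrixP => r s; rewrite !mxE.
  have /matrixP/(_ r 0) := HB s; rewrite summxE !mxE eqxx andbT => ->.
  by apply: eq_bigr => i _; rewrite !mxE mulrC.
exists (\row_i m i *m Bm) => i.
have -> : a i = Am *m delta_mx i 0.
  apply/colP => r; rewrite !mxE (bigD1 i) //= big1 => [|j /negPf ji].
    by rewrite !mxE !eqxx mulr1 addr0.
  by rewrite !mxE ji mulr0.
rewrite -mulmxA (mulmxA Bm) (mulmx1C AB) mul1mx !mxE (bigD1 i) //= big1 => [|j /negPf ji].
  by rewrite !mxE !eqxx mulr1 addr0.
by rewrite !mxE ji mulr0.
Qed.

(** 2 pi i times this operator is the effect of D on the coefficient of e^(2 pi i th(x)). *)
Definition symbol th w : W := \sum_i ((th *m e i) 0 0)%:C *: gamma i w.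

Lemma symbolE th w : symbol th w = cl_act (cl_vec M (uvec M th)) w.
Proof.
rewrite /cl_vec cl_act_suml; apply: eq_bigr => i _.
by rewrite cl_actZl cl_act_gen uvecE.
Qed.

Lemma symbol_sq th w : symbol th (symbol th w) = - (Nth M th)%:C *: w.
Proof.
rewrite !symbolE -cl_actM.
have := cl_vec_anti M (uvec M th) (uvec M th).
rewrite -mulr2n -scaler_nat -/(Nth M th) -mulrN -scalerA => /(scalerI _) -> //.
by rewrite cl_actZl cl_act1 rmorphN.
Qed.

Lemma symbolZ th (c : C) w : symbol th (c *: w) = c *: symbol th w.
Proof. by rewrite !symbolE cl_actZr. Qed.

Lemma symbol_eigen_sq th (c l : C) w : c *: symbol th w = l *: w ->
  (c ^+ 2 * - (Nth M th)%:C) *: w = l ^+ 2 *: w.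
Proof.
move=> h; have := congr1 (fun u => c *: symbol th u) h.
by rewrite !symbolZ symbol_sq !scalerA mulrC [c * l]mulrC -[(l * c) *: _]scalerA h scalerA -!expr2.
Qed.

Lemma two_pi_i_sq (r : R) : ('i * (2 * pi)%:C) ^+ 2 * - r%:C = (4 * pi ^+ 2 * r)%:C :> C.
Proof.
rewrite exprMn expr2 ii mulN1r mulrNN expr2 -!(rmorphM (real_complex R)); congr (_%:C); ring.
Qed.

Lemma rowD th u v : (th *m (u + v)) 0 0 = (th *m u) 0 0 + (th *m v) 0 0.
Proof. by rewrite mulmxDr mxE. Qed.

Lemma rowZ th (c : R) v : (th *m (c *: v)) 0 0 = c * (th *m v) 0 0.
Proof. by rewrite -scalemxAr mxE. Qed.

Lemma row_linear th : linear_form (fun x : V => (th *m x) 0 0).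
Proof. by split=> *; rewrite ?rowD ?rowZ. Qed.

Lemma row_ext th th' : (forall i, (th *m a i) 0 0 = (th' *m a i) 0 0) -> th = th'.
Proof.
move=> H; apply/rowP => r; have E (t : 'rV[R]_n) : t 0 r = (t *m delta_mx r (0 : 'I_1)) 0 0.
  by rewrite -colE mxE.
rewrite !E; have [t ->] := a_expand M (delta_mx r 0); rewrite !mulmx_sumr !summxE.
by apply: eq_bigr => i _; rewrite !rowZ H.
Qed.

Section SpinorProjection.
Variables (th : 'I_n -> R).

Definition sproj phi x : W := [ffun I : {ffun 'I_k -> 'I_2} => projs a (enum 'I_n) th (fun z => phi z I) x].

Definition sbounded phi := forall I, cbounded (fun z => phi z I).

Definition linop (L : W -> W) :=
  (forall w w', L (w + w') = L w + L w') /\ (forall c w, L (c *: w) = c *: L w).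

(** Fourier projections act on coordinates; a linear operator on spinors commutes with them through
    its matrix coefficients. *)
Lemma linear_coord (L : W -> W) w I : linop L ->
  L w I = \sum_J L [ffun K => (K == J)%:R] I * w J.
Proof.
move=> [LD LZ]; have L0 : L 0 = 0 by have := LZ 0 0; rewrite !scale0r.
have {1}-> : w = \sum_J w J *: ([ffun K => (K == J)%:R] : W).
  apply/spinorP => I0; rewrite sp_sumE (bigD1 I0) //= big1 => [|J /negPf J0].
    by rewrite spZE ffunE eqxx mulr1 addr0.
  by rewrite spZE ffunE eq_sym J0 mulr0.
rewrite (big_morph L LD L0) sp_sumE; apply: eq_bigr => J _.
by rewrite LZ spZE mulrC.
Qed.

Lemma sproj_linear (L : W -> W) phi x : linop L -> sbounded phi ->
  sproj (fun z => L (phi z)) x = L (sproj phi x).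
Proof.
move=> LL bp; apply/spinorP => I; rewrite ffunE (linear_coord _ _ LL).
rewrite (_ : (fun z => _) = fun z => \sum_J L [ffun K => (K == J)%:R] I * phi z J); last first.
  by apply/funext => z; exact: linear_coord.
rewrite projs_sum; last by move=> J; apply: boundedZ; exact: (bp J).
by apply: eq_bigr => J _; rewrite projsZ // ffunE.
Qed.

Lemma sproj_scale (c : C) phi x : sbounded phi -> sproj (fun z => c *: phi z) x = c *: sproj phi x.
Proof.
move=> bp; apply/spinorP => I; rewrite spZE !ffunE.
rewrite (_ : (fun z => _) = fun z => c * phi z I); last by apply/funext => z; rewrite spZE.
by rewrite projsZ //; exact: bp.
Qed.

Lemma sproj_sum (J : Type) (r : seq J) (psi : J -> V -> W) x : (forall j, sbounded (psi j)) ->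
  sproj (fun z => \sum_(j <- r) psi j z) x = \sum_(j <- r) sproj (psi j) x.
Proof.
move=> bp; apply/spinorP => I; rewrite ffunE sp_sumE.
rewrite (_ : (fun z => _) = fun z => \sum_(j <- r) psi j z I); last first.
  by apply/funext => z; rewrite sp_sumE.
rewrite projs_sum; last by move=> j; exact: (bp j I).
by apply: eq_bigr => j _; rewrite ffunE.
Qed.

Lemma sbounded_linear (L : W -> W) phi : linop L -> sbounded phi -> sbounded (fun z => L (phi z)).
Proof.
move=> LL bp I.
rewrite (_ : (fun z => _) = fun z => \sum_J L [ffun K => (K == J)%:R] I * phi z J); last first.
  by apply/funext => z; exact: linear_coord.
by apply: bounded_fsum => J; apply: boundedZ; exact: (bp J).
Qed.

Variable delta : 'I_n -> R.
Hypothesis adm : admissible delta th.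

Variables (phi : V -> W) (l : R).
Hypotheses (np : forall I, nice a delta (fun x => phi x I) (fun v x => spinor_derive v phi x I))
  (eigen : forall x, dirac_op M phi x = l%:C *: phi x).
Variable row : 'rV[R]_n.
Hypothesis rowE : forall i, (row *m a i) 0 0 = th i.

(** Both sides are linear in v, and on the basis [a] this is [projs_derivative]. *)
Lemma sproj_derive v x : sproj (spinor_derive v phi) x = 'i * (2 * pi * (row *m v) 0 0)%:C *: sproj phi x.
Proof.
apply/spinorP => I; rewrite spZE !ffunE.
have [_ _ _ nD nZ _] := nice_projs (enum 'I_n) th (np I).
pose G (u : V) := projs a (enum 'I_n) th (fun z => spinor_derive u phi z I) x.
pose H (u : V) : C := 'i * (2 * pi * (row *m u) 0 0)%:C * projs a (enum 'I_n) th (fun z => phi z I) x.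
suff : G v = H v by [].
have {}nD u u' : G (u + u') = G u + G u' by exact: nD.
have {}nZ c u : G (c *: u) = c%:C * G u by exact: nZ.
have HD u u' : H (u + u') = H u + H u'.
  by rewrite /H rowD mulrDr (rmorphD (real_complex R)) mulrDr mulrDl.
have HZ c u : H (c *: u) = c%:C * H u.
  by rewrite /H rowZ [RHS]mulrA; congr (_ * _); rewrite [RHS]mulrC mul_iR; congr ('i * _%:C); ring.
have Ga i : G (a i) = H (a i).
  by rewrite /G /H rowE; rewrite (projs_derivative adm (np I)) ?mem_enum.
have [t ->] := a_expand M v.
elim/big_rec: _ => [|i u _ IH]; last by rewrite nD HD IH nZ HZ Ga.
by have := nZ 0 0; have := HZ 0 0; rewrite !scale0r !mul0r => -> ->.
Qed.

Lemma sproj_eigen x : ('i * (2 * pi)%:C) *: symbol row (sproj phi x) = l%:C *: sproj phi x.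
Proof.
have bp : sbounded phi by move=> I; exact: (nice_bound (np I)).
have bd v : sbounded (spinor_derive v phi) by move=> I; exact: (nice_dbound (np I) v).
have gL i : linop (@gamma R k i) by split=> *; rewrite ?gammaD ?gammaZ.
have <- : sproj (fun z => l%:C *: phi z) x = l%:C *: sproj phi x.
  exact: sproj_scale.
have -> : (fun z => l%:C *: phi z) = (fun z => \sum_i gamma i (spinor_derive (e i) phi z)).
  by apply/funext => z; rewrite -eigen.
rewrite sproj_sum; last by move=> i; apply: sbounded_linear.
rewrite /symbol scaler_sumr; apply: eq_bigr => i _.
rewrite sproj_linear // sproj_derive gammaZ !scalerA; congr (_ *: _).
exact: mul_iR.
Qed.

(** The symbol squares to - |th|^2, so a nonzero coefficient forces 4 pi^2 |th|^2 = l^2. *)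
Lemma sproj_vanish x : 4 * pi ^+ 2 * Nth M row != l ^+ 2 -> sproj phi x = 0.
Proof.
move=> ne; have := symbol_eigen_sq (sproj_eigen x).
rewrite two_pi_i_sq -rmorphXn => /eqP; rewrite -subr_eq0 -scalerBl scaler_eq0 => /orP[|/eqP //].
by rewrite -rmorphB fmorph_eq0 subr_eq0 (negPf ne).
Qed.

Lemma sproj_exp x : sproj phi x = ex ((row *m x) 0 0) *: sproj phi 0.
Proof.
apply/spinorP => I; rewrite spZE !ffunE.
apply: (exponential_ode (row_linear row) (nice_projs (enum 'I_n) th (np I))) => v z.
by have /(congr1 (fun w : W => w I)) := sproj_derive v z; rewrite spZE !ffunE.
Qed.

End SpinorProjection.
End Coefficients.

(** * Eigenspinors as finite sums of characters *)

Section Spectrum.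
Variables (R : realType) (k : nat) (M : CHD R k).
Local Notation n := k.*2.+1.
Local Notation V := 'cV[R]_n.
Local Notation C := (CC R).
Local Notation W := (spinor R k).
Local Notation a := (chd_a M).
Local Notation e := (chd_e M).
Local Notation A := (chd_A M).
Implicit Types (phi : V -> W) (x v : V) (w : W) (th : 'rV[R]_n).

Variables (y : clifford R n) (h : affine R k -> clifford R n) (delta : R).
Hypotheses (k0 : (0 < k)%N) (Hh : spin_structure M y h)
  (y_pow : forall w, iter n (cl_act y) w = ex delta *: w)
  (d01 : delta = 0 \/ delta = 1 / 2).

Definition character th := forall i, (th *m a i) 0 0 - del delta i \is a Num.int.

(** A maps a_1, ..., a_(n-1) to integral combinations of themselves and fixes a_n. *)
Lemma character_A th : character th -> character (th *m A).
Proof.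
move=> ch i; rewrite -mulmxA; have [->|im] := eqVneq i ord_max.
  by rewrite -{1}(ix_last k) chd_A_last ix_last; exact: ch.
have d0 (j : 'I_n) : j != ord_max -> (th *m a j) 0 0 \is a Num.int.
  by move=> jm; have := ch j; rewrite /del (negPf jm) subr0.
rewrite /del (negPf im) subr0 (ixE i).
have ij : (i.+1 < n)%N.
  rewrite ltnS ltn_neqAle -ltnS ltn_ord andbT; apply: contraNneq im => ei.
  by apply/eqP/val_inj.
have ne (j : nat) : (1 <= j < n)%N -> ix k j != ord_max.
  move=> /andP[j1 jn]; rewrite -val_eqE /= ix_val ?j1 1?ltnW //=.
  by rewrite neq_ltn -ltnS prednK // jn.
have [lt|] := ltnP i.+1 n.-1; first by rewrite chd_A_shift ?lt //; apply/d0/ne.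
rewrite /= => ge; have -> : i.+1 = n.-1 by apply/eqP; rewrite /= eqn_leq ge -ltnS ij.
rewrite chd_A_wrap // mulmxN mxE rpredN mulmx_sumr summxE.
by rewrite big_nat; apply: rpred_sum => j jn; apply/d0/ne.
Qed.

(** [T] enumerates without repetition the characters with 4 pi^2 |th|^2 = q, the only ones that
    occur when l^2 = q. *)
Variables (T : finType) (rw : T -> 'rV[R]_n) (q : R).
Hypotheses (rw_inj : injective rw) (T_char : forall t, character (rw t))
  (T_norm : forall t, 4 * pi ^+ 2 * Nth M (rw t) = q)
  (T_all : forall th, character th -> 4 * pi ^+ 2 * Nth M th = q -> exists t, rw t = th).

Lemma T_shift t : exists u, rw u = rw t *m A.
Proof. by apply: T_all; rewrite ?NthA //; exact: character_A. Qed.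

Definition tA t : T := sval (cid (T_shift t)).
Lemma tAE t : rw (tA t) = rw t *m A. Proof. exact: svalP (cid (T_shift t)). Qed.

Lemma tA_inj : injective tA.
Proof.
move=> t u /(congr1 rw); rewrite !tAE => /(congr1 (mulmx^~ (invmx A))).
by rewrite !mulmxK ?A_unit // => /rw_inj.
Qed.

Local Notation X := {ffun T -> W}.

Definition synth (c : X) x : W := \sum_t ex ((rw t *m x) 0 0) *: c t.

(** The second condition is invariance under g, read on the coefficient of e^(2 pi i th(A x)); the
    translation part a_n / n contributes e^(2 pi i th(a_n) / n). *)
Definition coef_eigen (l : R) (c : X) :=
  (forall t, ('i * (2 * pi)%:C) *: symbol M (rw t) (c t) = l%:C *: c t) /\
  (forall t, cl_act y (c (tA t)) = ex (sth M (rw t) / n%:R) *: c t).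

Lemma synth_linear (b : C) c d x : synth (b *: c + d) x = b *: synth c x + synth d x.
Proof.
rewrite /synth scaler_sumr -big_split; apply: eq_bigr => t _ /=.
by rewrite ffunE ffunE scalerDr !scalerA mulrC.
Qed.

Lemma synth_coord c x I : synth c x I = \sum_t c t I * ex ((rw t *m x) 0 0).
Proof. by rewrite sp_sumE; apply: eq_bigr => t _; rewrite spZE mulrC. Qed.

Lemma rw_sep t u : t \in index_enum T -> u \in index_enum T ->
  (forall i, (rw t *m a i) 0 0 = (rw u *m a i) 0 0) -> t = u.
Proof. by move=> _ _ /row_ext /rw_inj. Qed.

Lemma rw_indep (b : T -> C) : (forall x, \sum_t b t * ex ((rw t *m x) 0 0) = 0) -> forall t, b t = 0.
Proof.
move=> H t; apply: (@characters_independent _ _ _ a (del delta) _ (index_enum T)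
  (fun t x => (rw t *m x) 0 0)) => //.
- exact: index_enum_uniq.
- by move=> u; exact: row_linear.
- exact: rw_sep.
Qed.

Lemma synth_inj c : (forall x, synth c x = 0) -> c = 0.
Proof.
move=> H; apply/ffunP => t; rewrite ffunE; apply/spinorP => I; rewrite [RHS]ffunE.
apply: (rw_indep (b := fun t => c t I)) => x.
by rewrite -synth_coord H ffunE.
Qed.

Lemma synth_smooth c : smooth (synth c).
Proof.
move=> m I; have := Csmooth_trig_sum (fun t => c t I) (fun t => row_linear (rw t)) (index_enum T).
move=> [h1 h2]; split.
  by rewrite (_ : (fun x => _) = fun x => Re (\sum_t c t I * ex ((rw t *m x) 0 0))) //;
    apply/funext => x; rewrite synth_coord.
by rewrite (_ : (fun x => _) = fun x => Im (\sum_t c t I * ex ((rw t *m x) 0 0))) //;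
  apply/funext => x; rewrite synth_coord.
Qed.

Lemma synth_derive c v x : spinor_derive v (synth c) x =
  \sum_t ex ((rw t *m x) 0 0) *: (('i * (2 * pi * (rw t *m v) 0 0)%:C) *: c t).
Proof.
apply/spinorP => I; rewrite ffunE.
have E : (fun x => synth c x I) = (fun x => \sum_t c t I * ex ((rw t *m x) 0 0)).
  by apply/funext => z; exact: synth_coord.
rewrite -/(cdir v (fun z => synth c z I) x) E cdir_trig_sum; last by move=> t; exact: row_linear.
rewrite sp_sumE; apply: eq_bigr => t _; rewrite spZE spZE; ring.
Qed.

Lemma synth_dirac c x : dirac_op M (synth c) x =
  \sum_t ex ((rw t *m x) 0 0) *: (('i * (2 * pi)%:C) *: symbol M (rw t) (c t)).
Proof.
rewrite /dirac_op; under eq_bigr do rewrite synth_derive gamma_sum.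
rewrite exchange_big /=; apply: eq_bigr => t _.
rewrite /symbol !scaler_sumr; apply: eq_bigr => i _.
by rewrite !gammaZ; congr (_ *: _); rewrite scalerA mul_iR.
Qed.

Lemma synth_rotation c x : synth c (A *m x + n%:R^-1 *: a ord_max) =
  \sum_t ex ((rw (tA t) *m x) 0 0) *: (ex (sth M (rw t) / n%:R) *: c t).
Proof.
apply: eq_bigr => t _; rewrite scalerA -exD tAE rowD rowZ mulmxA.
by rewrite /sth -(ix_last k) chd_e_last [_ / _]mulrC.
Qed.

Lemma synth_y c x : cl_act y (synth c x) =
  \sum_t ex ((rw (tA t) *m x) 0 0) *: cl_act y (c (tA t)).
Proof.
rewrite cl_act_sumr (reindex_inj tA_inj) /=; apply: eq_bigr => t _.
by rewrite cl_actZr.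
Qed.

Lemma synth_eigen l c : coef_eigen l c -> eigenspinors M h l (synth c).
Proof.
move=> [cD cy]; split; last first.
  move=> x; rewrite synth_dirac scaler_sumr; apply: eq_bigr => t _.
  by rewrite cD !scalerA mulrC.
apply: (spinor_field_intro k0 Hh); first exact: synth_smooth.
  move=> i x im; apply: eq_bigr => t _; rewrite rowD exD.
  by have := T_char t i; rewrite /del (negPf im) subr0 => /ex_int ->; rewrite mulr1.
by move=> x; rewrite synth_rotation synth_y; apply: eq_bigr => t _; rewrite cy.
Qed.

Lemma eigen_synth l phi : l ^+ 2 = q -> eigenspinors M h l phi ->
  exists2 c : X, coef_eigen l c & phi = synth c.
Proof.
move=> lq [fp eig].
have np I := nice_field Hh y_pow I d01 fp.
pose co t i := (rw t *m a i) 0 0.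
have adm t : admissible (del delta) (co t) by move=> i; exact: T_char.
pose c : X := [ffun t => sproj M (co t) phi 0].
have cE t : c t = sproj M (co t) phi 0 by rewrite ffunE.
have phiE : phi = synth c.
  apply/funext => x; apply/spinorP => I; rewrite synth_coord.
  have := @fourier_expansion _ _ _ a (del delta) _ (index_enum T)
    (fun t x => (rw t *m x) 0 0) (index_enum_uniq T) (fun t => row_linear (rw t)) T_char rw_sep
    _ _ (np I).
  move=> H; rewrite H; first by apply: eq_bigr => t _; rewrite cE ffunE.
  - by exists (del delta) => i; rewrite subrr.
  (* A character not in [T] has the wrong norm, so its component is zero by [sproj_vanish]. *)
  - move=> th ad ne; apply/funext => z.
    have [r Hr] := row_with_values M th.
    have chr : character r by move=> i; rewrite Hr; exact: ad.
    have [eq|neq] := eqVneq (4 * pi ^+ 2 * Nth M r) q.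
      have [t tr] := T_all chr eq.
      have [i /negP[]] := ne t (mem_index_enum t); apply/eqP.
      by rewrite -Hr tr.
    have := sproj_vanish ad np eig Hr z; rewrite lq => /(_ neq).
    by move=> /(congr1 (fun w : W => w I)); rewrite !ffunE.
  - move=> t z _; have := sproj_exp (adm t) np (fun i => erefl (co t i)) z.
    by move=> /(congr1 (fun w : W => w I)); rewrite spZE !ffunE.
exists c => //; split=> t.
  by rewrite cE; exact: (sproj_eigen (adm t) np eig (fun i => erefl (co t i)) 0).
(* The defect of invariance at the character th A. By independence of characters it vanishes; [invF]
   returns to an indexing by th. *)
pose b t : W := cl_act y (c (tA t)) - ex (sth M (rw t) / n%:R) *: c t.
suff : b t = 0 by move/eqP; rewrite subr_eq0 => /eqP.
apply/spinorP => I; rewrite [RHS]ffunE -[t](invF_f tA_inj).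
apply: (rw_indep (b := fun u => b (invF tA_inj u) I)) => x.
rewrite (reindex_inj tA_inj) /=.
have := field_rotation Hh x fp; rewrite phiE synth_rotation synth_y => E.
transitivity ((\sum_t ex ((rw (tA t) *m x) 0 0) *: b t : W) I).
  by rewrite sp_sumE; apply: eq_bigr => u _; rewrite spZE invF_f mulrC.
under eq_bigr do rewrite scalerBr; by rewrite sumrB -E subrr ffunE.
Qed.

End Spectrum.

(** * Multiplicities of eigenvalues *)

Section Multiplicity.
Variables (R : realType) (k : nat) (M : CHD R k).
Local Notation n := k.*2.+1.
Local Notation V := 'cV[R]_n.
Local Notation C := (CC R).
Local Notation W := (spinor R k).
Local Notation a := (chd_a M).
Local Notation e := (chd_e M).
Local Notation A := (chd_A M).
Local Notation index := {ffun 'I_k -> 'I_2}.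
Implicit Types (x v : V) (w : W) (th : 'rV[R]_n) (I : index).

Variables (y : clifford R n) (h : affine R k -> clifford R n) (delta : R).
Hypotheses (k0 : (0 < k)%N) (Hh : spin_structure M y h)
  (y_pow : forall w, iter n (cl_act y) w = ex delta *: w)
  (d01 : delta = 0 \/ delta = 1 / 2)
  (y_vec : forall v w, cl_act y (cl_act (cl_vec M v) w) = cl_act (cl_vec M (A *m v)) (cl_act y w)).

Variables (T : finType) (rw : T -> 'rV[R]_n) (q : R).
Hypotheses (rw_inj : injective rw) (T_char : forall t, character M delta (rw t))
  (T_norm : forall t, 4 * pi ^+ 2 * Nth M (rw t) = q)
  (T_all : forall th, character M delta th -> 4 * pi ^+ 2 * Nth M th = q -> exists t, rw t = th).

Local Notation X := {ffun T -> W}.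
Local Notation tA := (tA k0 T_char T_norm T_all).
Local Notation eigenc := (coef_eigen y k0 T_char T_norm T_all).
Implicit Types (c : X) (l : R).

Definition on_axis t := Nth M (rw t) == sth M (rw t) ^+ 2.
Definition cut (b : T -> bool) c : X := [ffun t => if b t then c t else 0].
Definition supported (b : T -> bool) c := forall t, ~~ b t -> c t = 0.

Lemma XaddE c d t : (c + d) t = c t + d t. Proof. by rewrite ffunE. Qed.
Lemma XscaleE (z : C) c t : (z *: c) t = z *: c t. Proof. by rewrite ffunE. Qed.

Lemma XlinE (z : C) c d t : (z *: c + d) t = z *: c t + d t. Proof. by rewrite XaddE XscaleE. Qed.

Lemma on_axis_A t : on_axis (tA t) = on_axis t.
Proof. by rewrite /on_axis tAE NthA sthA. Qed.

Lemma symbolD th w w' : symbol M th (w + w') = symbol M th w + symbol M th w'.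
Proof. by rewrite !symbolE cl_actDr. Qed.

Lemma symbol0 th : symbol M th 0 = 0.
Proof. by rewrite -[in LHS](scale0r (0 : W)) symbolZ scale0r. Qed.

Lemma cl_actr0 z : cl_act z 0 = 0 :> W.
Proof. by rewrite -[in LHS](scale0r (0 : W)) cl_actZr scale0r. Qed.

Lemma eigenc_linear l (b : C) c d : eigenc l c -> eigenc l d -> eigenc l (b *: c + d).
Proof.
move=> [c1 c2] [d1 d2]; split=> t; rewrite !XaddE !XscaleE.
  rewrite symbolD symbolZ [LHS]scalerDr d1 scalerA [_ * b]mulrC -scalerA c1.
  by rewrite scalerDr !scalerA [b * _]mulrC.
by rewrite cl_actDr cl_actZr c2 d2 scalerDr !scalerA [b * _]mulrC.
Qed.

Lemma eigenc0 l : eigenc l 0.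
Proof. by split=> t; rewrite !ffunE ?symbol0 ?cl_actr0 !scaler0. Qed.

Lemma eigenc_cut l b c : (forall t, b (tA t) = b t) -> eigenc l c -> eigenc l (cut b c).
Proof.
move=> bA [c1 c2]; split=> t; rewrite !ffunE ?bA; case: (b t) => //.
  by rewrite symbol0 !scaler0.
by rewrite cl_actr0 scaler0.
Qed.

Lemma supported_linear b (z : C) c d : supported b c -> supported b d -> supported b (z *: c + d).
Proof. by move=> hc hd t bt; rewrite !ffunE hc // hd // scaler0 addr0. Qed.

Lemma part_exists b l : exists U : {vspace X}, forall c, c \in U <-> eigenc l c /\ supported b c.
Proof.
apply: closed_vspace; first by split; [exact: eigenc0|move=> t _; rewrite ffunE].
by move=> z c d [c1 c2] [d1 d2]; split; [exact: eigenc_linear|exact: supported_linear].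
Qed.

Definition part b l : {vspace X} := sval (cid (part_exists b l)).
Lemma partP b l c : c \in part b l <-> eigenc l c /\ supported b c.
Proof. exact: (svalP (cid (part_exists b l))). Qed.

Definition emult l := \dim (part xpredT l).

Lemma has_dim_emult l : l ^+ 2 = q -> has_dim (eigenspinors M h l) (emult l).
Proof.
move=> lq; apply: (has_dim_param (Phi := synth rw)).
- exact: synth_linear.
- by move=> c _; exact: (synth_inj rw_inj T_char).
move=> phi; split.
  move=> /(eigen_synth k0 Hh y_pow d01 rw_inj T_char T_norm T_all lq) [c Hc ->].
  by exists c => //; apply/partP; split.
by move=> [c /partP [Hc _] ->]; exact: (synth_eigen Hh rw_inj Hc).
Qed.

(** A preserves |th| and th(e_n), so both conditions on the coefficients survive cutting a family
    into its axis part and the rest. *)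
Lemma emult_split l : emult l = (\dim (part (predC on_axis) l) + \dim (part on_axis l))%N.
Proof.
rewrite -dimv_disjoint_sum; last first.
  apply/eqP; rewrite -subv0; apply/subvP => c; rewrite memv_cap => /andP[/partP [_ h1] /partP [_ h2]].
  rewrite memv0; apply/eqP/ffunP => t; rewrite ffunE.
  by case o : (on_axis t); [apply: h1 => /=; rewrite o|apply: h2; rewrite o].
congr (\dim _); apply/vspaceP => c; apply/idP/memv_addP.
  move=> /partP [Hc _]; exists (cut (predC on_axis) c).
    apply/partP; split; first by apply: eigenc_cut => // t; rewrite /= on_axis_A.
    by move=> t /negPf bt; rewrite ffunE bt.
  exists (cut on_axis c).
    apply/partP; split; first by apply: eigenc_cut => // t; rewrite /= on_axis_A.
    by move=> t /negPf bt; rewrite ffunE bt.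
  by apply/ffunP => t; rewrite !ffunE /=; case: (on_axis t); rewrite ?add0r ?addr0.
move=> [c1 /partP [h1 _] [c2 /partP [h2 _] ->]]; apply/partP; split=> //.
by rewrite -[c1]scale1r; exact: eigenc_linear.
Qed.

(* Clifford multiplication by w anticommutes with the symbol of D: it exchanges the
   eigenvalues l and -l, and is injective off the axis. Locked, because unification
   diverges when it unfolds. *)
Definition reflectc := locked (fun c => [ffun t => cl_act (cl_vec M (wvec M (rw t))) (c t)] : X).

Lemma reflectcE c t : reflectc c t = cl_act (cl_vec M (wvec M (rw t))) (c t).
Proof. by rewrite /reflectc -lock ffunE. Qed.

Lemma reflectc_semilinear (z : C) c d : reflectc (z *: c + d) = z *: reflectc c + reflectc d.
Proof.
apply/ffunP => t.
rewrite (XlinE z (reflectc c) (reflectc d) t) (reflectcE c t) (reflectcE d t).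
by rewrite (reflectcE (z *: c + d) t) (XlinE z c d t) cl_actDr cl_actZr.
Qed.

Lemma reflectc_linear : linear_fun reflectc.
Proof. exact: reflectc_semilinear. Qed.

Lemma reflectc_eigen l c : eigenc l c -> eigenc (- l) (reflectc c).
Proof.
move=> [c1 c2]; split=> t; rewrite !reflectcE.
  rewrite symbolE -cl_actM.
  have := cl_vec_anti M (uvec M (rw t)) (wvec M (rw t)).
  rewrite dotC wvec_dot_u mulr0 oppr0 scale0r => /eqP; rewrite addr_eq0 => /eqP ->.
  rewrite cl_actNl cl_actM scalerN -cl_actZr -symbolE c1 cl_actZr.
  by rewrite rmorphN scaleNr.
by rewrite tAE y_vec wvecA c2 cl_actZr.
Qed.

(** The vector acts with square - |th|^2 (|th|^2 - th(e_n)^2); off the axis neither factor is 0,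
    because |th| = 0 forces th(e_n) = 0. *)
Lemma reflectc_inj t w : ~~ on_axis t -> cl_act (cl_vec M (wvec M (rw t))) w = 0 -> w = 0.
Proof.
rewrite /on_axis => ax w0.
have := cl_vec_anti M (wvec M (rw t)) (wvec M (rw t)).
rewrite -mulr2n -scaler_nat -mulrN -scalerA => /(scalerI _) => /(_ _) E.
have {}E : cl_vec M (wvec M (rw t)) * cl_vec M (wvec M (rw t)) = (- chd_dot M (wvec M (rw t)) (wvec M (rw t))) *: 1.
  by apply: E; rewrite pnatr_eq0.
have := congr1 (fun z => cl_act z w) E; rewrite cl_actM w0 cl_actr0 cl_actZl cl_act1.
move/esym/eqP; rewrite scaler_eq0 => /orP[|/eqP //].
rewrite fmorph_eq0 oppr_eq0 wvec_norm mulf_eq0 subr_eq0 (negPf ax) orbF => /eqP N0.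
case/negP: ax; have := cauchy_schwarz M (uvec M (rw t)) (e ord_max).
rewrite uvec_dot -/(sth M (rw t)) -/(Nth M (rw t)) N0 mul0r => s0.
by rewrite eq_le s0 sqr_ge0.
Qed.

Lemma part_off_le l : (\dim (part (predC on_axis) l) <= \dim (part (predC on_axis) (- l)))%N.
Proof.
apply: (dim_le_inj reflectc_linear).
  move=> c /partP [h1 h2]; apply/partP; split; first exact: reflectc_eigen.
  by move=> t ht; rewrite reflectcE h2 // cl_actr0.
move=> c /partP [h1 h2] J0; apply/ffunP => t; rewrite [RHS]ffunE.
have [on|off] := boolP (on_axis t); first by apply: h2; rewrite /= on.
apply: (reflectc_inj off); by rewrite -reflectcE J0 ffunE.
Qed.

Lemma part_off_opp l : \dim (part (predC on_axis) (- l)) = \dim (part (predC on_axis) l).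
Proof. by apply/eqP; rewrite eqn_leq part_off_le -{2}(opprK l) part_off_le. Qed.

End Multiplicity.

(** * The contribution of the characters on the axis *)

Section AxisPart.
Variables (R : realType) (k : nat) (M : CHD R k).
Local Notation n := k.*2.+1.
Local Notation V := 'cV[R]_n.
Local Notation C := (CC R).
Local Notation W := (spinor R k).
Local Notation a := (chd_a M).
Local Notation e := (chd_e M).
Local Notation A := (chd_A M).
Local Notation index := {ffun 'I_k -> 'I_2}.
Implicit Types (x v : V) (w : W) (th : 'rV[R]_n) (I : index).

Definition parity I := odd (\sum_s I s).
(* For k odd this exchanges the two signs of nu. *)
Definition flip I : index := [ffun s => rev_ord (I s)].

Lemma prod_sg2 I : \prod_s sg2 R (I s) = (-1) ^+ parity I.
Proof.
rewrite /sg2 /parity signr_odd.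
by elim/big_rec2: _ => [|s p m _ ->]; rewrite ?expr0 ?exprD.
Qed.

Lemma flipK : involutive flip.
Proof. by move=> I; apply/ffunP => s; rewrite !ffunE rev_ordK. Qed.

Lemma flip_val I s : flip I s = (1 - I s)%N :> nat.
Proof. by rewrite ffunE. Qed.

Lemma parity_flip I : odd k -> parity (flip I) = ~~ parity I.
Proof.
move=> ok; have : (\sum_s flip I s + \sum_s I s = k)%N.
  rewrite -big_split /= (eq_bigr (fun=> 1%N)) ?sum1_card ?card_ord // => s _.
  by rewrite flip_val subnK // -ltnS.
by move=> /(congr1 odd); rewrite oddD ok /parity; do 2 case: (odd _).
Qed.

Lemma muI_flip I : muI R (flip I) = - muI R I.
Proof.
rewrite /muI -sumrN; apply: eq_bigr => s _; rewrite flip_val -mulNr; congr (_ * _).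
by case: (I s) => [[|[|//]] lt] /=; rewrite ?expr1 ?expr0 ?opprK.
Qed.

Variables (y : clifford R n) (delta c : R).
Hypotheses (ok : odd k) (k0 : (0 < k)%N) (d01 : delta = 0 \/ delta = 1 / 2) (c01 : c = 0 \/ c = 1 / 2).

(* With mu_eps = muI I this is mu_eps / 2 + c(k) n. *)
Definition kap I : R := muI R I / 2 + c * n%:R.

Hypothesis y_eig : forall w, cl_act y (Bop w) = Bop (dg (fun I => ex (- ((kap I + delta * n%:R) / n%:R))) w).

Variables (T : finType) (rw : T -> 'rV[R]_n) (q : R).
Hypotheses (rw_inj : injective rw) (T_char : forall t, character M delta (rw t))
  (T_norm : forall t, 4 * pi ^+ 2 * Nth M (rw t) = q)
  (T_all : forall th, character M delta th -> 4 * pi ^+ 2 * Nth M th = q -> exists t, rw t = th).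
Local Notation X := {ffun T -> W}.
Local Notation eigenc := (coef_eigen y k0 T_char T_norm T_all).
Local Notation part := (part y k0 T_char T_norm T_all).
Local Notation on_axis := (on_axis M rw).

Variable l : R.
Hypotheses (lq : (2 * pi * l) ^+ 2 = q) (l0 : l != 0).

(* the pairs (character on the axis, common eigenvector of alpha and e_n) which satisfy
   the eigenvalue equation and the invariance under g *)
Definition good (p : T * index) := [&& on_axis p.1,
  sth M (rw p.1) * (-1) ^+ parity p.2 == - l &
  (kap p.2 + delta * n%:R + sth M (rw p.1)) / n%:R \is a Num.int].

Lemma symbol_axis (z : R) w : symbol M (z *: axis M) w = z%:C *: gamma ord_max w.
Proof.
rewrite /symbol (bigD1 ord_max) //= big1 ?addr0 => [|i im].
  by rewrite -scalemxAl mxE axisE chd_e_orthonormal eqxx mulr1.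
by rewrite -scalemxAl mxE axisE chd_e_orthonormal (negPf im) mulr0 scale0r.
Qed.

Lemma axis_row t : on_axis t -> rw t = sth M (rw t) *: axis M.
Proof. by move=> /eqP; exact: axis_form. Qed.

Lemma tA_axis t : on_axis t -> tA k0 T_char T_norm T_all t = t.
Proof.
move=> ax; apply: rw_inj; rewrite tAE (axis_row ax) -scalemxAl axis_A //.
Qed.

Lemma Bop_inj : injective (@Bop R k). Proof. exact: can_inj (@BopK R k). Qed.

Lemma Bop_eq_scale (z : C) (f : index -> C) w : (Bop (dg f w) = z *: Bop w) <->
  forall I, w I != 0 -> f I = z.
Proof.
rewrite -BopZ; split=> [/Bop_inj E I wI|H].
  have := congr1 (fun w : W => w I) E; rewrite dgE spZE => /(mulIf wI) //.
congr Bop; apply/spinorP => I; rewrite dgE spZE.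
by have [->|/H ->] := eqVneq (w I) 0; rewrite ?mulr0.
Qed.

(** On the index I, e_n acts by i (-1)^parity, so 2 pi i th(e_n) e_n has the eigenvalue - 2 pi
    th(e_n) (-1)^parity. *)
Lemma axis_symbol_cond t w : on_axis t ->
  (('i * (2 * pi)%:C) *: symbol M (rw t) (Bop w) = (2 * pi * l)%:C *: Bop w) <->
  forall I, w I != 0 -> sth M (rw t) * (-1) ^+ parity I = - l.
Proof.
move=> ax; rewrite (axis_row ax) symbol_axis sth_axis gamma_last_Bop !scalerA.
set s := sth M (rw t).
have -> : ('i * (2 * pi)%:C * s%:C) *: Bop (dg (fun I => 'i * \prod_s sg2 R (I s)) w) =
    Bop (dg (fun I => (2 * pi * (- (s * (-1) ^+ parity I)))%:C) w).
  rewrite -BopZ; congr Bop; apply/spinorP => I; rewrite spZE !dgE prod_sg2 mulrA; congr (_ * _).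
  rewrite mul_iR mulrCA !mulrA ii.
  rewrite (_ : (-1) ^+ parity I = ((-1) ^+ parity I : R)%:C); last first.
    by case: (parity I); rewrite ?expr1 ?expr0 ?(rmorphN (real_complex R)) ?rmorph1.
  by rewrite mulN1r -(rmorphN (real_complex R)) -(rmorphM (real_complex R)); congr (_%:C); ring.
rewrite Bop_eq_scale; split=> H I wI; have := H I wI.
  move=> /(congr1 (@complex.Re R)) /= /(mulfI _) <-; rewrite ?opprK //.
  by rewrite mulf_neq0 ?pnatr_eq0 // gt_eqF ?pi_gt0.
by move=> ->; rewrite opprK.
Qed.

Lemma ex_eq (u v : R) : ex u = ex v <-> u - v \is a Num.int.
Proof.
rewrite -ex_eq1 exD exN; split=> [->|/eqP]; first by rewrite divff ?ex_neq0.
by move=> /(congr1 (fun z => z * ex v)); rewrite mulfVK ?ex_neq0 // mul1r.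
Qed.

(** On the axis th A = th, and invariance under g becomes an eigenvalue equation for y. *)
Lemma axis_y_cond t w : on_axis t ->
  (cl_act y (Bop w) = ex (sth M (rw t) / n%:R) *: Bop w) <->
  forall I, w I != 0 -> (kap I + delta * n%:R + sth M (rw t)) / n%:R \is a Num.int.
Proof.
move=> ax; rewrite y_eig Bop_eq_scale; split=> H I wI; have := H I wI.
  by move/ex_eq; rewrite -opprD rpredN -mulrDl.
by move=> h; apply/ex_eq; rewrite -opprD rpredN -mulrDl.
Qed.

Lemma part_axisP d : d \in part on_axis (2 * pi * l) <->
  forall t I, BVop (d t) I != 0 -> good (t, I).
Proof.
have BE t : d t = Bop (BVop (d t)) by rewrite BVopK.
split=> [/partP [[d1 d2] ds] t I wI|H].
  have ax : on_axis t.
    apply: contraNT wI => /ds ->; rewrite /BVop /tensor_op ffunE big1 // => J _.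
    by rewrite ffunE mulr0.
  rewrite /good ax /=.
  have := d1 t; rewrite (BE t) => /(axis_symbol_cond _ ax)/(_ I wI) ->; rewrite eqxx.
  have := d2 t; rewrite (tA_axis ax) [in X in X -> _](BE t) => /(axis_y_cond _ ax); exact.
have ds t : ~~ on_axis t -> d t = 0.
  move=> ax; rewrite (BE t) -[RHS](BVopK 0); congr Bop; apply/spinorP => I.
  have -> : BVop (0 : W) I = 0.
    by rewrite /BVop /tensor_op ffunE big1 // => J _; rewrite ffunE mulr0.
  by apply/eqP; apply: contraNT ax => /H /and3P[].
apply/partP; split=> //; split=> t.
  have [ax|/ds ->] := boolP (on_axis t); last by rewrite symbol0 !scaler0.
  rewrite (BE t); apply/(axis_symbol_cond _ ax) => I /H /and3P[_ /eqP //].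
have [ax|ax] := boolP (on_axis t); last first.
  by rewrite (ds t ax) ds ?on_axis_A // cl_actr0 scaler0.
by rewrite (tA_axis ax) (BE t); apply/(axis_y_cond _ ax) => I /H /and3P[].
Qed.

Definition axis_synth := locked (fun u : {ffun {p | good p} -> C^o} =>
  [ffun t => Bop [ffun I => if insub (t, I) is Some p then u p else 0]] : X).

Lemma axis_synthE u t : axis_synth u t = Bop [ffun I => if insub (t, I) is Some p then u p else 0].
Proof. by rewrite /axis_synth -lock ffunE. Qed.

Lemma axis_synth_lin (z : C) (u v : {ffun {p | good p} -> C^o}) : axis_synth (z *: u + v) = z *: axis_synth u + axis_synth v.
Proof.
apply/ffunP => t; rewrite (XlinE z (axis_synth u) (axis_synth v) t) !axis_synthE -BopZ -BopD.
congr Bop; apply/spinorP => I; rewrite spDE spZE !ffunE.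
by case: insub => [p|]; rewrite ?ffunE ?mulr0 ?addr0 // ffunE.
Qed.

Lemma dim_part_axis : \dim (part on_axis (2 * pi * l)) = #|good|.
Proof.
rewrite (dim_param (f := axis_synth) axis_synth_lin); last 2 first.
- move=> u u0; apply/ffunP => p; rewrite ffunE.
  have := axis_synthE u (val p).1; rewrite u0 ffunE => /esym /(congr1 (@BVop R k)); rewrite BopK.
  move=> /(congr1 (fun w : W => w (val p).2)); rewrite ffunE -surjective_pairing valK => ->.
  by rewrite /BVop /tensor_op ffunE big1 // => J _; rewrite ffunE mulr0.
- move=> d; rewrite part_axisP; split=> [H|[u ->] t I].
    exists [ffun p => BVop (d (val p).1) (val p).2]; apply/ffunP => t; rewrite axis_synthE.
    rewrite -[LHS]BVopK; congr Bop; apply/spinorP => I; rewrite [RHS]ffunE.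
    case: insubP => [p _ pE|]; first by rewrite [RHS]ffunE pE.
    by move=> ng; apply/eqP; apply: contraNT ng => /H.
  by rewrite axis_synthE BopK ffunE; case: insubP => // ?; rewrite eqxx.
rewrite dimvf; transitivity (#|{: {p | good p}}| * 1)%N; first by [].
by rewrite muln1 card_sig; apply: eq_card.
Qed.

(** Even parity is nu = 1. At s = r + delta the congruence is the one that defines A_r, because
    delta n - delta is 0 or k. *)
Definition axis_set (s : R) := [set I : index | ~~ parity I & `[< (kap I + delta * n%:R - s) / n%:R \is a Num.int >]]%SET.

Lemma int_half (x : R) : x = 0 \/ x = 1 / 2 -> 2 * x \is a Num.int.
Proof. by case=> ->; rewrite ?mulr0 ?mul1r ?divff ?pnatr_eq0. Qed.

Lemma axis_character (s : R) : s - delta \is a Num.int -> character M delta (s *: axis M).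
Proof.
move=> sd i; rewrite -scalemxAl mxE /del; case: eqVneq => [->|im].
  by rewrite axisE -(ix_last k) -chd_e_last ix_last chd_e_orthonormal eqxx mulr1.
by rewrite axis_a // mulr0 subr0.
Qed.

Lemma sth_character th : character M delta th -> sth M th - delta \is a Num.int.
Proof. by move=> /(_ ord_max); rewrite /del eqxx /sth -{2}(ix_last k) chd_e_last ix_last. Qed.

Lemma good_sth t I : good (t, I) -> sth M (rw t) = if parity I then l else - l.
Proof.
case/and3P => _ /eqP /= + _; case: (parity I); rewrite ?expr1 ?expr0 ?mulrN1 ?mulr1 //.
exact: oppr_inj.
Qed.

(** The eigenvalue 2 pi l arises from th(e_n) = - l with even parity and from th(e_n) = l with odd
    parity. For odd k, [flip] carries one family of indices to the other, whence the factor 2 and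
    the restriction to nu = 1. *)
Lemma card_good : #|good| = if `[< l - delta \is a Num.int >] then (2 * #|axis_set l|)%N else 0%N.
Proof.
have twod := int_half d01; have twoc := int_half c01.
case: asboolP => [ld|nld]; last first.
  apply: eq_card0 => -[t I]; apply/negP => /[dup] /good_sth s g; apply: nld.
  have := sth_character (T_char t); rewrite s; case: (parity I) => //.
  have -> : l - delta = - (- l - delta + 2 * delta) by ring.
  by move=> h; rewrite rpredN rpredD.
have mld : - l - delta \is a Num.int.
  have -> : - l - delta = - (l - delta + 2 * delta) by ring.
  by rewrite rpredN rpredD.
have qE (s : R) : s ^+ 2 = l ^+ 2 -> 4 * pi ^+ 2 * Nth M (s *: axis M) = q.
  by rewrite Nth_axis -lq => ->; ring.
have [tp tpE] := T_all (axis_character ld) (qE _ erefl).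
have [tm tmE] := T_all (axis_character mld) (qE _ (sqrrN _)).
have tpm : tp != tm.
  apply: contraNneq l0 => tt; have := congr1 (sth M) (congr1 rw tt).
  by rewrite tpE tmE !sth_axis; lra.
have onp t (s : R) : rw t = s *: axis M -> on_axis t.
  by move=> tE; rewrite /on_axis tE Nth_axis sth_axis.
(* Flipping replaces kap by 2 c n - kap; since 2c and 2 delta are integers, the condition modulo n
   only changes sign. *)
have kf I : (kap (flip I) + delta * n%:R + l) / n%:R \is a Num.int = ((kap I + delta * n%:R - l) / n%:R \is a Num.int).
  rewrite /kap muI_flip; have : n%:R != 0 :> R by rewrite pnatr_eq0.
  move: (n%:R) => N N0.
  have -> : (- muI R I / 2 + c * N + delta * N + l) / N =
    - ((muI R I / 2 + c * N + delta * N - l) / N) + 2 * c + 2 * delta by field.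
  by rewrite !rpredDr // rpredN.
pose f t (b : bool) I := (t, if b then flip I else I) : T * index.
have finj t b : injective (f t b).
  by move=> I J /(congr1 snd) /=; case: b => //; exact: (can_inj flipK).
have -> : #|good| = #|[set f tm false I | I in axis_set l]%SET :|: [set f tp true I | I in axis_set l]%SET|.
  apply: eq_card => -[t I]; rewrite inE; apply/idP/orP => [g|].
    have st := good_sth g; case/and3P: (g) => ax _ /= gi.
    have tE := axis_row ax; case p : (parity I) st => st; [right|left]; apply/imsetP.
      exists (flip I); last first.
        by rewrite /f flipK; congr (_, _); apply: rw_inj; rewrite tpE tE st.
      rewrite inE parity_flip // p /=; apply/asboolP.
      by rewrite -kf flipK -st.
    exists I; last by congr (_, _); apply: rw_inj; rewrite tmE tE st.
    by rewrite inE p /=; apply/asboolP; rewrite -st.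
  case=> /imsetP [J]; rewrite inE => /andP[pJ /asboolP jj] [-> ->]; rewrite unfold_in /good /=.
    by rewrite (onp _ _ tmE) tmE sth_axis (negPf pJ) expr0 mulr1 eqxx.
  by rewrite (onp _ _ tpE) tpE sth_axis parity_flip // pJ expr1 mulrN1 eqxx kf.
rewrite cardsU (_ : _ :&: _ = finset.set0) ?cards0 ?subn0.
  by rewrite !card_imset // mul2n addnn.
apply/setP => -[t I]; rewrite !inE; apply/negP => /andP[/imsetP [J _ [-> _]] /imsetP [J' _ [tt _]]].
by rewrite tt eqxx in tpm.
Qed.

End AxisPart.

(** * Counting characters *)

Section Lattice.
Variables (R : realType) (k : nat) (M : CHD R k).
Local Notation n := k.*2.+1.
Local Notation V := 'cV[R]_n.
Local Notation a := (chd_a M).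
Local Notation e := (chd_e M).
Local Notation dot := (chd_dot M).
Implicit Types (th : 'rV[R]_n).

Variable delta : R.
Hypothesis d01 : delta = 0 \/ delta = 1 / 2.
Local Notation character := (character M delta).

Definition char_row (m : 'I_n -> int) : 'rV[R]_n :=
  sval (cid (row_with_values M (fun i => (m i)%:~R + del delta i))).

Lemma char_rowE m i : (char_row m *m a i) 0 0 = (m i)%:~R + del delta i.
Proof. exact: (svalP (cid (row_with_values M (fun i => (m i)%:~R + del delta i)))). Qed.

Lemma char_row_character m : character (char_row m).
Proof. by move=> i; rewrite char_rowE addrK intr_int. Qed.

Lemma character_row th : character th -> exists m, th = char_row m.
Proof.
move=> ch; exists (fun i => Num.floor ((th *m a i) 0 0 - del delta i)).
by apply: (row_ext (M := M)) => i; rewrite char_rowE floorK // subrK.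
Qed.

Definition asize : R := \sum_i dot (a i) (a i).

Lemma asize_ge i : dot (a i) (a i) <= asize.
Proof. by rewrite /asize (bigD1 i) //= lerDl sumr_ge0 // => j _; exact: dot_ge0. Qed.

Lemma asize_gt0 : 0 < asize.
Proof.
apply: lt_le_trans (asize_ge ord_max); rewrite -(ix_last k) -chd_e_last ix_last.
by rewrite chd_e_orthonormal eqxx ltr01.
Qed.

Lemma row_value_bound th i : (th *m a i) 0 0 ^+ 2 <= Nth M th * asize.
Proof.
rewrite -(uvec_dot M); apply: le_trans (cauchy_schwarz _ _ _) _.
by rewrite ler_wpM2l ?asize_ge ?Nth_ge0.
Qed.

Lemma del_half (i : 'I_n) : 0 <= del delta i <= 1 / 2.
Proof. by rewrite /del; case: eqP => _; [case: d01 => ->|]; lra. Qed.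

Lemma char_row_bound m i : `|(m i)%:~R : R| <= 1 / 2 + `|(char_row m *m a i) 0 0|.
Proof.
have -> : (m i)%:~R = (char_row m *m a i) 0 0 - del delta i :> R by rewrite char_rowE addrK.
apply: le_trans (ler_normB _ _) _; rewrite addrC lerD2r.
by have /andP[h1 h2] := del_half i; rewrite ger0_norm.
Qed.

Lemma int_ge1 (z : int) : z != 0 -> 1 <= `|z%:~R : R|.
Proof. by move=> z0; rewrite -intr_norm (ler_int R 1) -gtz0_ge1 normr_gt0. Qed.

(** The values of a character on the a_i lie in Z or Z + 1/2, so a nonzero one has a value of
    modulus at least 1/2; Cauchy-Schwarz concludes. *)
Lemma char_row_far m : Nth M (char_row m) != 0 -> 1 / 4 <= Nth M (char_row m) * asize.
Proof.
move=> N0; suff [i hi] : exists i, 1 / 2 <= `|(char_row m *m a i) 0 0|.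
  apply: le_trans (row_value_bound _ i); rewrite -real_normK ?num_real //.
  have -> : 1 / 4 = (1 / 2) ^+ 2 :> R by field.
  by rewrite ler_pXn2r // nnegrE; lra.
apply: contrapT => H; case/eqP: N0; rewrite /Nth.
have z i : (char_row m *m a i) 0 0 = 0.
  have {}H : `|(char_row m *m a i) 0 0| < 1 / 2.
    by rewrite ltNge; apply/negP => h; apply: H; exists i.
  have /andP[h1 h2] := del_half i.
  move: H; rewrite char_rowE; have [->|/int_ge1 m0] := eqVneq (m i) 0.
    rewrite /= add0r /del; case: eqP => // _; case: d01 => -> //.
    by rewrite ger0_norm; lra.
  move: m0; rewrite !real_lter_norml ?num_real // ler_normr => m0 /andP[h3 h4].
  by case/orP: m0 => m0; lra.
have -> : char_row m = 0.
  by apply: (row_ext (M := M)) => i; rewrite z mul0mx mxE.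
by rewrite uvec_dot mul0mx mxE.
Qed.

Lemma char_row_growth m i : Nth M (char_row m) != 0 ->
  (1 + `|(m i)%:~R|) ^+ 2 <= 16 * asize * Nth M (char_row m).
Proof.
move=> /char_row_far N4; have := char_row_bound m i.
have := row_value_bound (char_row m) i; rewrite -real_normK ?num_real //.
set x : R := `|_ 0 0|; set N : R := Nth _ _ in N4 *; have x0 : 0 <= x by exact: normr_ge0.
set mi : R := `|(m i)%:~R|; have m0 : 0 <= mi by exact: normr_ge0.
(* With Y = |th|^2 [asize] >= 1/4 one has 3/2 <= 3 sqrt Y and x <= sqrt Y, whence 16 = (3 + 1)^2. *)
move=> xN mx; apply: (@le_trans _ _ ((3 / 2 + x) ^+ 2)).
  by rewrite ler_pXn2r ?nnegrE //; lra.
have h : 0 <= (x - 1 / 2) ^+ 2 by exact: sqr_ge0.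
nra.
Qed.

Local Notation box B := {ffun 'I_n -> 'I_(B.*2.+1)}.
Definition box_vec (B : nat) (f : box B) (i : 'I_n) : int := (f i)%:Z - B%:Z.

Lemma box_vec_onto (B : nat) (m : 'I_n -> int) : (forall i, `|m i| <= B%:Z) ->
  exists f : box B, box_vec f = m.
Proof.
move=> mB; exists [ffun i => inord (absz (m i + B%:Z))]; apply/funext => i.
rewrite /box_vec ffunE inordK; last by move: (mB i); lia.
by move: (mB i); lia.
Qed.

(** Bounds |m_i| when 4 pi^2 |th|^2 = q: with Y = q / (4 pi^2) times [asize], |m_i| <= 1/2 + sqrt Y
    <= 2 Y + 1. *)
Definition box_size (q : R) : nat := (Num.truncn (2 * (q / (4 * pi ^+ 2)) * asize + 1)).+1.

Lemma pi2_gt0 : 0 < 4 * pi ^+ 2 :> R.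
Proof. by rewrite mulr_gt0 // exprn_gt0 // pi_gt0. Qed.

Lemma char_row_in_box (q : R) m (B : nat) : 4 * pi ^+ 2 * Nth M (char_row m) = q -> (box_size q <= B)%N ->
  forall i, `|m i| <= B%:Z.
Proof.
move=> Nq qB i; have := char_row_bound m i.
have := row_value_bound (char_row m) i; rewrite -real_normK ?num_real //.
have -> : Nth M (char_row m) = q / (4 * pi ^+ 2) by rewrite -Nq [_ * Nth _ _]mulrC mulfK // gt_eqF ?pi2_gt0.
set x : R := `|_ 0 0|; have x0 : 0 <= x by exact: normr_ge0.
set mi : R := `|(m i)%:~R|; have m0 : 0 <= mi by exact: normr_ge0.
move=> xN mx; rewrite -(ler_int R) intr_norm -/mi.
have mq : mi <= 2 * (q / (4 * pi ^+ 2)) * asize + 1.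
  have h : 0 <= (x - 1 / 2) ^+ 2 by exact: sqr_ge0.
  have h' : 0 <= (mi - 1 / 2) ^+ 2 by exact: sqr_ge0.
  have h1 : mi ^+ 2 <= (1 / 2 + x) ^+ 2 by rewrite ler_pXn2r ?nnegrE //; lra.
  nra.
apply: le_trans mq (le_trans (ltW (truncnS_gt _)) _).
by rewrite -pmulrn ler_nat.
Qed.

Definition box_chars (q : R) (B : nat) :=
  [pred f : box B | 4 * pi ^+ 2 * Nth M (char_row (box_vec f)) == q].

Definition char_seq (q : R) : seq 'rV[R]_n :=
  undup [seq char_row (box_vec f) | f in box_chars q (box_size q)].

Lemma mem_char_seq q th : th \in char_seq q <-> character th /\ 4 * pi ^+ 2 * Nth M th = q.
Proof.
rewrite mem_undup; split.
  by move=> /fintype.imageP [f /eqP fq ->]; split=> //; exact: char_row_character.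
move=> [/character_row [m ->] Nq].
have [f fm] := box_vec_onto (char_row_in_box Nq (leqnn _)).
by apply/fintype.imageP; exists f; rewrite ?inE fm ?Nq.
Qed.

Lemma size_char_seq q (B : nat) : (box_size q <= B)%N -> (size (char_seq q) <= #|box_chars q B|)%N.
Proof.
move=> qB; rewrite -(fintype.size_image (fun f : box B => char_row (box_vec f))).
apply: uniq_leq_size; first exact: undup_uniq.
move=> th /mem_char_seq [/character_row [m ->] Nq].
have [f fm] := box_vec_onto (char_row_in_box Nq qB).
by apply/fintype.imageP; exists f; rewrite ?inE fm ?Nq.
Qed.

Definition char_ix q : finType := seq_sub (char_seq q).
Definition char_val q (t : char_ix q) : 'rV[R]_n := ssval t.

Lemma char_val_inj q : injective (@char_val q). Proof. exact: val_inj. Qed.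
Lemma char_val_char q (t : char_ix q) : character (char_val t).
Proof. by have /mem_char_seq [] := ssvalP t. Qed.
Lemma char_val_norm q (t : char_ix q) : 4 * pi ^+ 2 * Nth M (char_val t) = q.
Proof. by have /mem_char_seq [] := ssvalP t. Qed.
Lemma char_val_all q th : character th -> 4 * pi ^+ 2 * Nth M th = q -> exists t : char_ix q, char_val t = th.
Proof.
move=> ch Nq; have th_in : th \in char_seq q by apply/mem_char_seq.
by exists (SeqSub th_in).
Qed.

Lemma card_char_ix q : #|char_ix q| = size (char_seq q).
Proof. by rewrite card_seq_sub // undup_uniq. Qed.

(** The sum is a product over the coordinates. Each factor runs over -B, ..., B and splits at 0 into
    two halves, each at most 2 by [sum_node] with d = 1. *)
Lemma sum_box (B : nat) : \sum_(f : box B) \prod_i (1 + `|(box_vec f i)%:~R : R|) ^- 2 <= 4 ^+ n.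
Proof.
pose F (j : 'I_(B.*2.+1)) : R := (1 + `|((j%:Z - B%:Z)%:~R : R)|) ^- 2.
have <- : \prod_(i < n) \sum_j F j = \sum_(f : box B) \prod_i (1 + `|(box_vec f i)%:~R : R|) ^- 2.
  by rewrite bigA_distr_bigA.
rewrite prodr_const card_ord; apply: lerXn2r.
- by rewrite nnegrE sumr_ge0 // => j _; rewrite invr_ge0 sqr_ge0.
- by rewrite nnegrE.
have half (m : nat) : \sum_(j < m) (1 + j%:R) ^- 2 <= 2 :> R.
  apply: le_trans (_ : 1 + 1^-1 <= _); last by rewrite invr1.
  apply: le_trans (sum_node (d := 1 : R) ltr01 m); apply: ler_sum => j _.
  by rewrite /node mul1r.
pose G (j : nat) : R := (1 + `|((j%:Z - B%:Z)%:~R : R)|) ^- 2.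
rewrite (_ : \sum_j F j = \sum_(0 <= j < B.*2.+1) G j); last by rewrite big_mkord.
rewrite (big_cat_nat (n := B)) //=; last by lia.
rewrite (_ : 4 = 2 + 2); last by ring.
apply: lerD.
  rewrite big_nat_rev /= add0n big_mkord; apply: le_trans (half B); apply: ler_sum => j _.
  rewrite lef_pV2 ?posrE ?exprn_gt0 ?ltr_wpDr // ?ler_pXn2r ?nnegrE ?addr_ge0 //.
  rewrite lerD2l -intr_norm [_%:R]pmulrn ler_int; have := ltn_ord j; lia.
rewrite -{1}(add0n B) big_addn big_mkord.
apply: le_trans (half _); apply: ler_sum => j _.
rewrite lef_pV2 ?posrE ?exprn_gt0 ?ltr_wpDr // ?ler_pXn2r ?nnegrE ?addr_ge0 //.
rewrite lerD2l -intr_norm [_%:R]pmulrn ler_int; lia.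
Qed.

Lemma card_sqrt (L : seq R) (x : R) : uniq L -> (\sum_(l <- L | l ^+ 2 == x) 1 <= 2 :> R)%R.
Proof.
move=> uL; rewrite -big_filter big_const_seq count_predT iter_addr_0.
rewrite (ler_nat R _ 2); apply: (@uniq_leq_size _ _ [:: Num.sqrt x; - Num.sqrt x]).
  exact: filter_uniq.
move=> l; rewrite mem_filter => /andP[/eqP <- _]; rewrite sqrtr_sqr !inE.
by case: (ger0P l) => _; rewrite ?opprK eqxx ?orbT.
Qed.

(** The weight |l|^(-2n) is a product of n factors l^(-2), each at most K (1 + |m_i|)^(-2) by
    [char_row_growth]; the exponent 2n is chosen so that the lattice sum factors. A character
    belongs to at most two values of l. *)
Lemma char_sum_bound : exists C : R, forall L : seq R, uniq L ->
  \sum_(l <- L | l != 0) (size (char_seq (l ^+ 2)))%:R * `|l| ^- (2 * n) <= C.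
Proof.
(* The constant 16 [asize] of [char_row_growth] after substituting |th|^2 = l^2 / (4 pi^2). *)
pose K : R := 4 * asize / pi ^+ 2.
have K0 : 0 < K by rewrite divr_gt0 ?exprn_gt0 ?pi_gt0 // mulr_gt0 ?asize_gt0.
exists (K ^+ n * 2 * 4 ^+ n) => L uL.
(* One box for all l in L; the final bound does not depend on it. *)
pose B := \sum_(l <- L) box_size (l ^+ 2).
have BL l : l \in L -> (box_size (l ^+ 2) <= B)%N.
  by move=> lL; rewrite /B (big_rem l lL) leq_addr.
pose w (f : box B) : R := \prod_i (1 + `|(box_vec f i)%:~R|) ^- 2.
have w0 f : 0 <= w f by apply: prodr_ge0 => i _; rewrite invr_ge0 sqr_ge0.
apply: (@le_trans _ _ (\sum_(l <- L | l != 0) \sum_(f in box_chars (l ^+ 2) B) K ^+ n * w f)).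
  rewrite big_seq_cond [leRHS]big_seq_cond; apply: ler_sum => l /andP[lL l0].
  apply: (@le_trans _ _ (#|box_chars (l ^+ 2) B|%:R * `|l| ^- (2 * n))).
    by rewrite ler_wpM2r ?invr_ge0 ?exprn_ge0 // ler_nat size_char_seq ?BL.
  rewrite -sum1_card natr_sum mulr_suml; apply: ler_sum => f /eqP Nf; rewrite mul1r.
  have N0 : Nth M (char_row (box_vec f)) != 0.
    apply: contraNneq l0 => N0; move: Nf; rewrite N0 mulr0 => /esym/eqP.
    by rewrite sqrf_eq0.
  have l2 : 0 < l ^+ 2 by rewrite lt_def sqrf_eq0 l0 sqr_ge0.
  have NE : Nth M (char_row (box_vec f)) = l ^+ 2 / (4 * pi ^+ 2).
    by rewrite -Nf [_ * Nth _ _]mulrC mulfK // gt_eqF ?pi2_gt0.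
  rewrite exprM real_normK ?num_real // -exprVn /w.
  have -> : K ^+ n * \prod_i (1 + `|(box_vec f i)%:~R|) ^- 2 = \prod_(i < n) (K * (1 + `|(box_vec f i)%:~R|) ^- 2).
    by rewrite big_split /= prodr_const card_ord.
  have -> : (l ^+ 2)^-1 ^+ n = \prod_(i < n) (l ^+ 2)^-1 by rewrite prodr_const card_ord.
  apply: ler_prod => i _; rewrite invr_ge0 (ltW l2) /=.
  rewrite ler_pdivlMr ?exprn_gt0 ?ltr_wpDr // ler_pdivrMl //.
  apply: le_trans (char_row_growth i N0) _; rewrite NE /K.
  have : pi ^+ 2 != 0 :> R by rewrite sqrf_eq0 gt_eqF ?pi_gt0.
  by move: (pi ^+ 2) => p p0; rewrite le_eqVlt; apply/orP; left; apply/eqP; field.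
rewrite (eq_bigr (fun l => \sum_f (if 4 * pi ^+ 2 * Nth M (char_row (box_vec f)) == l ^+ 2 then K ^+ n * w f else 0))); last first.
  by move=> l _; rewrite -big_mkcond; apply: eq_bigl => f; rewrite inE.
rewrite exchange_big /=.
apply: (@le_trans _ _ (\sum_f K ^+ n * w f * 2)).
  apply: ler_sum => f _; rewrite -big_mkcondr /= -big_filter.
  apply: le_trans (_ : \sum_(l <- L | l ^+ 2 == 4 * pi ^+ 2 * Nth M (char_row (box_vec f))) K ^+ n * w f <= _).
    rewrite big_filter [leRHS]big_mkcond [leLHS]big_mkcond; apply: ler_sum => l _.
    have h : 0 <= K ^+ n * w f by rewrite mulr_ge0 // exprn_ge0 // ltW.
    rewrite [_ == l ^+ 2]eq_sym; case: (l == 0); case: (_ == _) => //=.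
  rewrite -[X in \sum_(l <- L | _) X]mulr1 -mulr_sumr ler_wpM2l ?card_sqrt //.
  by rewrite mulr_ge0 // exprn_ge0 // ltW.
rewrite -mulr_suml -mulr_sumr -mulrA [leRHS]mulrAC -mulrA.
by apply: ler_pM; rewrite ?exprn_ge0 ?(ltW K0) ?mulr_ge0 ?sumr_ge0 ?ler_wpM2r ?sum_box.
Qed.

(** [char_row_far] gives l^2 >= pi^2 / [asize]; for |l| < 1 this bounds |l| >= l^2 as well, without
    a square root. *)
Lemma char_seq_far : exists2 c : R, 0 < c & forall l, l != 0 -> (0 < size (char_seq (l ^+ 2)))%N -> c <= `|l|.
Proof.
have h0 : 0 < pi ^+ 2 / asize by rewrite divr_gt0 ?asize_gt0 // exprn_gt0 ?pi_gt0.
exists (Num.min 1 (pi ^+ 2 / asize)); first by rewrite lt_min ltr01.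
move=> l l0; case E : (char_seq (l ^+ 2)) => [//|th s] _.
have : th \in char_seq (l ^+ 2) by rewrite E mem_head.
move=> /mem_char_seq [/character_row [m ->] Nq].
have N0 : Nth M (char_row m) != 0.
  apply: contraNneq l0 => N0; move: Nq; rewrite N0 mulr0 => /esym/eqP.
  by rewrite sqrf_eq0.
have := char_row_far N0; rewrite ge_min.
have [//|l1] := leP 1 `|l| => h; rewrite orFb.
apply: (@le_trans _ _ (`|l| ^+ 2)); last by rewrite expr2 ger_pMl ?normr_gt0 // ltW.
rewrite real_normK ?num_real // -Nq ler_pdivrMr ?asize_gt0 //.
have : 0 < pi ^+ 2 :> R by rewrite exprn_gt0 ?pi_gt0.
move: (pi ^+ 2) => p p0; move: h; set N := Nth _ _; nra.
Qed.

End Lattice.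

(** * The numbers A_r *)

Section Averages.
Variables (R : realType) (n : nat) (a chi : nat -> R).
Hypotheses (n0 : (0 < n)%N) (aper : forall m, a (m + n)%N = a m).

Lemma avg_weighted : avg n chi = (\sum_(i < n) (n%:R - i%:R) * chi i) / n%:R.
Proof.
rewrite /avg; congr (_ / _).
have H (m : nat) : \sum_(j < m) psum chi j.+1 = \sum_(i < m) (m%:R - i%:R) * chi i.
  elim: m => [|m IH]; first by rewrite !big_ord0.
  rewrite big_ord_recr /= IH [RHS]big_ord_recr /= /psum big_ord_recr /= addrA -big_split /=.
  congr (_ + _); first by apply: eq_bigr => i _; rewrite -natr1; ring.
  by rewrite -natr1; ring.
exact: H.
Qed.

Lemma sum_rev (f : nat -> R) : \sum_(i < n) f (n.-1 - i)%N = \sum_(i < n) f i.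
Proof.
rewrite [RHS](reindex_inj rev_ord_inj) /=; apply: eq_bigr => i _; congr f.
by have := ltn_ord i; lia.
Qed.

Lemma sum_shift (b : nat -> R) : \sum_(i < n) b i.+1 = \sum_(i < n) b i + b n - b 0%N.
Proof.
have := erefl (\sum_(i < n.+1) b i); rewrite {1}big_ord_recr big_ord_recl /= => ->.
by rewrite addrC addKr.
Qed.

(** In the weighted mean a_i has the weight n - i from the first term and - (i + 1) from the
    reflected one, together n - (2i + 1). *)
Lemma avg_half_shift : (forall m, (m < n)%N -> chi m = a m - a (n.-1 - m)%N) ->
  \sum_(m < n) chi m = 0 /\ avg n chi = \sum_(0 <= r < n) a r * (1 - (2 * r + 1)%:R / n%:R).
Proof.
move=> chiE; split.
  rewrite (eq_bigr (fun m : 'I_n => a m - a (n.-1 - m)%N)); last by move=> m _; exact: chiE.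
  by rewrite sumrB sum_rev subrr.
rewrite avg_weighted big_mkord; have nn : n%:R != 0 :> R by rewrite pnatr_eq0 -lt0n.
rewrite (eq_bigr (fun i : 'I_n => (n%:R - i%:R) * a i - (n%:R - i%:R) * a (n.-1 - i)%N)); last first.
  by move=> i _; rewrite chiE // mulrBr.
rewrite sumrB.
have -> : \sum_(i < n) (n%:R - i%:R) * a (n.-1 - i)%N = \sum_(i < n) i.+1%:R * a i.
  rewrite -(sum_rev (fun i => i.+1%:R * a i)); apply: eq_bigr => i _; congr (_ * _).
  by rewrite -natrB 1?ltnW //; congr (_%:R); have := ltn_ord i; lia.
rewrite -sumrB mulr_suml; apply: eq_bigr => i _.
by rewrite natrD natrM -natr1; field.
Qed.

(** Here a_r has the weights n + 1 - r and - (r + 1), together n - 2r; the extreme terms a_n and -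
    a_0 cancel by periodicity, so the sum starts at 1. *)
Lemma avg_full_shift : (forall m, (m < n)%N -> chi m = a m.+1 - a (n.-1 - m)%N) ->
  \sum_(m < n) chi m = 0 /\ avg n chi = \sum_(1 <= r < n) a r * (1 - (2 * r)%:R / n%:R).
Proof.
move=> chiE; have an : a n = a 0%N by rewrite -[LHS]/(a (0 + n)%N) aper.
split.
  rewrite (eq_bigr (fun m : 'I_n => a m.+1 - a (n.-1 - m)%N)); last by move=> m _; exact: chiE.
  by rewrite sumrB sum_rev sum_shift an addrK subrr.
rewrite avg_weighted; have nn : n%:R != 0 :> R by rewrite pnatr_eq0 -lt0n.
rewrite (eq_bigr (fun i : 'I_n => (n.+1%:R - i.+1%:R) * a i.+1 - (n%:R - i%:R) * a (n.-1 - i)%N)); last first.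
  by move=> i _; rewrite chiE // mulrBr -!natr1; congr (_ * _ - _); ring.
rewrite sumrB (sum_shift (fun i => (n.+1%:R - i%:R) * a i)).
have -> : \sum_(i < n) (n%:R - i%:R) * a (n.-1 - i)%N = \sum_(i < n) i.+1%:R * a i.
  rewrite -(sum_rev (fun i => i.+1%:R * a i)); apply: eq_bigr => i _; congr (_ * _).
  by rewrite -natrB 1?ltnW //; congr (_%:R); have := ltn_ord i; lia.
have -> : \sum_(1 <= r < n) a r * (1 - (2 * r)%:R / n%:R) =
   \sum_(r < n) a r * (1 - (2 * r)%:R / n%:R) - a 0%N.
  by rewrite -(big_mkord xpredT (fun r => a r * (1 - (2 * r)%:R / n%:R))) big_ltn // muln0 mul0r subr0 mulr1 addrC addKr.
rewrite an -natr1.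
have -> : \sum_(r < n) a r * (1 - (2 * r)%:R / n%:R) =
   (\sum_(i < n) (n%:R + 1 - i%:R) * a i - \sum_(i < n) i.+1%:R * a i) / n%:R.
  rewrite -sumrB mulr_suml; apply: eq_bigr => i _.
  by rewrite natrM -natr1; field.
by field.
Qed.

End Averages.

(** * Sign vectors and tensor indices *)

Section Counting.
Variables (R : realType) (k : nat).
Local Notation n := k.*2.+1.
Local Notation index := {ffun 'I_k -> 'I_2}.
Local Notation signs := {ffun 'I_k -> bool}.
Implicit Types (I : index) (eps : signs).

Definition weight : nat := ((k * k.+1)./2)%N.

Lemma mu_weight eps : mu eps = weight%:Z - 2 * (\sum_(i < k | eps i) i.+1)%N%:Z.
Proof.
have -> : weight%:Z = \sum_(i < k) (i.+1)%:Z.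
  have -> : weight = (\sum_(i < k) i.+1)%N.
    have := bin2_sum k.+1; rewrite big_nat_recl // add0n big_mkord => ->.
    by rewrite bin2 mulnC.
  by rewrite (big_morph Posz PoszD (erefl _)).
rewrite (big_morph Posz PoszD (erefl _)) mulr_sumr [\sum_(i < k | eps i) _]big_mkcond -sumrB.
by apply: eq_bigr => i _; case: (eps i); rewrite ?expr1 ?expr0; lia.
Qed.

(** mu has the parity of k(k+1)/2, and c(k) n is a proper half-integer exactly when that number is
    odd, n being odd. *)
Lemma half_mu_int eps : half_mu eps \is a Num.int.
Proof.
rewrite /half_mu mu_weight /c_k -/weight.
set X := (\sum_(i < k | eps i) i.+1)%N.
have -> : ((weight%:Z - 2 * X%:Z)%:~R / 2 + (if odd weight then 1 / 2 else 0) * n%:R : rat) =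
  (((weight + odd weight * n)./2)%:Z - X%:Z)%:~R.
  have : ((weight + odd weight * n)./2.*2 = weight + odd weight * n)%N.
    have ev : odd (weight + odd weight * n) = false.
      by rewrite oddD oddM /= odd_double; case: (odd weight).
    by have := odd_double_half (weight + odd weight * n); rewrite ev add0n.
  move=> /(congr1 (fun m : nat => m%:R : rat)); rewrite -muln2 natrM natrD natrM => h.
  rewrite !intrD !intrN intrM -!pmulrn.
  move: h; case: (odd weight) => /= h; lra.
exact: intr_int.
Qed.

(** Reversed, since the tensor factor s carries the sign of index k - s. *)
Definition index_of (eps : signs) : index := [ffun s => inord (eps (rev_ord s))].
Definition signs_of I : signs := [ffun i => I (rev_ord i) == 1].

Lemma signs_ofK : cancel signs_of index_of.
Proof.
move=> I; apply/ffunP => s; rewrite !ffunE rev_ordK; apply/val_inj.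
by case: (I s) => [[|[|//]] lt] /=; rewrite inordK.
Qed.

Lemma index_ofK : cancel index_of signs_of.
Proof.
move=> eps; apply/ffunP => i; rewrite !ffunE rev_ordK -val_eqE /= inordK; by case: (eps i).
Qed.

Lemma signs_of_odd I i : signs_of I i = odd (I (rev_ord i)).
Proof. by rewrite ffunE; case: (I _) => [[|[|//]] lt]. Qed.

Lemma muI_signs I : muI R I = (mu (signs_of I))%:~R.
Proof.
rewrite /mu rmorph_sum /= (reindex_inj rev_ord_inj) /=; apply: eq_bigr => s _.
rewrite rmorphM /= rmorphXn rmorphN rmorph1 /= signs_of_odd rev_ordK signr_odd.
by congr (_ * _); rewrite -pmulrn; congr (_%:R); have := ltn_ord s; rewrite /=; lia.
Qed.

Lemma parity_signs I : (nu (signs_of I) == 1) = ~~ parity I.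
Proof.
have -> : nu (signs_of I) = (-1) ^+ parity I.
  rewrite /nu /parity (reindex_inj rev_ord_inj) signr_odd /=.
  rewrite (eq_bigr (fun s => (-1) ^+ (I s))); last first.
    by move=> s _; rewrite signs_of_odd rev_ordK signr_odd.
  by elim/big_rec2: _ => [|s p m _ ->]; rewrite ?expr0 ?exprD.
by case: (parity I).
Qed.

Definition c_real : R := if odd weight then 1 / 2 else 0.

Lemma kap_signs I : kap c_real I = ratr (half_mu (signs_of I)).
Proof.
rewrite /kap /half_mu muI_signs rmorphD /= !rmorphM /= fmorphV /= ratr_int !rmorph_nat /c_real /c_k -/weight.
by case: ifP => _; rewrite ?rmorph0 // rmorphM /= fmorphV rmorph1 rmorph_nat.
Qed.

Lemma ratr_intE (x : rat) : (ratr x \is a @Num.int R) = (x \is a Num.int).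
Proof.
apply/idP/idP => [/intrP [z] h|/intrP [z ->]]; last by rewrite ratr_int intr_int.
have : x = z%:~R by apply/eqP; rewrite eq_le -!(ler_rat R) h ratr_int lexx.
by move=> ->; exact: intr_int.
Qed.

Lemma kap_int I : kap c_real I \is a Num.int.
Proof. by rewrite kap_signs ratr_intE half_mu_int. Qed.

Lemma card_signs (P : pred signs) : #|[set I : index | P (signs_of I)]%SET| = #|[set eps | P eps]%SET|.
Proof.
rewrite -(card_imset _ (can_inj signs_ofK)); apply: eq_card => eps; rewrite [RHS]inE.
apply/imsetP/idP => [[I]|Pe]; first by rewrite inE => PI ->.
by exists (index_of eps); rewrite ?inE index_ofK.
Qed.

Lemma A_plus_axis (r : nat) : (A_plus k r = 2 * #|axis_set k 0 c_real r%:R|)%N.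
Proof.
rewrite /A_plus; congr (2 * _)%N; rewrite -card_signs; apply: eq_card => I; rewrite !inE.
rewrite parity_signs; congr (_ && _); rewrite /rat_congr -ratr_intE.
rewrite asboolb mul0r addr0 kap_signs.
by rewrite rmorphM /= rmorphB /= fmorphV !rmorph_nat.
Qed.

Lemma A_minus_axis (r : nat) : (A_minus k r = 2 * #|axis_set k (1 / 2) c_real (r%:R + 1 / 2)|)%N.
Proof.
rewrite /A_minus; congr (2 * _)%N; rewrite -card_signs; apply: eq_card => I; rewrite !inE.
rewrite parity_signs; congr (_ && _); rewrite /rat_congr -ratr_intE asboolb kap_signs.
rewrite rmorphM /= rmorphB rmorphD /= fmorphV !rmorph_nat; congr (_ / _ \is a _).
by rewrite -[n%:R]natr1 -muln2 natrM; field.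
Qed.

Lemma axis_set_periodic (delta c s : R) (z : int) : axis_set k delta c (s + z%:~R * n%:R) = axis_set k delta c s.
Proof.
apply/setP => I; rewrite !inE !asboolb; congr (_ && _).
have -> : (kap c I + delta * n%:R - (s + z%:~R * n%:R)) / n%:R = (kap c I + delta * n%:R - s) / n%:R - z%:~R.
  have : n%:R != 0 :> R by rewrite pnatr_eq0.
  by move: (n%:R) => N N0; field.
by rewrite rpredBr // intr_int.
Qed.

End Counting.

(** * The eta series *)

Section UnconditionalSums.
Variables (R : realType) (F : R -> CC R) (B : R).
Local Notation C := (CC R).
Hypothesis FB : forall L : seq R, uniq L -> \sum_(l <- L) cabs (F l) <= B.

(** L0 is chosen with its sum of moduli within e of the supremum over all finite sets; a disjoint
    set cannot add more than e. *)
Lemma small_tail (e : R) : 0 < e -> exists2 L0 : seq R, uniq L0 &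
  forall L : seq R, uniq L -> {in L, forall l, l \notin L0} -> cabs (\sum_(l <- L) F l) <= e.
Proof.
move=> e0; pose E := [set x | exists2 L : seq R, uniq L & x = \sum_(l <- L) cabs (F l)].
have hE : has_sup E.
  split; first by exists 0, [::]; rewrite ?big_nil.
  by exists B => _ [L uL ->]; exact: FB.
have [_ [L0 uL0 ->] hL0] := sup_adherent e0 hE.
exists L0 => // L uL dis; apply: le_trans (cabs_sum _ _ _) _.
have : \sum_(l <- L0 ++ L) cabs (F l) <= sup E.
  apply: sup_ubound; first exact: hE.2.
  exists (L0 ++ L) => //; rewrite cat_uniq uL0 uL andbT /=.
  by apply/hasPn => l /dis.
by rewrite big_cat /= => h; lra.
Qed.

(** Under absolute summability it is enough to approach s along some sets, provided they can contain
    any prescribed finite set: what a larger set adds is a small tail. *)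
Lemma unconditional_sum (s : C) :
  (forall (e : R) (L0 : seq R), 0 < e -> exists L1 : seq R,
     [/\ uniq L1, {subset L0 <= L1} & cabs (\sum_(l <- L1) F l - s) <= e]) ->
  (fun L : {fset R} => \sum_(l <- L) F l) @ summability.totally --> s.
Proof.
move=> H; have FF : Filter (@summability.totally R) by exact: summability.totally_filter.
apply/cvgrPdist_le => e e0.
have [er [eE ep]] : exists er : R, e = er%:C /\ 0 < er.
  case: e e0 => a b; rewrite ltcE /= => /andP[/eqP -> a0]; by exists a.
have e2 : 0 < er / 2 by rewrite divr_gt0.
have [L0 uL0 tail] := small_tail e2.
have [L1 [uL1 sub close]] := H _ L0 e2.
exists [fset l | l in L1]%fset => // L /= /fsubsetP LL; rewrite eE normCC lecR.
have LL1 : {subset L1 <= (L : seq R)} by move=> l lL; apply: LL; rewrite inE.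
have uL : uniq (L : seq R) by exact: fset_uniq.
have pL : perm_eq ([seq l <- L | l \in L1] ++ [seq l <- L | l \notin L1]) L by rewrite (perm_filterC (mem L1)).
rewrite -(perm_big _ pL) big_cat /=.
have -> : \sum_(l <- [seq x <- L | x \in L1]) F l = \sum_(l <- L1) F l.
  apply/perm_big/uniq_perm; rewrite ?filter_uniq // => l.
  by rewrite mem_filter; case: (boolP (l \in L1)) => // /LL1 ->.
have -> (x y : C) : s - (x + y) = - (x - s) - y by ring.
apply: le_trans (cabsD _ _) _; rewrite !cabsN [er]splitr; apply: lerD => //.
apply: tail; first exact: filter_uniq.
by move=> l; rewrite mem_filter => /andP[/= nl _]; apply: contra nl; exact: sub.
Qed.

End UnconditionalSums.

(** * From multiplicities to the eta function *)

Section EtaSeries.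
Variables (R : realType) (mult : R -> nat) (n P : nat) (c d : R) (chi : nat -> R).
Local Notation C := (CC R).
Hypotheses (n0 : (0 < n)%N) (P3 : (3 <= P)%N) (c0 : 0 < c) (d0 : 0 < d) (bal : balanced n chi)
  (mult_sum : exists B : R, forall L : seq R, uniq L ->
     \sum_(l <- L | l != 0) (mult l)%:R * `|l| ^- P <= B)
  (mult_far : exists2 r : R, 0 < r & forall l, l != 0 -> (0 < mult l)%N -> r <= `|l|)
  (mult_node : forall m : nat, (mult (c * node d m))%:R - (mult (- (c * node d m)))%:R = chi m)
  (mult_off : forall l : R, 0 < l -> (forall m : nat, l != c * node d m) -> mult l = mult (- l)).

(** For |l| >= r and Re z >= P, |l|^(- Re z) <= r^(P - Re z) |l|^(-P). *)
Lemma eta_term_bound (z : C) : P%:R <= Re z -> exists2 K : R, 0 <= K & forall l, l != 0 ->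
  cabs (eta_term (mult l) l z) <= K * ((mult l)%:R * `|l| ^- P).
Proof.
move=> Pz; have [r r0 far] := mult_far.
exists (expR (- (Re z - P%:R) * ln r)); first exact: expR_ge0.
move=> l l0; rewrite /eta_term cabsM cabsM cabs_nat cabsR cabs_cpowR.
have [->|m0] := posnP (mult l); first by rewrite !mul0r mulr0.
have ll : 0 < `|l| by rewrite normr_gt0.
rewrite normr_sg l0 mulr1 mulrCA ler_wpM2l // ReN.
have -> : `|l| ^- P = expR (- (P%:R * ln `|l|)).
  by rewrite expRN expRM_natl lnK ?posrE.
rewrite -expRD ler_expR.
have : ln r <= ln `|l| by rewrite ler_ln ?posrE // far.
by move: (ln r) (ln `|l|) => x y xy; nra.
Qed.

Lemma node_inj : injective (fun m : nat => c * node d m).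
Proof.
move=> m m' /(mulfI (lt0r_neq0 c0)); rewrite /node => /addrI /(mulfI (lt0r_neq0 d0)).
by move/eqP; rewrite eqr_nat => /eqP.
Qed.

Let cn m := c * node d m.
Let G (z : C) l := ((mult l)%:R - (mult (- l))%:R) * cpowR l (- z).

Lemma cn_gt0 m : 0 < cn m. Proof. by rewrite mulr_gt0 // node_gt0. Qed.

Lemma eta_pair z l : 0 < l -> eta_term (mult l) l z + eta_term (mult (- l)) (- l) z = G z l.
Proof.
move=> l0; rewrite /eta_term normrN sgrN gtr0_norm // gtr0_sg // /G.
by rewrite (rmorphN (real_complex R)) rmorph1 mulr1 mulrN1 mulNr mulrBl.
Qed.

Lemma G_node z m : G z (cn m) = (chi m)%:C * cpowR (cn m) (- z).
Proof.
by rewrite /G -mult_node (rmorphB (real_complex R)) !rmorph_nat.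
Qed.

Lemma node_unbounded (x : R) : exists M0 : nat, forall m, (M0 <= m)%N -> x < cn m.
Proof.
exists (Num.truncn (`|x| / (c * d))).+1 => m Mm; rewrite /cn /node.
have cd : 0 < c * d by rewrite mulr_gt0.
have h : `|x| / (c * d) < m%:R.
  by apply: lt_le_trans (truncnS_gt _) _; rewrite ler_nat.
rewrite ltr_pdivrMr // in h.
have -> : c * (1 + d * m%:R) = c + m%:R * (c * d) by ring.
by apply: le_lt_trans (ler_norm x) (lt_le_trans h _); rewrite lerDr ltW.
Qed.

(** Over a set stable under l |-> - l the eta terms pair to (mult l - mult (- l)) l^(-z), which is
    the chi term at a node and 0 elsewhere. M is taken so large that the omitted nodes exceed every
    modulus in L0. *)
Lemma symmetric_sum z (L0 : seq R) : exists M0 : nat, forall M, (M0 <= M)%N -> exists L1 : seq R,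
  [/\ uniq L1, {in L0, forall l, l != 0 -> l \in L1} &
   \sum_(l <- L1) (if l != 0 then eta_term (mult l) l z else 0) = \sum_(m < M) (chi m)%:C * cpowR (cn m) (- z)].
Proof.
pose B := \sum_(l <- L0) `|l|.
have LB l : l \in L0 -> `|l| <= B.
  by move=> lL; rewrite /B (big_rem l lL) /= lerDl sumr_ge0.
have [M0 HM0] := node_unbounded B.
exists M0 => M MM; pose nodes := [seq cn m | m <- iota 0 M].
have un : uniq nodes by rewrite map_inj_uniq ?iota_uniq //; exact: node_inj.
(* The moduli from L0 which are not nodes; they are added to contain L0 and contribute 0. *)
pose extra := [seq l <- undup [seq `|l| | l <- L0] | (0 < l) && (l \notin nodes)].
pose pos := nodes ++ extra.
have posP l : l \in pos -> 0 < l.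
  rewrite mem_cat => /orP[/mapP [m _ ->]|]; first exact: cn_gt0.
  by rewrite mem_filter => /andP[/andP[]].
have upos : uniq pos.
  rewrite cat_uniq un filter_uniq ?undup_uniq // andbT /=.
  by apply/hasPn => l; rewrite mem_filter => /andP[/andP[]].
exists (pos ++ [seq - l | l <- pos]); split.
- rewrite cat_uniq upos map_inj_uniq; last exact: oppr_inj.
  rewrite upos andbT /=; apply/hasPn => _ /mapP [l /posP l0 ->].
  by apply/negP => /posP; rewrite oppr_gt0 ltNge ltW.
- move=> l lL l0; have ll : `|l| \in pos.
    rewrite mem_cat; case: (boolP (`|l| \in nodes)) => //= nl.
    by rewrite mem_filter nl normr_gt0 l0 mem_undup map_f.
  rewrite mem_cat; case: (ger0P l) ll => [_ ->//|_ ll].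
  by apply/orP; right; rewrite -[l]opprK map_f.
rewrite big_cat /= big_map -big_split /=.
rewrite (eq_big_seq (G z)); last first.
  by move=> l /posP l0; rewrite oppr_eq0 gt_eqF //= eta_pair.
rewrite big_cat /= [X in _ + X]big_seq [X in _ + X]big1; last first.
  move=> l; rewrite mem_filter => /andP[/andP[l0 nl]]; rewrite mem_undup => /mapP [l' lL lE].
  rewrite /G mult_off ?subrr ?mul0r // => m; apply: contra nl => /eqP lm; rewrite lm.
  apply: map_f; rewrite mem_iota add0n /= ltnNge; apply/negP => Mm.
  have := HM0 m (leq_trans MM Mm); have := LB _ lL.
  by rewrite -lE lm => lB; rewrite ltNge lB.
rewrite addr0 big_map -[in LHS](subn0 M) -/(index_iota 0 M) big_mkord.
by apply: eq_bigr => m _; exact: G_node.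
Qed.

Lemma eta_series : exists eta : C -> C,
  [/\ forall p, derivable eta p 1, eta 0 = (avg n chi)%:C &
   forall z, P%:R < Re z ->
     (fun L : {fset R} => \sum_(l <- L | l != 0) eta_term (mult l) l z) @ summability.totally --> eta z].
Proof.
have [eta [eta_d eta0 eta_s]] := dirichlet_continuation n0 d0 c0 bal.
exists eta; split=> // z Pz.
have [B HB] := mult_sum; have [K K0 HK] := eta_term_bound (ltW Pz).
pose F l : C := if l != 0 then eta_term (mult l) l z else 0.
have -> : (fun L : {fset R} => \sum_(l <- L | l != 0) eta_term (mult l) l z) = (fun L : {fset R} => \sum_(l <- L) F l).
  by apply/funext => L; rewrite big_mkcond.
apply: (@unconditional_sum R F (K * B)).
  move=> L uL; rewrite (eq_bigr (fun l => if l != 0 then cabs (eta_term (mult l) l z) else 0)); last first.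
    by move=> l _; rewrite /F; case: eqP; rewrite ?cabs0.
  rewrite -big_mkcond; apply: (@le_trans _ _ (\sum_(l <- L | l != 0) K * ((mult l)%:R * `|l| ^- P))).
    by apply: ler_sum => l l0; exact: HK.
  by rewrite -mulr_sumr ler_wpM2l // HB.
move=> e L0 e0; have z3 : 3 <= Re z.
  by apply: le_trans (ltW Pz); rewrite (ler_nat R 3).
have [M1 HM1] := eta_s z z3 e e0; have [M2 HM2] := symmetric_sum z L0.
have [L1 [uL1 sub E]] := HM2 (maxn M1 M2) (leq_maxr _ _).
have close : cabs (\sum_(l <- L1) F l - eta z) <= e by rewrite E; apply: HM1; exact: leq_maxl.
have [z1|z1] := boolP (0 \in L1).
  exists L1; split=> // l lL; have [->//|l0] := eqVneq l 0.
  exact: sub.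
exists (0 :: L1); split.
- by rewrite /= z1.
- move=> l lL; rewrite inE; have [//|l0] := eqVneq l 0.
  exact: sub.
- by rewrite big_cons {1}/F eqxx add0r.
Qed.

End EtaSeries.

(** * The eta invariants of the two spin structures *)

Section EtaInvariant.
Variables (R : realType) (k : nat) (M : CHD R k).
Local Notation n := k.*2.+1.
Local Notation C := (CC R).
Local Notation W := (spinor R k).
Local Notation index := {ffun 'I_k -> 'I_2}.

Lemma ex_half : ex (1 / 2 : R) = -1.
Proof.
apply: ReIm_eq; rewrite ?Re_ex ?Im_ex (_ : 2 * pi * (1 / 2) = pi) /=; try by field.
  by rewrite cospi.
by rewrite sinpi oppr0.
Qed.

(** Both alpha_+ and alpha_- have the form s alpha with s = e^(-2 pi i (c + delta)): c gives the
    sign (-1)^(k(k+1)/2), and delta the sign between the two. *)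
Variables (h : affine R k -> clifford R n) (delta s : R).
Local Notation c := (c_real R k).
Local Notation y := (s *: alpha R k).
Hypotheses (ok : odd k) (d01 : delta = 0 \/ delta = 1 / 2)
  (sE : s%:C = ex (- (c + delta))) (Hh : spin_structure M y h).

Lemma k_gt0 : (0 < k)%N. Proof. exact: odd_gt0. Qed.

Lemma c_real01 : c = 0 \/ c = 1 / 2.
Proof. by rewrite /c_real; case: ifP; [right|left]. Qed.

Lemma y_vec v (w : W) : cl_act y (cl_act (cl_vec M v) w) = cl_act (cl_vec M (chd_A M *m v)) (cl_act y w).
Proof. by rewrite !cl_actZl -!cl_actM alpha_vec cl_actM cl_actZr -cl_actM. Qed.

Lemma y_eig (w : W) : cl_act y (Bop w) = Bop (dg (fun I => ex (- ((kap c I + delta * n%:R) / n%:R))) w).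
Proof.
rewrite cl_actZl alpha_Bop -BopZ; congr Bop; apply/spinorP => I.
rewrite spZE !dgE mulrA sE -exD; congr (ex _ * _); rewrite /kap.
have : n%:R != 0 :> R by rewrite pnatr_eq0.
by move: (n%:R) => N N0; field.
Qed.

(** The eigenvalues of y^n are e^(-2 pi i (kap + delta n)); kap is an integer, and so is (n + 1)
    delta = (k + 1) 2 delta. *)
Lemma y_pow (w : W) : iter n (cl_act y) w = ex delta *: w.
Proof.
rewrite -[w](BVopK w); move: (BVop w) => {}w.
have H m : iter m (cl_act y) (Bop w) = Bop (dg (fun I => ex (m%:R * - ((kap c I + delta * n%:R) / n%:R))) w).
  elim: m => [|m IH].
    by congr Bop; apply/spinorP => I; rewrite dgE mul0r ex0 mul1r.
  rewrite iterS IH y_eig; congr Bop; apply/spinorP => I.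
  by rewrite !dgE mulrA -exD -natr1; congr (ex _ * _); ring.
rewrite H -BopZ; congr Bop; apply/spinorP => I; rewrite dgE spZE; congr (_ * _).
apply/ex_eq; rewrite mulrN mulrC divfK ?pnatr_eq0 //.
have -> : - (kap c I + delta * n%:R) - delta = - (kap c I + k.+1%:R * (2 * delta)).
  by rewrite -[n%:R]natr1 -muln2 natrM -natr1; ring.
rewrite rpredN rpredD ?kap_int // rpredM ?rpred_nat // int_half //.
Qed.

(** q is kept apart from l so that the multiplicities of l and - l are taken over the same finite
    set of characters. *)
Definition multq (q l : R) : nat := emult y k_gt0 (@char_val_char R k M delta d01 q)
  (@char_val_norm R k M delta d01 q) (@char_val_all R k M delta d01 q) l.
Definition mult l := multq (l ^+ 2) l.

Lemma mult_has_dim l : has_dim (eigenspinors M h l) (mult l).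
Proof.
by apply: (has_dim_emult k_gt0 Hh y_pow d01) => //; exact: char_val_inj.
Qed.

(* the part of the multiplicity of 2 pi l due to characters on the axis *)
Definition axis_mult l : nat := if `[< l - delta \is a Num.int >] then (2 * #|axis_set k delta c l|)%N else 0%N.

Lemma mult_pair l : l != 0 ->
  (mult (2 * pi * l))%:R - (mult (- (2 * pi * l)))%:R = (axis_mult l)%:R - (axis_mult (- l))%:R :> R.
Proof.
move=> l0; rewrite /mult sqrrN /multq !emult_split.
rewrite (part_off_opp k_gt0 y_vec) -mulrN.
rewrite !(dim_part_axis k_gt0 y_eig); [|exact: char_val_inj|exact: char_val_inj].
rewrite !natrD opprD addrACA subrr add0r; set q := (2 * pi * l) ^+ 2.
have qN : (2 * pi * - l) ^+ 2 = q by rewrite mulrN sqrrN.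
have cg m : (2 * pi * m) ^+ 2 = q -> m != 0 -> #|good M delta c (@char_val R k M delta q) m| = axis_mult m.
  move=> mq m0; apply: (card_good ok k_gt0 d01 c_real01 (@char_val_inj _ _ _ _ q) _ _ mq m0).
    exact: char_val_char.
  exact: char_val_all.
by rewrite !cg // oppr_eq0.
Qed.

Lemma mult_le l : (mult l <= size (char_seq M delta (l ^+ 2)) * #|{: index}|)%N.
Proof.
rewrite /mult /multq /emult -(card_char_ix M delta).
apply: leq_trans (dimvS (subvf _)) _; rewrite dimvf.
by rewrite -[X in (_ <= _ * X)%N]muln1.
Qed.

Lemma mult_sum : exists B : R, forall L : seq R, uniq L ->
  \sum_(l <- L | l != 0) (mult l)%:R * `|l| ^- (2 * n) <= B.
Proof.
have [B HB] := char_sum_bound M d01; exists (#|{: index}|%:R * B) => L uL.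
apply: le_trans (ler_wpM2l _ (HB L uL)); last by [].
rewrite mulr_sumr; apply: ler_sum => l _; rewrite mulrA ler_wpM2r ?invr_ge0 ?exprn_ge0 //.
by rewrite -natrM ler_nat mulnC mult_le.
Qed.

Lemma mult_far : exists2 r : R, 0 < r & forall l, l != 0 -> (0 < mult l)%N -> r <= `|l|.
Proof.
have [r r0 Hr] := char_seq_far M d01; exists r => // l l0 ml; apply: Hr => //.
by have := leq_trans ml (mult_le l); rewrite muln_gt0 => /andP[].
Qed.

Lemma axis_mult_periodic l (z : int) : axis_mult (l + z%:~R * n%:R) = axis_mult l.
Proof.
rewrite /axis_mult axis_set_periodic; congr (if _ then _ else _); congr asbool.
apply/propext; have -> : l + z%:~R * n%:R - delta = l - delta + z%:~R * n%:R by ring.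
by rewrite rpredDr // rpredM ?intr_int ?rpred_nat.
Qed.

(* the positive numbers of Z - delta are m + first_node, and 2 delta is an integer *)
Definition first_node : R := 1 - delta.
Definition axis_char (m : nat) : R :=
  (axis_mult (m%:R + first_node))%:R - (axis_mult (- (m%:R + first_node)))%:R.

Lemma first_node_gt0 : 0 < first_node.
Proof. by rewrite /first_node; case: d01 => ->; lra. Qed.

Lemma axis_char_periodic m : axis_char (m + n) = axis_char m.
Proof.
rewrite /axis_char -(axis_mult_periodic (m%:R + first_node) 1) -(axis_mult_periodic (- (m%:R + first_node)) (-1)).
by rewrite natrD; congr (_%:R - _%:R); congr axis_mult; rewrite ?rmorphN rmorph1; ring.
Qed.

Lemma eta_invariant_axis : \sum_(m < n) axis_char m = 0 -> eta_invariant M h (avg n axis_char)%:C.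
Proof.
move=> bal; have f0 := first_node_gt0; have pi2 : 0 < 2 * pi :> R by rewrite mulr_gt0 ?pi_gt0.
(* The eigenvalues 2 pi (m + [first_node]) in the normalized form c (1 + d m). *)
have nodeE m : 2 * pi * first_node * node (first_node^-1) m = 2 * pi * (m%:R + first_node).
  by rewrite /node -!mulrA; congr (2 * (pi * _)); move: first_node (lt0r_neq0 f0) => f fn; field.
have P3 : (3 <= 2 * n)%N by have := k_gt0; lia.
have [eta [eta_d eta0 eta_s]] : exists eta : C -> C,
  [/\ forall p, derivable eta p 1, eta 0 = (avg n axis_char)%:C &
   forall z, (2 * n)%:R < Re z ->
     (fun L : {fset R} => \sum_(l <- L | l != 0) eta_term (mult l) l z) @ summability.totally --> eta z].
  apply: (@eta_series _ mult n (2 * n) (2 * pi * first_node) first_node^-1) => //.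
  - exact: mulr_gt0.
  - by rewrite invr_gt0.
  - by split=> // m; exact: axis_char_periodic.
  - exact: mult_sum.
  - exact: mult_far.
  - by move=> m; rewrite nodeE mult_pair // gt_eqF // ltr_wpDl.
  move=> l l0 off; pose l' := l / (2 * pi).
  have l'0 : 0 < l' by rewrite divr_gt0.
  have lE : l = 2 * pi * l' by rewrite mulrC divfK // gt_eqF.
  have twod := int_half d01.
  have nint : ~ l' - delta \is a Num.int.
    move=> li; have : l' - first_node \is a Num.int.
      have -> : l' - first_node = l' - delta + 2 * delta - 1 by rewrite /first_node; ring.
      exact: (rpredB (rpredD li twod) (rpred1 _)).
    (* l' > 0 and [first_node] <= 1 give z > -1, so l would be the node of index z. *)
    move=> /intrP [z zE]; have z0 : (0 <= z).
      have : -1 < z%:~R :> R by rewrite -zE /first_node; case: d01 => ->; lra.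
      by rewrite -(mulrN1z 1) ltr_int; lia.
    have := off `|z|%N; rewrite nodeE lE; move/eqP; apply; congr (_ * _).
    by rewrite natr_absz ger0_norm // -zE subrK.
  have nint' : ~ - l' - delta \is a Num.int.
    move=> li; apply: nint; have -> : l' - delta = - (- l' - delta + 2 * delta) by ring.
    by rewrite rpredN rpredD.
  have l'n : l' != 0 by rewrite gt_eqF.
  have := mult_pair l'n; rewrite -lE /axis_mult !asboolF // subrr => /eqP.
  by rewrite subr_eq0 eqr_nat => /eqP.
exists mult, eta; split=> //.
- by move=> l _; exact: mult_has_dim.
- by exists (2 * n)%:R.
(* The continuation is entire: no pole, exponent 0. *)
- move=> p; exists 0%N, eta; split; first exact: (@filterE C (nbhs p) _ _ eta_d).
  by apply: (@filterE C (nbhs p^')) => z; rewrite expr0 divr1.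
- exact: (@filterE C (nbhs (0 : C)) _ _ eta_d).
Qed.

End EtaInvariant.

Lemma alpha_plusE (R : realType) (k : nat) : alpha_plus R k = ((-1) ^+ weight k : R) *: alpha R k.
Proof. by rewrite /alpha_plus -/(weight k) -signr_odd -[in RHS]signr_odd; case: (odd _); rewrite ?expr1 ?expr0 ?mulN1r ?scaleN1r ?mul1r ?scale1r. Qed.

Theorem theorem1 (R : realType) (k : nat) (hk : odd k) (M : CHD R k)
    (h_plus h_minus : affine R k -> clifford R k.*2.+1)
    (Hplus : spin_structure M (alpha_plus R k) h_plus)
    (Hminus : spin_structure M (alpha_minus R k) h_minus) :
  let n := k.*2.+1 in
  [/\ forall eps : {ffun 'I_k -> bool}, half_mu eps \is a Num.int,
      eta_invariant M h_plus
        (\sum_(1 <= r < n) (A_plus k r)%:R * (1 - (2 * r)%:R / n%:R) : R)%:C &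
      eta_invariant M h_minus
        (\sum_(0 <= r < n) (A_minus k r)%:R * (1 - (2 * r + 1)%:R / n%:R) : R)%:C].
Proof.
move=> n; split; first exact: half_mu_int.
- have d01 : (0 : R) = 0 \/ (0 : R) = 1 / 2 by left.
  rewrite alpha_plusE in Hplus.
  have sE : ((-1) ^+ weight k : R)%:C = ex (- (c_real R k + 0)).
    rewrite /c_real -signr_odd; case: (odd _); last by rewrite expr0 addr0 oppr0 ex0.
    by rewrite expr1 addr0 exN ex_half invrN1 (rmorphN (real_complex R)) rmorph1.
  have per m : (A_plus k (m + n))%:R = (A_plus k m)%:R :> R.
    by rewrite !(A_plus_axis R) -(axis_set_periodic k 0 _ m%:R 1) mul1r natrD.
  (* Modulo n, - (m + 1) is n - 1 - m. *)
  have chiE m : (m < n)%N -> axis_char k 0 m = (A_plus k m.+1)%:R - (A_plus k (n.-1 - m))%:R :> R.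
    move=> mn; rewrite /axis_char /first_node subr0 natr1 !(A_plus_axis R); congr (_%:R - _%:R).
      by rewrite /axis_mult asboolT // subr0 rpred_nat.
    rewrite -(axis_mult_periodic _ _ _ 1) mul1r.
    have -> : - m.+1%:R + n%:R = (n.-1 - m)%:R :> R.
      have -> : n%:R = (m.+1 + (n.-1 - m))%:R :> R by congr (_%:R); rewrite /n in mn *; lia.
      by rewrite natrD; ring.
    by rewrite /axis_mult asboolT // subr0 rpred_nat.
  have [bal <-] := avg_full_shift (ltn0Sn _) per chiE.
  exact: (eta_invariant_axis hk d01 sE Hplus bal).
have d01 : (1 / 2 : R) = 0 \/ (1 / 2 : R) = 1 / 2 by right.
rewrite /alpha_minus alpha_plusE -scaleNr in Hminus.
have sE : (- (-1) ^+ weight k : R)%:C = ex (- (c_real R k + 1 / 2)).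
  rewrite /c_real -signr_odd opprD exD [X in _ * X]exN ex_half invrN1 (rmorphN (real_complex R)) mulrN1; congr (- _).
  case: (odd _); last by rewrite expr0 oppr0 ex0.
  by rewrite expr1 exN ex_half invrN1 (rmorphN (real_complex R)) rmorph1.
(* Modulo n, - (m + 1/2) is (n - 1 - m) + 1/2. *)
have chiE m : (m < n)%N -> axis_char k (1 / 2) m = (A_minus k m)%:R - (A_minus k (n.-1 - m))%:R :> R.
  move=> mn; rewrite /axis_char /first_node !(A_minus_axis R); congr (_%:R - _%:R).
    have -> : m%:R + (1 - 1 / 2) = m%:R + 1 / 2 :> R by field.
    by rewrite /axis_mult asboolT // addrK rpred_nat.
  rewrite -(axis_mult_periodic _ _ _ 1).
  have -> : - (m%:R + (1 - 1 / 2)) + 1%:~R * k.*2.+1%:R = (n.-1 - m)%:R + 1 / 2 :> R.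
    rewrite [1%:~R * _]mul1r; have -> : k.*2.+1%:R = (m.+1 + (n.-1 - m))%:R :> R by congr (_%:R); rewrite /n in mn *; lia.
    by rewrite natrD -natr1; field.
  by rewrite /axis_mult asboolT // addrK rpred_nat.
have [bal <-] := avg_half_shift (ltn0Sn _) chiE.
exact: (eta_invariant_axis hk d01 sE Hminus bal).
Qed.
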